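(* Let $r=r(n)>0$ and let $G\in\mathcal{G}(n,r)$ be the random geometric graph in the plane. All limits are as $n\to\infty$. Let $$\mu=\mu(C_5)=\frac{1}{5!}\int_{(\mathbb{R}^2)^4}\mathbf{1}\big[\text{the geometric graph on the points } \mathbf{0},\mathbf{x}_1,\mathbf{x}_2,\mathbf{x}_3,\mathbf{x}_4 \text{ with threshold } 1 \text{ is isomorphic to } C_5\big]\,d\mathbf{x}_1\,d\mathbf{x}_2\,d\mathbf{x}_3\,d\mathbf{x}_4,$$ which is a constant with $\mu>0$. Then: (1) if $nr^2\to 0$ then $\chi_c(G)=1$ with high probability; (2) if $nr^2\to c$, where $0<c<\infty$, then $\Pr(\chi_c(G)=1)\to e^{-(\pi/2)c}$ and $\Pr(\chi_c(G)=2)\to 1-e^{-(\pi/2)c}$; (3) if $nr^2\to\infty$ and $nr^8\to 0$ then $\chi_c(G)=2$ with high probability; (4) if $nr^8\to c$, where $0<c<\infty$, then $\Pr(\chi_c(G)=2)\to e^{-\mu c}$ and $\Pr(\chi_c(G)=3)\to 1-e^{-\mu c}$; (5) if $nr^8\to\infty$ and $r\le 0.46\sqrt{\log n}$ then $\chi_c(G)\ge 3$ with high probability; (6) if $r\ge 9.27\sqrt{\log n}$ then $\chi_c(G)=2$ with high probability.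
   Context: Graphs are finite and simple. A clique in a graph is a set of pairwise adjacent vertices; it is maximal if it is not a proper subset of another clique. A clique colouring of $G$ is a colouring of the vertices such that no maximal clique is monochromatic, ignoring isolated vertices (that is, no maximal clique with at least two vertices is monochromatic). The clique chromatic number $\chi_c(G)$ is the least number of colours in a clique colouring of $G$ (if $G$ has no edges, $\chi_c(G)=1$). Given points $\mathbf{x}_1,\ldots,\mathbf{x}_n$ in the plane and a threshold $r>0$, the corresponding geometric graph has vertex set $\{v_1,\ldots,v_n\}$, and for $i\ne j$ the vertices $v_i,v_j$ are adjacent exactly when the Euclidean distance $d(\mathbf{x}_i,\mathbf{x}_j)\le r$. The random geometric graph $\mathcal{G}(n,r)$ is the geometric graph with threshold $r$ obtained from $n$ random points sampled independently and uniformly in the square $\mathcal{S}_n=[-\sqrt{n}/2,\sqrt{n}/2]^2$. Events $A_n$ hold with high probability if $\Pr(A_n)\to 1$ as $n\to\infty$. $C_5$ is the cycle on 5 vertices, and $\log$ is the natural logarithm. The constant $\mu(C_5)$ is the asymptotic expected number of components of $G$ isomorphic to $C_5$ in the case $nr^8\to 1$. *)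

(* Defs.v *)
From HB Require Import structures.
From mathcomp Require Import all_boot all_order all_algebra.
From mathcomp Require Import all_classical all_reals all_analysis.

Set Implicit Arguments.
Unset Strict Implicit.
Unset Printing Implicit Defensive.

Import Order.TTheory GRing.Theory Num.Theory.
Import numFieldNormedType.Exports.

Local Open Scope classical_set_scope.
Local Open Scope ring_scope.

Record sgraph (V : finType) := SGraph {
  adj :> rel V;
  adj_sym : symmetric adj;
  adj_irr : irreflexive adj }.

Definition graph_iso (V W : finType) (G : sgraph V) (H : sgraph W) : Prop :=
  exists2 f : V -> W, bijective f & forall u v, G u v = H (f u) (f v).

Section CliqueColouring.
Variables (V : finType) (G : sgraph V).

Definition clique (S : {set V}) : bool :=
  [forall u in S, forall v in S, (u != v) ==> G u v].

Definition maximal_clique (S : {set V}) : bool := maxset clique S.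

Definition monochromatic k (f : {ffun V -> 'I_k}) (S : {set V}) : bool :=
  [forall u in S, forall v in S, f u == f v].

Definition clique_colouring k (f : {ffun V -> 'I_k}) : bool :=
  [forall S : {set V},
     maximal_clique S && (1 < #|S|)%N ==> ~~ monochromatic f S].

Definition clique_colourable (k : nat) : bool :=
  [exists f : {ffun V -> 'I_k}, clique_colouring f].

Lemma clique_colourable_ex : exists k, (0 < k)%N && clique_colourable k.
Proof.
exists #|V|.+1; apply/existsP.
exists [ffun v => widen_ord (leqnSn _) (enum_rank v)].
apply/forallP => S; apply/implyP => /andP[_ /card_gt1P[u [v [uS vS uv]]]].
apply/negP => /forall_inP /(_ u uS) /forall_inP /(_ v vS).
rewrite !ffunE => /eqP /(congr1 val) /= /ord_inj /enum_rank_inj e.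
by rewrite e eqxx in uv.
Qed.

(** The condition [0 < k] only matters when [V] is empty: a graph with no edges
    has clique chromatic number 1. *)
Definition clique_chromatic_number : nat := ex_minn clique_colourable_ex.

End CliqueColouring.

Definition C5_adj : rel 'I_5 :=
  fun i j => (j == i.+1 %[mod 5]) || (i == j.+1 %[mod 5]).

Lemma C5_adj_sym : symmetric C5_adj.
Proof. by move=> i j; rewrite /C5_adj orbC. Qed.

Lemma C5_adj_irr : irreflexive C5_adj.
Proof. by move=> [[|[|[|[|[|i]]]]] hi]. Qed.

Definition C5 : sgraph 'I_5 := SGraph C5_adj_sym C5_adj_irr.

(** [measurableTypeR R] is [R] equipped with its Borel sets, the type on which
    [lebesgue_measure] is defined. *)
Notation plane R := (measurableTypeR R * measurableTypeR R)%type.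

(** The library norm on [R * R] is the sup norm, hence an explicit Euclidean
    distance. *)
Definition edist (R : realType) (x y : R * R) : R :=
  Num.sqrt ((x.1 - y.1) ^+ 2 + (x.2 - y.2) ^+ 2).

Section GeometricGraph.
Variables (R : realType) (V : finType) (x : V -> R * R) (r : R).

Definition geom_adj : rel V :=
  fun i j => (i != j) && (edist (x i) (x j) <= r).

Lemma geom_adj_sym : symmetric geom_adj.
Proof.
move=> i j; rewrite /geom_adj eq_sym /edist.
by rewrite -[(x j).1 - _]opprB -[(x j).2 - _]opprB !sqrrN.
Qed.

Lemma geom_adj_irr : irreflexive geom_adj.
Proof. by move=> i; rewrite /geom_adj eqxx. Qed.

Definition geom_graph : sgraph V := SGraph geom_adj_sym geom_adj_irr.

End GeometricGraph.

Local Open Scope ereal_scope.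

Definition area (R : realType) : set (plane R) -> \bar R :=
  @lebesgue_measure R \x @lebesgue_measure R.

HB.instance Definition _ (R : realType) := Measure.on (@area R).

(** Proved here because canonical inference does not find the sigma-finiteness
    of a product of two Lebesgue measures. *)
Lemma area_sigma_finite (R : realType) : sigma_finite setT (@area R).
Proof.
have /sigma_finiteP[F [TF ndF Foo]] := sigma_finiteT (@lebesgue_measure R).
exists (fun n => F n `*` F n).
  rewrite -setXTT TF predeqE => -[x y]; split.
    move=> [/= [n _ Fnx] [k _ Fky]]; exists (maxn n k) => //; split.
    - by move: x Fnx; exact/subsetPset/ndF/leq_maxl.
    - by move: y Fky; exact/subsetPset/ndF/leq_maxr.
  by move=> [n _ []/= ? ?]; split; exists n.
move=> k; have [? ?] := Foo k; split; first exact: measurableX.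
rewrite /area product_measure1E//.
by rewrite lte_mul_pinfty// ge0_fin_numE.
Qed.

HB.instance Definition _ (R : realType) :=
  Measure_isSigmaFinite.Build _ _ _ (@area R) (@area_sigma_finite R).

Definition mutually_independent d (T : measurableType d) (R : realType)
    (P : probability T R) d' (T' : measurableType d') (I : finType)
    (X : I -> {RV P >-> T'}) : Prop :=
  forall (J : {set I}) (B : I -> set T'), (forall i, measurable (B i)) ->
    P (\bigcap_(i in [set` J]) (X i @^-1` B i))
    = \prod_(i in J) P (X i @^-1` B i).

Definition uniform_on d (T : measurableType d) (R : realType)
    (P : probability T R) (S : set (plane R)) (X : {RV P >-> plane R}) :
    Prop :=
  forall B : set (plane R), measurable B ->
    distribution P X B = area (B `&` S) * ((fine (area S))^-1)%:E.

Definition square (R : realType) (n : nat) : set (plane R) :=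
  let a : R := (Num.sqrt n%:R / 2)%R in
  `[(- a)%R, a]%classic `*` `[(- a)%R, a]%classic.

Definition iid_uniform_square d (T : measurableType d) (R : realType)
    (P : probability T R) (n : nat) (X : 'I_n -> {RV P >-> plane R}) :
    Prop :=
  mutually_independent X /\ (forall i, uniform_on (square n) (X i)).

Definition rgg d (T : measurableType d) (R : realType) (P : probability T R)
    (n : nat) (X : 'I_n -> {RV P >-> plane R}) (r : R) (w : T) :
    sgraph 'I_n :=
  geom_graph (fun i => X i w) r.

Definition five_points (R : realType)
    (x : plane R * plane R * plane R * plane R) : 'I_5 -> R * R :=
  tnth [tuple (0%R, 0%R); x.1.1.1; x.1.1.2; x.1.2; x.2].

(** As for every [Rintegral], an infinite integral would count as 0; so
    [0 < mu_C5 R] entails that the integral is finite. *)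
Definition mu_C5 (R : realType) : R :=
  ((5`!%:R)^-1 *
   \int[@area R \x @area R \x @area R \x @area R]_x
      \1_[set x | graph_iso (geom_graph (five_points x) 1) C5] x)%R.

(* Main.v *)
(** When [n r ^ 8] is bounded, no six points are close to each other with high
    probability, so all components have at most five vertices; then [chi_c] is
    1 without edges, 3 if some component is an induced C5, and 2 otherwise (a
    finite check). The probability of having no edge, or no induced C5, is
    estimated by revealing the possible positions one after the other: the
    error is a first moment of pairs of overlapping positions.

    If [n r ^ 8] is large and [r <= 0.46 sqrt (log n)], a second moment argument
    over disjoint blocks finds five points forming a C5, near the vertices of a
    fixed pentagon, such that no other point is adjacent to two consecutive
    ones. Its five edges are then maximal cliques, so two colours do not suffice.

    If [r >= 9.27 sqrt (log n)], all cells of a fine grid contain a point and the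
    checkerboard colouring of the cells works, since the cells met by a maximal
    clique include two adjacent ones. *)
From Stdlib Require Import ZArith.
From HB Require Import structures.
Require Import Defs.
From mathcomp Require Import all_boot all_order all_algebra.
From mathcomp Require Import all_classical all_reals all_analysis.
From mathcomp Require Import measurable_realfun.
From mathcomp Require Import ssrZ zify ring lra.

Set Implicit Arguments.
Unset Strict Implicit.
Unset Printing Implicit Defensive.

(** * Graphs with at most five vertices *)

(** The geometry never relies on exact positions: one pentagon has its five vertices range over unit
    cells, and integer arithmetic decides adjacency and covers the common neighbourhoods for all
    positions in the cells at once. The same pentagon shows that mu is positive and supplies the
    isolated pentagons.

    Their expected number is at least a constant times n r^8 exp(-4.69 r^2). For r <= 1 this has
    order n r^8; for r > 1 it is at least a constant times n^0.0075, because 4.69 * 0.46^2 < 0.9925.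
    So n r^8 -> infinity takes care of small radii and 0.46 of large ones. Pentagons in different
    blocks are nearly independent: all but ten points must avoid both regions, and avoiding two
    disjoint regions is negatively correlated; the ten remaining points cost a factor (1 -
    delta)^-10, which tends to 1.

    When n r^2 -> infinity, the absence of edges follows by monotonicity: on the same points a
    larger radius only adds edges, so a comparison with n r^2 = c for large c suffices. *)

Section FiveVertexCheck.

(* Strict evaluation by [vm_compute] would not stop [has] and [all] early. *)
Fixpoint lazy_has T (a : pred T) (s : seq T) : bool :=
  if s is x :: s' then if a x then true else lazy_has a s' else false.

Fixpoint lazy_all T (a : pred T) (s : seq T) : bool :=
  if s is x :: s' then if a x then lazy_all a s' else false else true.

Lemma lazy_hasE T (a : pred T) s : lazy_has a s = has a s.
Proof. by elim: s => //= x s ->; case: (a x). Qed.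

Lemma lazy_allE T (a : pred T) s : lazy_all a s = all a s.
Proof. by elim: s => //= x s ->; case: (a x). Qed.

Fixpoint words T (s : seq T) (n : nat) : seq (seq T) :=
  if n is n'.+1 then [seq x :: w | x <- s, w <- words s n'] else [:: [::]].

Lemma wordsP (T : eqType) (s w : seq T) :
  all [in s] w -> w \in words s (size w).
Proof.
elim: w => //= x w ih /andP[xs /ih ww].
by apply/allpairsP; exists (x, w).
Qed.

Lemma words_mem (T : eqType) (s : seq T) n w :
  w \in words s n -> size w = n /\ all [in s] w.
Proof.
elim: n w => [|n ih] w; first by rewrite inE => /eqP ->.
by move=> /allpairsP[[x v] /= [xs /ih [<- av] ->]]; rewrite /= xs av.
Qed.

(** One bit for each unordered pair codes a graph on five labelled vertices, so symmetry and
    irreflexivity are built in. *)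
Definition pairs5 : seq (nat * nat) :=
  [:: (0,1); (0,2); (0,3); (0,4); (1,2); (1,3); (1,4); (2,3); (2,4); (3,4)].

Definition code_adj (b : seq bool) (i j : nat) : bool :=
  if i == j then false
  else nth false b (index (minn i j, maxn i j) pairs5).

(** The mask [m] selects a vertex set, which is bad for [c] only if it is a monochromatic clique
    with at least two vertices and no vertex is adjacent to all of it. Members of the set never pass
    this last test, since they are not adjacent to themselves. *)
Definition code_good (b : seq bool) (c : seq nat) (m : seq bool) : bool :=
  let S := [seq i <- iota 0 5 | nth false m i] in
  if 1 < size S then
    if lazy_all (fun i => lazy_all (fun j =>
         if i == j then true else code_adj b i j) S) S
    then if lazy_all (fun i => lazy_all (fun j =>
              nth 0 c i == nth 0 c j) S) S
         then lazy_has (fun v => lazy_all (fun i => code_adj b v i) S) (iota 0 5)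
         else true
    else true
  else true.

Definition code_colourable (k : nat) (b : seq bool) : bool :=
  let ms := words [:: true; false] 5 in
  lazy_has (fun c => lazy_all (code_good b c) ms) (words (iota 0 k) 5).

Definition nat_C5 (i j : nat) : bool :=
  (j == i.+1 %[mod 5]) || (i == j.+1 %[mod 5]).

(** A rotation of the cycle brings vertex 0 to the front, so only the order of the four others
    varies. *)
Definition code_C5 (b : seq bool) : bool :=
  lazy_has (fun s => if uniq s then
      lazy_all (fun i => lazy_all (fun j =>
        code_adj b (nth 0 s i) (nth 0 s j) == nat_C5 i j) (iota 0 5)) (iota 0 5)
    else false) [seq 0 :: s | s <- permutations (iota 1 4)].

(** Smaller graphs are included: padded with isolated vertices, they are among these 1024 codes. *)
Lemma code_check : all (fun b =>
    (if code_C5 b then true else code_colourable 2 b) && code_colourable 3 b)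
  (words [:: true; false] 10).
Proof. by vm_compute. Qed.

End FiveVertexCheck.

Lemma C5_triangle_free (i j k : 'I_5) : ~~ [&& C5 i j, C5 k i & C5 k j].
Proof.
have /allP/(_ (val i)) : all (fun i => all (fun j => all (fun k =>
    ~~ [&& nat_C5 i j, nat_C5 k i & nat_C5 k j])
  (iota 0 5)) (iota 0 5)) (iota 0 5) by vm_compute.
rewrite mem_iota ltn_ord => /(_ isT)/allP/(_ (val j)).
rewrite mem_iota ltn_ord => /(_ isT)/allP/(_ (val k)).
by rewrite mem_iota ltn_ord => /(_ isT).
Qed.

(** * Maximal cliques and the clique chromatic number *)

Section CliqueChromatic.
Variables (V : finType) (G : sgraph V).
Implicit Types (S : {set V}).

Lemma cliqueP S :
  reflect (forall u v, u \in S -> v \in S -> u != v -> G u v) (clique G S).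
Proof.
apply: (iffP forall_inP) => [h u v uS vS uv|h u uS].
  by have /forall_inP/(_ v vS)/implyP/(_ uv) := h u uS.
by apply/forall_inP => v vS; apply/implyP; exact: h.
Qed.

Lemma monochromaticP k (f : {ffun V -> 'I_k}) S :
  reflect (forall u v, u \in S -> v \in S -> f u = f v) (monochromatic f S).
Proof.
apply: (iffP forall_inP) => [h u v uS vS|h u uS].
  by have /forall_inP/(_ v vS)/eqP := h u uS.
by apply/forall_inP => v vS; apply/eqP/h.
Qed.

Lemma clique_chromatic_leq k :
  0 < k -> clique_colourable G k -> clique_chromatic_number G <= k.
Proof.
by move=> k0 Gk; rewrite /clique_chromatic_number; case: ex_minnP => m _; apply;
  rewrite k0.
Qed.

Lemma clique_chromatic_gt0 : 0 < clique_chromatic_number G.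
Proof. by rewrite /clique_chromatic_number; case: ex_minnP => m /andP[]. Qed.

Lemma clique_chromatic_colourable :
  clique_colourable G (clique_chromatic_number G).
Proof. by rewrite /clique_chromatic_number; case: ex_minnP => m /andP[]. Qed.

Lemma clique_colourableW k l : k <= l ->
  clique_colourable G k -> clique_colourable G l.
Proof.
move=> kl /existsP[f fP]; apply/existsP.
exists [ffun v => widen_ord kl (f v)].
apply/forallP => S; apply/implyP => hS.
apply: contraNN (implyP (forallP fP S) hS) => /monochromaticP h.
by apply/monochromaticP => u v uS vS; have := h u v uS vS; rewrite !ffunE =>
  /(congr1 val) /= /val_inj.
Qed.

Lemma clique_ext S : clique G S -> exists2 M : {set V},
  maximal_clique G M & S \subset M.
Proof. by move=> /maxset_exists[M]; exists M. Qed.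

Lemma maximal_cliqueP S : maximal_clique G S ->
  clique G S /\ forall v, (forall u, u \in S -> u != v -> G u v) -> v \in S.
Proof.
move=> /maxsetP[cS mS]; split => // v h.
rewrite -(mS (v |: S)) ?setU11 ?finset.subsetUr//.
apply/cliqueP => x y /setU1P[->|xS] /setU1P[->|yS] xy.
- by rewrite eqxx in xy.
- by rewrite adj_sym h // eq_sym.
- exact: h.
- by move/cliqueP: cS; apply.
Qed.

Lemma clique_pair u v : G u v -> clique G [set u; v].
Proof.
move=> uv; apply/cliqueP => x y /set2P[]-> /set2P[]->; rewrite ?eqxx//.
by rewrite adj_sym.
Qed.

Lemma adj_neq u v : G u v -> u != v.
Proof. by apply: contraTneq => ->; rewrite adj_irr. Qed.

Lemma clique_chromatic_eq1 :
  clique_chromatic_number G = 1 <-> forall u v, ~~ G u v.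
Proof.
split=> [e u v|h].
  have := clique_chromatic_colourable; rewrite e => /existsP[f /forallP fP].
  apply/negP => uv; have [M mM /fintype.subsetP sM] := clique_ext (clique_pair uv).
  have /implyP := fP M; rewrite mM /= => /(_ _)/negP; apply.
    by apply/card_gt1P; exists u, v; rewrite !sM ?in_set2 ?eqxx ?orbT ?adj_neq.
  by apply/monochromaticP => x y _ _; rewrite !ord1.
apply/eqP; rewrite eqn_leq clique_chromatic_gt0 andbT.
apply: clique_chromatic_leq => //; apply/existsP; exists [ffun=> ord0].
apply/forallP => S; apply/implyP => /andP[mS /card_gt1P[u [v [uS vS uv]]]].
have /cliqueP/(_ u v uS vS uv) := (maximal_cliqueP mS).1.
by rewrite (negbTE (h u v)).
Qed.

Definition induced_C5 (g : 'I_5 -> V) : Prop :=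
  forall i j, G (g i) (g j) = C5 i j.

(* An edge without common neighbour is a maximal clique, so a clique
   2-colouring would properly 2-colour the odd cycle. *)
Lemma induced_C5_chromatic_ge3 (g : 'I_5 -> V) : induced_C5 g ->
  (forall i j w, C5 i j -> ~~ (G w (g i) && G w (g j))) ->
  3 <= clique_chromatic_number G.
Proof.
move=> gC nc; rewrite ltnNge; apply/negP => le2.
have /existsP[f /forallP fP] := clique_colourableW le2 clique_chromatic_colourable.
have fN i j : C5 i j -> f (g i) != f (g j).
  move=> ij; have uv : G (g i) (g j) by rewrite gC.
  have [M mM /fintype.subsetP sM] := clique_ext (clique_pair uv).
  have iM : g i \in M by rewrite sM// in_set2 eqxx.
  have jM : g j \in M by rewrite sM// in_set2 eqxx orbT.
  have MS w : w \in M -> w = g i \/ w = g j.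
    move=> wM; have [->|wi] := eqVneq w (g i); first by left.
    have [->|wj] := eqVneq w (g j); first by right.
    have /cliqueP cM := (maximal_cliqueP mM).1.
    by have := nc i j w ij; rewrite !cM.
  have /implyP := fP M; rewrite mM /= => /(_ _)/negP => h.
  apply/eqP => e; apply: h.
    by apply/card_gt1P; exists (g i), (g j); rewrite iM jM adj_neq.
  by apply/monochromaticP => x y /MS[]-> /MS[]->.
have two (a b c : 'I_2) : a != b -> b != c -> a = c.
  case: a b c => [[|[|a]] ha] [[|[|b]] hb] [[|[|c]] hc] //= _ _; exact: val_inj.
pose o i : 'I_5 := inord i.
have E i j : i < 5 -> j < 5 -> nat_C5 i j -> f (g (o i)) != f (g (o j)).
  by move=> i5 j5 ij; apply: fN; rewrite /= /C5_adj !inordK.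
have e1 := two _ _ _ (E 0 1 isT isT isT) (E 1 2 isT isT isT).
have e2 := two _ _ _ (E 2 3 isT isT isT) (E 3 4 isT isT isT).
by have := E 4 0 isT isT isT; rewrite e1 e2 eqxx.
Qed.

End CliqueChromatic.

(** * Colouring graphs whose components have at most five vertices *)

Section SmallComponents.
Variables (V : finType) (G : sgraph V).

Definition component (x : V) : {set V} := [set y | connect G x y].

Hypothesis small : forall x, #|component x| <= 5.

Let idx (x : V) (i : nat) : V := nth x (enum (component x)) i.

Let size_enum x : size (enum (component x)) = #|component x|.
Proof. by rewrite cardE. Qed.

(** Beyond the size of the component [idx] returns the default [x]; the two bounds turn these
    indices into isolated vertices. *)
Let local_adj (x : V) (i j : nat) : bool :=
  [&& i < #|component x|, j < #|component x| & G (idx x i) (idx x j)].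

Let code (x : V) : seq bool := [seq local_adj x p.1 p.2 | p <- pairs5].

Let code_adjE x i j : i < 5 -> j < 5 -> code_adj (code x) i j = local_adj x i j.
Proof.
have sym k l : local_adj x k l = local_adj x l k.
  by rewrite /local_adj adj_sym andbCA.
have irr k : local_adj x k k = false by rewrite /local_adj adj_irr !andbF.
by move: i j => [|[|[|[|[|i]]]]] [|[|[|[|[|j]]]]] //= _ _;
  rewrite ?irr // sym.
Qed.

Let code_words x : code x \in words [:: true; false] 10.
Proof. by apply: (@wordsP _ _ (code x)); apply/allP => -[]. Qed.

Let idx_uniq x i j : i < #|component x| -> j < #|component x| ->
  idx x i = idx x j -> i = j.
Proof.
by move=> hi hj /eqP; rewrite nth_uniq ?size_enum ?enum_uniq// => /eqP.
Qed.

Let idx_index x v : v \in component x -> idx x (index v (enum (component x))) = v.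
Proof. by move=> h; rewrite /idx nth_index// mem_enum. Qed.

Let lt_index x v : v \in component x -> index v (enum (component x)) < #|component x|.
Proof. by move=> h; rewrite -size_enum index_mem mem_enum. Qed.

Lemma component_code_C5 x : code_C5 (code x) -> exists g, induced_C5 G g.
Proof.
rewrite /code_C5 lazy_hasE => /hasP[s sP].
case: ifP => // us; rewrite lazy_allE => /allP h.
have ss : size s = 5.
  by move: sP => /mapP[t + ->]; rewrite mem_permutations => /perm_size /= ->.
have s5 i : i < 5 -> nth 0 s i < 5.
  move=> i5; have : nth 0 s i \in s by rewrite mem_nth ?ss.
  move: sP => /mapP[t + ->]; rewrite mem_permutations => /perm_mem tE.
  by rewrite inE => /predU1P[->//|]; rewrite tE mem_iota => /andP[].
have adjE i j : i < 5 -> j < 5 ->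
    local_adj x (nth 0 s i) (nth 0 s j) = nat_C5 i j.
  move=> i5 j5; rewrite -code_adjE ?s5//; apply/eqP.
  by have := h i; rewrite mem_iota => /(_ i5);
    rewrite lazy_allE => /allP/(_ j); rewrite mem_iota => /(_ j5).
(* Each vertex of a C5 has a neighbour, so none of the five indices is padding. *)
have lt i : i < 5 -> nth 0 s i < #|component x|.
  move=> i5; have [j [j5 ij]] : exists j, j < 5 /\ nat_C5 i j.
    by case: i i5 => [|[|[|[|[|i]]]]] //= _;
      [exists 1|exists 2|exists 3|exists 4|exists 0].
  by move: ij; rewrite -adjE// => /and3P[].
exists (fun i => idx x (nth 0 s i)) => i j.
by have := adjE i j (ltn_ord i) (ltn_ord j); rewrite /local_adj !lt.
Qed.

(** A monochromatic maximal clique [S] has an index set [T] that passes [code_good] only through an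
    index [v] adjacent to all of [T]. Then [idx x v] extends [S], hence lies in [S], and would be
    adjacent to itself. *)
Let good_colouring k x : code_colourable k.+1 (code x) ->
  exists f : V -> 'I_k.+1, forall S, maximal_clique G S -> 1 < #|S| ->
    S \subset component x ->
    exists u v, [/\ u \in S, v \in S & f u != f v].
Proof.
rewrite /code_colourable lazy_hasE => /hasP[c /words_mem[sc /allP kc]].
rewrite lazy_allE => /allP good.
pose f v : 'I_k.+1 := inord (nth 0 c (index v (enum (component x)))).
exists f => S mS S1 /fintype.subsetP Sx.
have [cS maxS] := maximal_cliqueP mS.
apply: contrapT => nf.
have mono u v : u \in S -> v \in S -> f u = f v.
  by move=> uS vS; apply/eqP; apply: contrapT => /negP ?; apply: nf; exists u, v.
have c_lt i : i < 5 -> nth 0 c i < k.+1.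
  move=> i5; have := kc _ (mem_nth 0 (s := c) (n := i) _).
  by rewrite sc mem_iota => /(_ i5).
pose m := [seq (i < #|component x|) && (idx x i \in S) | i <- iota 0 5].
have mE i : i < 5 -> nth false m i = (i < #|component x|) && (idx x i \in S).
  by move=> i5; rewrite (nth_map 0) ?size_iota// nth_iota.
have /good : m \in words [:: true; false] 5.
  by apply: (@wordsP _ _ m); apply/allP => -[].
rewrite /code_good; set T := [seq i <- iota 0 5 | nth false m i].
have TP i : (i \in T) = [&& i < 5, i < #|component x| & idx x i \in S].
  by rewrite mem_filter mem_iota /= add0n; case: ltnP => i5; rewrite ?andbF// mE// andbT.
have T_index v : v \in S -> index v (enum (component x)) \in T.
  move=> vS; have vx := Sx _ vS; rewrite TP lt_index// idx_index// vS !andbT.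
  exact: leq_trans (lt_index vx) (small x).
have sT : 1 < size T.
  move: S1 => /card_gt1P[u [v [uS vS uv]]].
  have uT : uniq T by rewrite filter_uniq// iota_uniq.
  have : size [:: index u (enum (component x)); index v (enum (component x))]
      <= size T.
    apply: uniq_leq_size; last by move=> i; rewrite !inE => /orP[]/eqP ->; exact: T_index.
    rewrite /= inE andbT; apply: contra uv => /eqP e.
    by rewrite -(idx_index (Sx _ uS)) e idx_index ?Sx.
  by [].
rewrite sT lazy_allE.
have -> : all (fun i => lazy_all (fun j =>
    if i == j then true else code_adj (code x) i j) T) T.
  apply/allP => i iT; rewrite lazy_allE; apply/allP => j jT.
  case: eqP => // /eqP ij; move: iT jT; rewrite !TP => /and3P[i5 ix iS] /and3P[j5 jx jS].
  rewrite code_adjE// /local_adj ix jx /=.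
  move/cliqueP: cS; apply => //.
  by apply: contra ij => /eqP e; apply/eqP; exact: idx_uniq e.
rewrite lazy_allE.
have -> : all (fun i => lazy_all (fun j => nth 0 c i == nth 0 c j) T) T.
  apply/allP => i iT; rewrite lazy_allE; apply/allP => j jT.
  move: iT jT; rewrite !TP => /and3P[i5 ix iS] /and3P[j5 jx jS].
  have := mono _ _ iS jS; rewrite /f /idx !index_uniq ?size_enum ?enum_uniq//.
  by move=> /(congr1 val) /=; rewrite !inordK ?c_lt// => ->.
rewrite lazy_hasE => /hasP[v]; rewrite mem_iota => /= v5.
rewrite lazy_allE => /allP vP.
have adjv u : u \in S -> local_adj x v (index u (enum (component x))).
  move=> uS; rewrite -code_adjE ?vP ?T_index//.
  by rewrite (leq_trans (lt_index (Sx _ uS))).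
have [u [_ [uS _ _]]] := card_gt1P S1.
have vx : v < #|component x| by have /and3P[] := adjv u uS.
have vS : idx x v \in S.
  apply: maxS => w wS _; have /and3P[_ _] := adjv w wS.
  by rewrite idx_index ?Sx// adj_sym.
have : v \in T by rewrite TP v5 vx.
by move=> /vP; rewrite code_adjE// /local_adj adj_irr !andbF.
Qed.

(** A clique lies within one component, so the colourings chosen at the roots of the components fit
    together. *)
Let glue k : (forall x, code_colourable k.+1 (code x)) -> clique_colourable G k.+1.
Proof.
move=> /(_ _)/good_colouring => h.
have [F FP] := choice h.
have cs : connect_sym G by apply: sym_connect_sym; exact: adj_sym.
apply/existsP; exists [ffun v => F (fingraph.root G v) v].
apply/forallP => S; apply/implyP => /andP[mS S1].
apply/negP => /monochromaticP mono.
have [x [_ [xS _ _]]] := card_gt1P S1.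
have [cS _] := maximal_cliqueP mS.
have Sx y : y \in S -> fingraph.root G y = fingraph.root G x.
  move=> yS; apply/fingraph.rootP => //.
  have [->|yx] := eqVneq y x; first exact: connect0.
  by apply: connect1; move/cliqueP: cS; apply.
have [|u [v [uS vS]]] := FP (fingraph.root G x) S mS S1.
  apply/fintype.subsetP => y yS; rewrite inE -(Sx y yS) cs; exact: fingraph.connect_root.
by rewrite -{1}(Sx u uS) -(Sx v vS); have := mono u v uS vS; rewrite !ffunE => ->;
  rewrite eqxx.
Qed.

Lemma small_components_colourable3 : clique_colourable G 3.
Proof.
by apply: glue => x; have /allP/(_ _ (code_words x))/andP[] := code_check.
Qed.

Lemma small_components_colourable2 : ~ (exists g, induced_C5 G g) ->
  clique_colourable G 2.
Proof.
move=> nC; apply: glue => x.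
have /allP/(_ _ (code_words x))/andP[+ _] := code_check.
by case: ifP => [/component_code_C5/nC []|_].
Qed.

(** Different vertices of C5 have different neighbourhoods. *)
Lemma induced_C5_inj (g : 'I_5 -> V) : induced_C5 G g -> injective g.
Proof.
move=> gC i j e; apply/val_inj/eqP => /=.
have /allP/(_ (val i)) : all (fun i => all (fun j =>
    all (fun k => nat_C5 i k == nat_C5 j k) (iota 0 5) ==> (i == j))
  (iota 0 5)) (iota 0 5) by vm_compute.
rewrite mem_iota ltn_ord => /(_ isT)/allP/(_ (val j)).
rewrite mem_iota ltn_ord => /(_ isT)/implyP; apply.
apply/allP => k; rewrite mem_iota => /= k5; apply/eqP.
by have := gC i (Ordinal k5); rewrite e gC.
Qed.

(** The five vertices fill their component, so a common neighbour of two consecutive ones would be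
    on the cycle and form a triangle. *)
Lemma small_components_C5 (g : 'I_5 -> V) : induced_C5 G g ->
  clique_chromatic_number G = 3.
Proof.
move=> gC; apply/eqP; rewrite eqn_leq clique_chromatic_leq//=; last first.
  exact: small_components_colourable3.
apply: (induced_C5_chromatic_ge3 gC) => i j w ij; apply/negP => /andP[wi wj].
have comp : component (g i) = [set g k | k in 'I_5].
  apply/esym/eqP; rewrite eqEcard; apply/andP; split.
    apply/fintype.subsetP => _ /imsetP[k _ ->]; rewrite inE.
    have step (a b : nat) (ha : a < 5) (hb : b < 5) : nat_C5 a b ->
        connect G (g (Ordinal ha)) (g (Ordinal hb)).
      by move=> ab; apply: connect1; rewrite gC.
    have z (a : 'I_5) : connect G (g ord0) (g a).
      have s1 := step 0 1 isT isT isT; have s2 := step 1 2 isT isT isT.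
      have s3 := step 2 3 isT isT isT; have s4 := step 3 4 isT isT isT.
      have -> : ord0 = Ordinal (isT : 0 < 5) by exact: val_inj.
      move: a => [[|[|[|[|[|a]]]]] ha] //=.
      - by rewrite (_ : Ordinal ha = Ordinal (isT : 0 < 5)) ?connect0//; exact: val_inj.
      - by rewrite (_ : Ordinal ha = Ordinal (isT : 1 < 5))//; exact: val_inj.
      - rewrite (_ : Ordinal ha = Ordinal (isT : 2 < 5)); last exact: val_inj.
        exact: connect_trans s2.
      - rewrite (_ : Ordinal ha = Ordinal (isT : 3 < 5)); last exact: val_inj.
        by apply: connect_trans s3; apply: connect_trans s2.
      - rewrite (_ : Ordinal ha = Ordinal (isT : 4 < 5)); last exact: val_inj.
        by apply: connect_trans s4; apply: connect_trans s3; apply: connect_trans s2.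
    apply: connect_trans (z k).
    by rewrite sym_connect_sym ?z //; exact: adj_sym.
  have gi := induced_C5_inj gC.
  by rewrite (card_imset _ gi) card_ord small.
have : w \in component (g i) by rewrite inE connect1// adj_sym.
rewrite comp => /imsetP[k _ e]; move: wi wj (C5_triangle_free i j k).
by rewrite e !gC ij => -> ->.
Qed.

End SmallComponents.

Import Order.TTheory GRing.Theory Num.Theory.
Import numFieldNormedType.Exports.

Local Open Scope classical_set_scope.
Local Open Scope ring_scope.

(** * Real-valued probabilities and independent blocks *)

Section RealProbability.
Context d (T : measurableType d) (R : realType) (P : probability T R).
Implicit Types A B : set T.

Definition pr A : R := fine (P A).

Lemma prE A : measurable A -> P A = (pr A)%:E.
Proof. by move=> mA; rewrite /pr fineK// fin_num_measure. Qed.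

Lemma pr_ge0 A : 0 <= pr A.
Proof. exact/fine_ge0/measure_ge0. Qed.

Lemma le_pr A B : measurable A -> measurable B -> A `<=` B -> pr A <= pr B.
Proof.
by move=> mA mB AB; rewrite -lee_fin -!prE// le_measure ?inE.
Qed.

Lemma pr_le1 A : measurable A -> pr A <= 1.
Proof. by move=> mA; rewrite -lee_fin -prE// probability_le1. Qed.

Lemma prT : pr setT = 1.
Proof. by rewrite /pr probability_setT. Qed.

Lemma pr0 : pr set0 = 0.
Proof. by rewrite /pr measure0. Qed.

Lemma prU A B : measurable A -> measurable B -> A `&` B = set0 ->
  pr (A `|` B) = pr A + pr B.
Proof.
move=> mA mB AB; apply: EFin_inj; rewrite EFinD -!prE//; last exact: measurableU.
by rewrite measureU.
Qed.

Lemma prD A B : measurable A -> measurable B -> pr A = pr (A `&` B) + pr (A `\` B).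
Proof.
move=> mA mB; rewrite -prU ?setUIDK//; [exact: measurableI|exact: measurableD|].
by apply/seteqP; split=> [w [[_ ?] []]|].
Qed.

Lemma prC A : measurable A -> pr (~` A) = 1 - pr A.
Proof.
move=> mA; apply: EFin_inj; rewrite EFinB -!prE//; last exact: measurableC.
exact: probability_setC.
Qed.

Lemma pr_leU A B : measurable A -> measurable B -> pr (A `|` B) <= pr A + pr B.
Proof.
move=> mA mB; rewrite (prD (measurableU _ _ mA mB) mA) setUK lerD//.
apply: le_pr => //; first by apply: measurableD => //; exact: measurableU.
by move=> x [[]].
Qed.

Lemma pr_le_bigU (I : Type) (s : seq I) (A : I -> set T) :
  (forall i, measurable (A i)) ->
  pr (\big[setU/set0]_(i <- s) A i) <= \sum_(i <- s) pr (A i).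
Proof.
move=> mA; elim: s => [|i s ih]; first by rewrite !big_nil pr0.
rewrite !big_cons (le_trans (pr_leU _ _)) ?lerD2l//.
exact: bigsetU_measurable.
Qed.

Lemma pr_le_exists (I : finType) (Q : pred I) (A : I -> set T) B :
  measurable B -> (forall i, measurable (A i)) ->
  (forall w, B w -> exists2 i, Q i & A i w) ->
  pr B <= \sum_(i | Q i) pr (A i).
Proof.
move=> mB mA BA.
rewrite -big_filter; set s := [seq i <- _ | Q i].
apply: le_trans (pr_le_bigU s mA); apply: le_pr => //.
  exact: bigsetU_measurable.
move=> w /BA[i Qi Aiw]; rewrite -bigcup_seq; exists i => //=.
by rewrite mem_filter Qi mem_index_enum.
Qed.

End RealProbability.

Section FiniteMeasurability.
Context d (T : measurableType d).

(** There are finitely many truth tables [f], so the event is a finite union of finite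
    intersections, whatever [Q] is. *)
Lemma measurable_finfun (K : finType) (e : K -> T -> bool)
    (Q : {ffun K -> bool} -> Prop) : (forall k, measurable [set w | e k w]) ->
  measurable [set w | Q [ffun k => e k w]].
Proof.
move=> me.
have -> : [set w | Q [ffun k => e k w]] =
    \bigcup_(f in [set f | Q f]) \bigcap_(k in [set: K])
       [set w | e k w = f k].
  apply/seteqP; split=> [w Qw|w [f Qf fw]] /=.
    by exists [ffun k => e k w] => // k _ /=; rewrite ffunE.
  by rewrite (_ : finfun _ = f)//; apply/ffunP => k; rewrite ffunE fw.
apply: fin_bigcup_measurable; first exact: finite_finset.
move=> f _; apply: fin_bigcap_measurable; first exact: finite_finset.
move=> k _; case: (f k); first exact: me.
rewrite (_ : [set w | _] = ~` [set w | e k w]); first exact/measurableC/me.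
by apply/seteqP; split => w /=; case: (e k w).
Qed.

Lemma edist_le (R : realType) (x y : R * R) (r : R) : 0 <= r ->
  (Defs.edist x y <= r) = ((x.1 - y.1) ^+ 2 + (x.2 - y.2) ^+ 2 <= r ^+ 2).
Proof.
move=> r0; rewrite /Defs.edist.
rewrite -[in RHS](sqr_sqrtr (a := (x.1 - y.1) ^+ 2 + (x.2 - y.2) ^+ 2)); last first.
  by rewrite addr_ge0// sqr_ge0.
by rewrite ler_sqr ?nnegrE ?sqrtr_ge0.
Qed.

Lemma measurable_edist_le (R : realType) (f g : T -> plane R) (r : R) : 0 <= r ->
  measurable_fun setT f -> measurable_fun setT g ->
  measurable [set w | Defs.edist (f w) (g w) <= r].
Proof.
move=> r0 /measurable_fun_pairP[f1 f2] /measurable_fun_pairP[g1 g2].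
pose h w : R := ((f w).1 - (g w).1) ^+ 2 + ((f w).2 - (g w).2) ^+ 2.
have mh : measurable_fun setT h.
  by apply: measurable_funD; apply: measurable_funX; apply: measurable_funB.
rewrite (_ : [set w | _] = setT `&` h @^-1` `]-oo, r ^+ 2]); first exact: mh.
by apply/seteqP; split=> w /=; rewrite in_itv/= (edist_le _ _ r0); [split|case].
Qed.

End FiniteMeasurability.

(** * Independence of events that depend on disjoint sets of points *)

Section IndependentBlocks.
Context d (T : measurableType d) (R : realType) (P : probability T R).
Context d' (T' : measurableType d') (I : finType) (X : I -> {RV P >-> T'}).

(** A pi-system that generates the events depending only on the points of [J]; measures are compared
    on it. *)
Definition block_rectangles (J : {set I}) : set (set T) :=
  [set A | exists2 B : I -> set T', (forall i, measurable (B i)) &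
    A = \bigcap_(i in [set` J]) (X i @^-1` B i)].

Definition block_sigma (J : {set I}) : set (set T) := <<s block_rectangles J >>.

Lemma measurable_RV_preimage i (B : set T') : measurable B -> measurable (X i @^-1` B).
Proof. by move=> mB; rewrite -[X in measurable X]setTI; exact: measurable_funP. Qed.

Lemma block_rectangles_measurable J A : block_rectangles J A -> measurable A.
Proof.
move=> [B mB ->]; apply: fin_bigcap_measurable; first exact: finite_finset.
by move=> i _; exact: measurable_RV_preimage.
Qed.

Lemma block_sigma_measurable J A : block_sigma J A -> measurable A.
Proof.
apply: smallest_sub; first exact: sigma_algebra_measurable.
exact: block_rectangles_measurable.
Qed.

Lemma block_rectangles_setI J : setI_closed (block_rectangles J).
Proof.
move=> _ _ [B mB ->] [C mC ->]; exists (fun i => B i `&` C i).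
  by move=> i; exact: measurableI.
by rewrite -bigcapI; apply: eq_bigcapr.
Qed.

Lemma block_rectanglesT J : block_rectangles J setT.
Proof.
by exists (fun=> setT) => //; apply/esym; rewrite bigcapT// => ? _; rewrite preimage_setT.
Qed.

Lemma block_sigma_RV (J : {set I}) i (B : set T') : i \in J -> measurable B ->
  block_sigma J (X i @^-1` B).
Proof.
move=> iJ mB; apply: sub_sigma_algebra.
exists (fun j => if j == i then B else setT) => [j|]; first by case: ifP.
apply/seteqP; split=> [w /= Bw j _ /=|w /(_ i iJ)]; last by rewrite /= eqxx.
by case: eqP => // ->.
Qed.

Lemma measure_block_eq (m1 m2 : {measure set T -> \bar R}) J :
  (forall A, block_rectangles J A -> m1 A = m2 A) -> (m1 setT < +oo)%E ->
  forall A, block_sigma J A -> m1 A = m2 A.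
Proof.
move=> m12 m1oo.
apply: (g_sigma_algebra_measure_unique (block_rectangles J) _ (fun=> setT)) => //.
- exact: block_rectangles_measurable.
- by move=> ?; exact: block_rectanglesT.
- by apply/seteqP; split => // x _; exists 0.
- exact: block_rectangles_setI.
Qed.

Hypothesis Xind : mutually_independent X.

Lemma block_rectangles_indep (J K : {set I}) A B : (forall i, i \in J -> i \notin K) ->
  block_rectangles J A -> block_rectangles K B -> P (A `&` B) = (P A * P B)%E.
Proof.
move=> dJK [F mF ->] [H mH ->].
have dF i : i \in K -> (i \in J) = false.
  by move=> iK; apply/negbTE/negP => /dJK; rewrite iK.
have dJK' : fintype.disjoint (mem J) (mem K).
  by rewrite disjoint_subset; apply/fintype.subsetP => i /dJK.
rewrite !Xind//.
have -> : \bigcap_(i in [set` J]) (X i @^-1` F i) `&`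
     \bigcap_(i in [set` K]) (X i @^-1` H i) =
   \bigcap_(i in [set` J :|: K]) (X i @^-1` (if i \in J then F i else H i)).
  apply/seteqP; split=> [w [wF wH] i /= /setUP[iJ|iK]|w h].
  - by rewrite iJ; exact: wF.
  - by rewrite ifF; [exact: wH|exact: dF].
  - split=> i /= iJ; have := h i; rewrite /= inE iJ ?orbT => /(_ isT)//.
    by rewrite dF.
rewrite Xind//; last by move=> i; case: ifP.
rewrite (eq_bigl [predU J & K]) => [|i]; last by rewrite !inE.
rewrite bigU//=.
congr (_ * _)%E; apply: eq_bigr => i iJ; first by rewrite iJ.
by rewrite dF.
Qed.

(** The uniqueness of measures is used twice. With a rectangle [C] fixed, P(. and C) and P(C) P(.)
    are finite measures that agree on the rectangles of [K]; with [B] fixed, the same is done on the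
    rectangles of [J]. *)
Lemma block_indep (J K : {set I}) A B : (forall i, i \in J -> i \notin K) ->
  block_sigma J A -> block_sigma K B -> pr P (A `&` B) = pr P A * pr P B.
Proof.
move=> dJK sA sB.
have mA := block_sigma_measurable sA; have mB := block_sigma_measurable sB.
pose c C : {nonneg R} := NngNum (pr_ge0 P C).
have step1 C : block_rectangles J C -> P (C `&` B) = (P C * P B)%E.
  move=> rC; have mC := block_rectangles_measurable rC.
  rewrite setIC (prE P mC).
  apply: (@measure_block_eq (mrestr P mC) (mscale (c C) P) K) => //.
    move=> D rD; change (P (D `&` C) = (pr P C)%:E * P D)%E.
    rewrite -(prE P mC) setIC.
    exact: block_rectangles_indep rC rD.
  by change (P (setT `&` C) < +oo)%E; rewrite setTI (prE P mC) ltry.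
have : P (A `&` B) = (P B * P A)%E.
  rewrite (prE P mB).
  apply: (@measure_block_eq (mrestr P mB) (mscale (c B) P) J) => //.
    move=> D rD; change (P (D `&` B) = (pr P B)%:E * P D)%E.
    by rewrite -(prE P mB) step1// muleC.
  by change (P (setT `&` B) < +oo)%E; rewrite setTI (prE P mB) ltry.
by move=> PAB; rewrite /pr PAB fineM ?fin_num_measure// mulrC.
Qed.

End IndependentBlocks.

(** * Areas and densities *)

Section Scaling.
Local Open Scope ereal_scope.
Context (R : realType).

(** Because it is stated with preimages, a dilation by r contributes the factor 1/r per
    coordinate. *)
Definition scales d (V : measurableType d) (m : set V -> \bar R) (phi : V -> V)
    (a : R) : Prop :=
  [/\ measurable_fun setT phi, (0 <= a)%R &
  forall E, measurable E -> m (phi @^-1` E) = a%:E * m E].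

(** Each section is scaled by [a2]; the outer integral is then moved to the pushforward of [m1] by
    [phi1], which is [a1] times [m1]. *)
Lemma scales_product d1 d2 (V1 : measurableType d1) (V2 : measurableType d2)
    (m1 : {measure set V1 -> \bar R})
    (m2 : {sigma_finite_measure set V2 -> \bar R}) phi1 phi2 a1 a2 :
  scales m1 phi1 a1 -> scales m2 phi2 a2 ->
  scales (m1 \x m2) (fun p => (phi1 p.1, phi2 p.2)) (a1 * a2)%R.
Proof.
move=> [mphi1 a10 s1] [mphi2 a20 s2]; split; last 2 first.
- exact: mulr_ge0.
- move=> E mE; rewrite /product_measure1.
  transitivity (\int[m1]_x (a2%:E * ((m2 \o xsection E) \o phi1) x)).
    apply: eq_integral => x _ /=; rewrite -s2; last exact: measurable_xsection.
    by congr (m2 _); apply/seteqP; split=> y; rewrite /xsection /= !inE.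
  have mf : measurable_fun setT (m2 \o xsection E) by exact: measurable_fun_xsection.
  rewrite ge0_integralZl//; last exact: measurableT_comp.
  rewrite -[X in \int[_]_(_ in X) _](preimage_setT phi1).
  rewrite -(ge0_integral_pushforward mphi1)//.
  have -> : \int[pushforward m1 phi1]_y (m2 \o xsection E) y =
      \int[mscale (NngNum a10) m1]_y (m2 \o xsection E) y.
    have [pm pmE] : exists pm : {measure set V1 -> \bar R},
        (pm : set V1 -> \bar R) = pushforward m1 phi1.
      by unshelve eexists (pushforward m1 phi1 : {measure set _ -> \bar R}).
    rewrite -pmE; apply: eq_measure_integral => A mA _.
    by rewrite pmE; exact: s1.
  by rewrite ge0_integral_mscale//= muleA -EFinM mulrC.
- by apply: measurable_fun_pair; exact: measurableT_comp.
Qed.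

Definition affine (x r : R) : measurableTypeR R -> measurableTypeR R :=
  fun y => (x + r * y)%R.

Lemma measurable_affine x r : measurable_fun setT (affine x r).
Proof. by apply: measurable_funD => //; apply: measurable_funM. Qed.

(** r times the pushforward agrees with Lebesgue measure on half-open intervals, so it is Lebesgue
    measure. *)
Lemma scales_affine (x r : R) : (0 < r)%R ->
  scales (@lebesgue_measure R) (affine x r) r^-1%R.
Proof.
move=> r0; have r0' : (0 <= r)%R := ltW r0; split.
- exact: measurable_affine.
- by rewrite invr_ge0.
move=> E mE.
have [pm pmE] : exists pm : {measure set measurableTypeR R -> \bar R},
    forall A, pm A = lebesgue_measure (affine x r @^-1` A).
  unshelve eexists (pushforward lebesgue_measure (affine x r) : {measure set _ -> \bar R}).
    exact: measurable_affine.
  by [].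
pose m' := mscale (NngNum r0') pm.
have : lebesgue_measure E = m' E.
  apply: lebesgue_measure_unique => // X [[a b] _ <-].
  change (lebesgue_measure `]a, b]%classic = r%:E * pm `]a, b]%classic); rewrite pmE.
  rewrite (_ : affine x r @^-1` _ = `](a - x) / r, (b - x) / r]%classic)%R; last first.
    apply/seteqP; split => y; rewrite /= !in_itv /= /affine;
    by rewrite ltr_pdivrMr// ler_pdivlMr// ltrBlDl lerBrDl mulrC.
  rewrite !lebesgue_measure_itv /= !lte_fin ltr_pM2r ?invr_gt0// ltrD2r.
  case: ifP => _; last by rewrite mule0.
  by rewrite -!EFinD -EFinM; congr (_%:E); field; rewrite gt_eqF.
rewrite (_ : m' E = r%:E * pm E)// pmE => ->.
by rewrite muleA -EFinM mulVf ?gt_eqF// mul1e.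
Qed.

Definition affine2 (x : R * R) (r : R) : plane R -> plane R :=
  fun y => (affine x.1 r y.1, affine x.2 r y.2).

Lemma scales_affine2 x r : (0 < r)%R -> scales (@area R) (affine2 x r) (r^-1 ^+ 2)%R.
Proof. by move=> r0; rewrite expr2; apply: scales_product; exact: scales_affine. Qed.

Definition affine8 (x : R * R) (r : R) :
    plane R * plane R * plane R * plane R -> plane R * plane R * plane R * plane R :=
  fun y => (affine2 x r y.1.1.1, affine2 x r y.1.1.2, affine2 x r y.1.2, affine2 x r y.2).

Lemma scales_affine8 x r : (0 < r)%R ->
  scales (@area R \x @area R \x @area R \x @area R) (affine8 x r) (r^-1 ^+ 8)%R.
Proof.
move=> r0; have s := scales_affine2 x r0.
have -> : (r^-1 ^+ 8 = r^-1 ^+ 2 * r^-1 ^+ 2 * r^-1 ^+ 2 * r^-1 ^+ 2)%R.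
  by rewrite -!exprD.
have s4 := scales_product s s.
have s6 := scales_product s4 s.
exact: (scales_product s6 s).
Qed.

End Scaling.

(** * The area of the unit disc *)

Section DiscArea.
Context (R : realType).
Local Open Scope ereal_scope.

(** The substitution x = sin y turns the integrand into 2 cos^2 y, with antiderivative y + sin y cos
    y. *)
Lemma integral_half_disc :
  \int[lebesgue_measure]_(x in `[(-1)%R, 1%R]) (2 * Num.sqrt (1 - x ^+ 2) : R)%:E
  = (pi : R)%:E.
Proof.
have pi0 : (- (pi / 2) < pi / 2 :> R)%R.
  by rewrite gtrN// divr_gt0// pi_gt0.
have e1 : ((-1)%R = sin (- (pi / 2)) :> R) by rewrite sinN sin_pihalf.
have e2 : (1%R = sin (pi / 2) :> R) by rewrite sin_pihalf.
have dsin : (@sin R)^`()%classic = cos.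
  by apply/funext => y; rewrite derive1E derive_val.
have -> : `[(-1)%R, 1%R]%classic = `[sin (- (pi / 2)), sin (pi / 2)]%classic :> set R.
  by rewrite -e1 -e2.
rewrite (integration_by_substitution_increasing (F := sin)
  (G := fun x : R => (2 * Num.sqrt (1 - x ^+ 2))%R)); first last.
- apply: continuous_subspaceT => x; apply: cvgM; first exact: cvg_cst.
  apply: (@continuous_comp _ _ _ (fun x : R => 1 - x ^+ 2)%R); last exact: sqrt_continuous.
  by apply: cvgB; [exact: cvg_cst|exact: exprn_continuous].
- split.
  + by move=> x _; exact: derivable_sin.
  + exact/cvg_at_right_filter/continuous_sin.
  + exact/cvg_at_left_filter/continuous_sin.
- by rewrite dsin; apply/cvg_ex; exists (cos (pi / 2)); apply: cvg_at_left_filter; exact: continuous_cos.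
- by rewrite dsin; apply/cvg_ex; exists (cos (- (pi / 2))); apply: cvg_at_right_filter; exact: continuous_cos.
- by move=> x _; rewrite dsin; exact: continuous_cos.
- by move=> x y xi yi; rewrite ltr_sin.
- exact: ltW.
transitivity (\int[lebesgue_measure]_(x in `[(- (pi / 2))%R, (pi / 2)%R])
    (2 * cos x ^+ 2 : R)%:E).
  apply: eq_integral => x; rewrite inE /= in_itv /= => xi; rewrite dsin fctE /=; congr (_%:E).
  by rewrite -cos2sin2 sqrtr_sqr ger0_norm ?cos_ge0_pihalf// -mulrA expr2.
have dF (x : R) : is_derive x 1%R (fun x : R => x + sin x * cos x)%R (2 * cos x ^+ 2)%R.
  apply: is_derive_eq; rewrite /GRing.scale /=; have := cos2Dsin2 x; lra.
have cF : continuous (fun x : R => x + sin x * cos x)%R.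
  by move=> x; apply: differentiable_continuous; apply/derivable1_diffP; exact: ex_derive.
rewrite (continuous_FTC2 (F := fun x : R => (x + sin x * cos x)%R)) //; first last.
- by move=> x _; rewrite derive1E derive_val.
- split.
  + by move=> x _; exact: ex_derive.
  + exact/cvg_at_right_filter/cF.
  + exact/cvg_at_left_filter/cF.
- apply: continuous_subspaceT => x; apply: cvgM; first exact: cvg_cst.
  apply: (@continuous_comp _ _ _ (@cos R) (fun x => x ^+ 2)%R); first exact: continuous_cos.
  exact: exprn_continuous.
rewrite cosN sinN cos_pihalf !mulr0 !addr0 -EFinB opprK.
by congr (_%:E); lra.
Qed.

Lemma area_disc : area [set y : plane R | Defs.edist (0, 0)%R y <= 1]%R = (pi : R)%:E.
Proof.
rewrite -integral_half_disc /area /product_measure1 [RHS]integral_mkcond.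
apply: eq_integral => x _.
transitivity ((2 * Num.sqrt (1 - x ^+ 2))%:E : \bar R).
  (* Outside [-1, 1] the section is empty, in accordance with [Num.sqrt] being 0 at negative
     numbers. *)
  have [x1|x1] := leP ((x : R) ^+ 2)%R 1%R; last first.
    rewrite ler0_sqrtr ?subr_le0 ?ltW// mulr0 /=.
    rewrite (_ : xsection _ _ = set0) ?measure0//.
    apply/seteqP; split => // y; rewrite /xsection /= inE /= edist_le//= !sub0r !sqrrN expr1n.
    by rewrite leNgt ltr_wpDr ?sqr_ge0.
  set s := Num.sqrt _; have s0 : (0 <= s)%R by exact: sqrtr_ge0.
  rewrite /= (_ : xsection _ _ = `[(- s)%R, s]%classic).
    rewrite lebesgue_measure_itv /= lte_fin; case: ltP => ss.
      by rewrite -EFinD; congr (_%:E); lra.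
    by congr (_%:E); lra.
  have E (y : R) : (- s <= y <= s)%R = (x ^+ 2 + y ^+ 2 <= 1)%R.
    rewrite -ler_norml -(ler_pXn2r (n := 2)) ?nnegrE// real_normK ?num_real//.
    by rewrite sqr_sqrtr ?subr_ge0// lerBrDl.
  by apply/seteqP; split => y; rewrite /xsection /= inE /= edist_le//= !sub0r
    !sqrrN expr1n in_itv /= E.
rewrite patchE; case: ifPn => //; rewrite notin_setE /= in_itv /= => /negP x1.
rewrite ler0_sqrtr ?mulr0// subr_le0 -[leRHS]real_normK ?num_real//.
rewrite exprn_ege1// leNgt; apply/negP => /ltW.
by rewrite ler_norml (negbTE x1).
Qed.

End DiscArea.

Section ProductBounds.
Local Open Scope ereal_scope.
Context (R : realType) d1 d2 (V1 : measurableType d1) (V2 : measurableType d2).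
Context (m1 : {measure set V1 -> \bar R}) (m2 : {sigma_finite_measure set V2 -> \bar R}).

Lemma integral_indic_cst (a : R) (S : set V1) : (0 <= a)%R -> measurable S ->
  \int[m1]_x (a%:E * (\1_S x)%:E) = a%:E * m1 S.
Proof.
move=> a0 mS; rewrite ge0_integralZl//; last exact: measurableT_comp.
by rewrite integral_indic// setIT.
Qed.

Lemma product_measure_le (E : set (V1 * V2)) S1 S2 (a : R) :
  measurable E -> measurable S1 -> measurable S2 -> (0 <= a)%R ->
  (forall x, S1 x -> m2 (xsection E x) <= a%:E) ->
  (m1 \x m2) (E `&` (S1 `*` S2)) <= a%:E * m1 S1.
Proof.
move=> mE mS1 mS2 a0 h.
have mF : measurable (E `&` (S1 `*` S2)).
  by apply: measurableI => //; exact: measurableX.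
rewrite -integral_indic_cst// /product_measure1; apply: ge0_le_integral => //.
- exact: measurable_fun_xsection.
- by apply: emeasurable_funM => //; exact: measurableT_comp.
move=> x _ /=; rewrite indicE; have [xS|xS] := boolP (x \in S1).
  rewrite mule1; apply: le_trans (h x (set_mem xS)); apply: le_measure;
  rewrite ?inE; try exact: measurable_xsection.
  by move=> y; rewrite /xsection /= !inE => H; case: H.
rewrite mule0 (_ : xsection _ _ = set0) ?measure0//.
apply/seteqP; split => // y; rewrite /xsection /= inE => -[_ [/= xS1 _]].
by move: xS; rewrite mem_set.
Qed.

(** [S'] will be the inner square, whose points are so far from the border that the whole section
    stays in [S2]. *)
Lemma product_measure_ge (E : set (V1 * V2)) S1 S2 S' (a : R) :
  measurable E -> measurable S1 -> measurable S2 -> measurable S' -> (0 <= a)%R ->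
  S' `<=` S1 ->
  (forall x, S' x -> m2 (xsection E x) = a%:E /\ xsection E x `<=` S2) ->
  a%:E * m1 S' <= (m1 \x m2) (E `&` (S1 `*` S2)).
Proof.
move=> mE mS1 mS2 mS' a0 S'S h.
have mF : measurable (E `&` (S1 `*` S2)).
  by apply: measurableI => //; exact: measurableX.
rewrite -integral_indic_cst// /product_measure1; apply: ge0_le_integral => //.
- by move=> x _; rewrite mule_ge0 ?lee_fin.
- by apply: emeasurable_funM => //; exact: measurableT_comp.
- exact: measurable_fun_xsection.
move=> x _ /=; rewrite indicE; have [xS|xS] := boolP (x \in S').
  have [<- s2] := h x (set_mem xS); rewrite mule1; apply: le_measure;
  rewrite ?inE; try exact: measurable_xsection.
  move=> y Ey; move: (Ey) => /s2; move: Ey; rewrite /xsection /= !inE => Ey S2y.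
  by split => //; split => //=; apply: S'S; exact: set_mem.
by rewrite mule0.
Qed.

End ProductBounds.

Section JointDensity.
Local Open Scope ereal_scope.
Context d (T : measurableType d) (R : realType) (P : probability T R).

Definition has_density dV (V : measurableType dV) (Z : T -> V)
    (m : set V -> \bar R) (S : set V) (c : R) : Prop :=
  forall B, measurable B -> P (Z @^-1` B) = c%:E * m (B `&` S).

(** By independence the law of the pair and the product density agree on measurable rectangles,
    which form a pi-system. *)
Lemma joint_density d1 d2 (V1 : measurableType d1) (V2 : measurableType d2)
    (m1 : {measure set V1 -> \bar R}) (m2 : {sigma_finite_measure set V2 -> \bar R})
    (U : T -> V1) (Y : T -> V2) S1 S2 c1 c2 :
  measurable_fun setT U -> measurable_fun setT Y ->
  measurable S1 -> measurable S2 -> (0 <= c1)%R -> (0 <= c2)%R ->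
  has_density U m1 S1 c1 -> has_density Y m2 S2 c2 ->
  (forall A B, measurable A -> measurable B ->
    P (U @^-1` A `&` Y @^-1` B) = P (U @^-1` A) * P (Y @^-1` B)) ->
  has_density (fun w => (U w, Y w)) (m1 \x m2) (S1 `*` S2) (c1 * c2)%R.
Proof.
move=> mU mY mS1 mS2 c10 c20 dU dY ind.
have mUY : measurable_fun setT (fun w => (U w, Y w)) by exact: measurable_fun_pair.
have [pm pmE] : exists pm : {measure set (V1 * V2) -> \bar R},
    (pm : set (V1 * V2) -> \bar R) = pushforward P (fun w => (U w, Y w)).
  by unshelve eexists (pushforward P (fun w => (U w, Y w)) : {measure set _ -> \bar R}).
have mS : measurable (S1 `*` S2) by exact: measurableX.
pose q := mscale (NngNum (mulr_ge0 c10 c20)) (mrestr (m1 \x m2) mS).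
pose C : set (set (V1 * V2)) :=
  [set C | exists A, measurable A /\ exists B, measurable B /\ C = A `*` B].
have CI : setI_closed C.
  move=> /= _ _ [X1 [mX1 [X2 [mX2 ->]]]] [Y1 [mY1 [Y2 [mY2 ->]]]].
  rewrite -setXI; exists (X1 `&` Y1); split; first exact: measurableI.
  by exists (X2 `&` Y2); split => //; exact: measurableI.
move=> E mE.
change (pushforward P (fun w => (U w, Y w)) E = q E); rewrite -pmE.
apply: (measure_unique C (fun=> setT)) => //.
- rewrite measurable_prod_measurableType //; congr (<<s _ >>).
  rewrite predeqE; split => [[A mA [B mB <-]]|[A [mA [B [mB ->]]]]].
    by exists A; split => //; exists B.
  by exists A => //; exists B.
- by move=> _; exists setT; split => //; exists setT; split => //; rewrite setXTT.
- by apply/seteqP; split => // x _; exists 0%N.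
- move=> _ [A [mA [B [mB ->]]]]; rewrite pmE.
  change (P (U @^-1` A `&` Y @^-1` B) =
    (c1 * c2)%:E * (m1 \x m2) ((A `*` B) `&` (S1 `*` S2))).
  rewrite ind// dU// dY// -setXI product_measure1E; try exact: measurableI.
  by rewrite EFinM muleACA.
- move=> _; rewrite pmE /pushforward preimage_setT probability_setT.
  by rewrite ltry.
Qed.

End JointDensity.

(** * A pentagon of unit cells *)

(* The five unit cells below are the vertices of a pentagon with sides just
   below 150 (a square with an equilateral triangle on top). *)
Delimit Scope Z_scope with zz.

Definition pentagon : seq (Z * Z) :=
  [:: (250, 425); (326, 298); (324, 150); (176, 150); (174, 298)]%zz.

(** The distance between the intervals [q, q + 1] and [Y, Y + 1]. *)
Definition row_gap (q Y : Z) : Z :=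
  Z.max (q - (Y + 1)) (Z.max (Y - (q + 1)) 0).

(** Here 150 units stand for the threshold, and 22500 = 150^2. The interval covers the points of row
    [Y] within the threshold of some point of the cell [p]; adding 1 to the integer square root
    rounds outwards. *)
Definition disc_row (p : Z * Z) (Y : Z) : option (Z * Z) :=
  let d := row_gap p.2 Y in
  if (150 <? d)%zz then None
  else let w := (Z.sqrt (22500 - d * d) + 1)%zz in
       Some (p.1 - w, p.1 + 1 + w)%zz.

Definition meet_row (o1 o2 : option (Z * Z)) : option (Z * Z) :=
  if (o1, o2) is (Some (a, b), Some (a', b')) then
    if (Z.max a a' <=? Z.min b b')%zz then Some (Z.max a a', Z.min b b') else None
  else None.

(** Hulls instead of unions keep each row a single interval. This can only enlarge a region whose
    purpose is to cover, and its area remains small enough. *)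
Definition hull_row (o1 o2 : option (Z * Z)) : option (Z * Z) :=
  match o1, o2 with
  | Some (a, b), Some (a', b') => Some (Z.min a a', Z.max b b')
  | None, o => o
  | o, None => o
  end.

Definition lens_row (Y : Z) (i : nat) : option (Z * Z) :=
  meet_row (disc_row (nth (0, 0)%zz pentagon i) Y)
           (disc_row (nth (0, 0)%zz pentagon (i.+1 %% 5)) Y).

Definition lenses_row (Y : Z) : option (Z * Z) :=
  foldr hull_row None [seq lens_row Y i | i <- iota 0 5].

(* The horizontal unit rows of a set of cells that covers the common
   neighbourhoods of two consecutive vertices. *)
Definition region_rows : seq (Z * (Z * Z)) :=
  pmap (fun k => let Y := Z.of_nat k in
                 omap (fun ab => (Y, ab)) (lenses_row Y)) (iota 0 600).

Definition rows_area (s : seq (Z * (Z * Z))) : Z :=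
  foldr (fun row n => (row.2.2 - row.2.1 + n)%zz) 0%zz s.

(* [105300 / 150 ^ 2 = 4.68] and [4.68 * 0.46 ^ 2 < 1]: this is where the
   constant [0.46] comes from. *)
Lemma region_rows_area : (rows_area region_rows <=? 105300)%zz = true.
Proof. by vm_compute. Qed.

(** The region keeps a margin of one unit inside a block of side 500, so regions of different blocks
    are disjoint. *)
Lemma region_rows_bounds :
  all (fun row => [&& (1 <=? row.1)%zz, (row.1 <=? 498)%zz, (1 <=? row.2.1)%zz,
                      (row.2.1 <=? row.2.2)%zz & (row.2.2 <=? 499)%zz])
      region_rows.
Proof. by vm_compute. Qed.

Lemma row_gap_ge0 p Y : (0 <= row_gap p Y)%zz.
Proof. exact: Z.le_trans (Z.le_max_r _ _) (Z.le_max_r _ _). Qed.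

Lemma lt_sqrt_succ n : (0 <= n)%zz -> (n < (Z.sqrt n + 1) * (Z.sqrt n + 1))%zz.
Proof. by move=> /Z.sqrt_spec[_]; rewrite Z.add_1_r. Qed.

Lemma Z_of_int_bounds (m : int) : 0 <= m -> m < 600 ->
  (0 <= ssrZ.Z_of_int m)%zz /\ (ssrZ.Z_of_int m < 600)%zz.
Proof. by lia. Qed.

Section Region.
Variable R : realType.

Definition ZtoR (z : Z) : R := (int_of_Z z)%:~R.

Lemma ZtoRD a b : ZtoR (a + b)%zz = ZtoR a + ZtoR b.
Proof. by rewrite /ZtoR -intrD -rmorphD. Qed.

Lemma ZtoRB a b : ZtoR (a - b)%zz = ZtoR a - ZtoR b.
Proof. by rewrite /ZtoR -intrB -rmorphB. Qed.

Lemma ZtoRM a b : ZtoR (a * b)%zz = ZtoR a * ZtoR b.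
Proof. by rewrite /ZtoR -intrM -rmorphM. Qed.

Lemma le_ZtoR a b : (a <= b)%zz -> ZtoR a <= ZtoR b.
Proof. by move=> ab; rewrite /ZtoR ler_int; lia. Qed.

Lemma lt_ZtoR a b : (a < b)%zz -> ZtoR a < ZtoR b.
Proof. by move=> ab; rewrite /ZtoR ltr_int; lia. Qed.

Lemma ZtoR_max a b : ZtoR (Z.max a b) = Num.max (ZtoR a) (ZtoR b).
Proof.
have [h|h] := Z.le_gt_cases a b; rewrite /Order.max.
  by rewrite Z.max_r//; case: ltP => // h'; apply/le_anti; rewrite h' le_ZtoR.
by rewrite Z.max_l; [rewrite ltNge le_ZtoR//; lia|lia].
Qed.

Lemma ZtoR_min a b : ZtoR (Z.min a b) = Num.min (ZtoR a) (ZtoR b).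
Proof.
have [h|h] := Z.le_gt_cases a b; rewrite /Order.min.
  by rewrite Z.min_l//; case: ltP => // h'; apply/le_anti; rewrite h' le_ZtoR.
by rewrite Z.min_r; [rewrite ltNge le_ZtoR//; lia|lia].
Qed.

Definition in_cell (p : Z * Z) (q : R * R) : bool :=
  (ZtoR p.1 <= q.1 <= ZtoR p.1 + 1) && (ZtoR p.2 <= q.2 <= ZtoR p.2 + 1).

Definition in_row (o : option (Z * Z)) (x : R) : bool :=
  if o is Some (a, b) then ZtoR a <= x <= ZtoR b else false.

Definition in_region (q : R * R) : bool :=
  has (fun row => in_row (Some row.2) q.1 && (ZtoR row.1 <= q.2 <= ZtoR row.1 + 1))
    region_rows.

Definition dist2 (p q : R * R) : R := (p.1 - q.1) ^+ 2 + (p.2 - q.2) ^+ 2.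

Lemma normr_sqr (x : R) : `|x| ^+ 2 = x ^+ 2.
Proof. exact/real_normK/num_real. Qed.

Lemma ZtoR1 : ZtoR 1 = 1. Proof. by []. Qed.

Lemma row_gapP p q Y (y : R) : ZtoR p <= q <= ZtoR p + 1 ->
  ZtoR Y <= y <= ZtoR Y + 1 ->
  0 <= ZtoR (row_gap p Y) /\ ZtoR (row_gap p Y) ^+ 2 <= (y - q) ^+ 2.
Proof.
move=> /andP[q1 q2] /andP[y1 y2]; rewrite /row_gap.
rewrite !ZtoR_max !ZtoRB !ZtoRD !ZtoR1.
have -> : ZtoR 0%zz = 0 by [].
set m := Num.max _ _; have m0 : 0 <= m by rewrite /m !le_max lexx !orbT.
split => //; have : m <= `|y - q|.
  rewrite /m !ge_max normr_ge0 andbT.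
  by rewrite [X in X && _]ler_normr [X in _ && X]ler_normr; apply/andP; split;
    apply/orP; [right|left]; lra.
by move=> h; rewrite -(normr_sqr (y - q)) ler_sqr ?nnegrE.
Qed.

Lemma disc_rowP p q Y x y : in_cell p q -> dist2 (x, y) q <= ZtoR 22500 ->
  ZtoR Y <= y <= ZtoR Y + 1 -> in_row (disc_row p Y) x.
Proof.
move=> /andP[/andP[q1 q2] q3] dq yY.
have [d0 d1] := row_gapP q3 yY; rewrite /disc_row.
set d := row_gap _ _ in d0 d1 *.
rewrite /dist2 /= in dq.
have x2 : (x - q.1) ^+ 2 + ZtoR d ^+ 2 <= ZtoR 22500 by lra.
case: ifP => [/Z.ltb_lt h|/Z.ltb_ge h].
  have dR := lt_ZtoR h.
  have n0 : 0 <= ZtoR 150 by rewrite ler0z.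
  have : ZtoR 150 ^+ 2 < ZtoR d ^+ 2 by rewrite ltr_sqr ?nnegrE.
  rewrite expr2 -ZtoRM /= => h'; have := sqr_ge0 (x - q.1); lra.
have n0 : (0 <= 22500 - d * d)%zz.
  by have := Z.mul_le_mono_nonneg _ _ _ _ (@row_gap_ge0 _ _) h (@row_gap_ge0 _ _) h;
     rewrite -/d => ?; exact/Z.le_0_sub.
have /lt_ZtoR := lt_sqrt_succ n0.
have := Z.sqrt_nonneg (22500 - d * d)%zz.
set s := Z.sqrt _ => s0; rewrite /in_row !(ZtoRB, ZtoRM, ZtoRD, ZtoR1).
have /le_ZtoR : (0 <= s)%zz by []; rewrite (_ : ZtoR 0%zz = 0)// => sR0 h2.
have : `|x - q.1| < ZtoR s + 1.
  rewrite -(ltr_pXn2r (n := 2)) ?nnegrE ?normr_sqr //; nra.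
rewrite ltr_norml => /andP[h3 h4]; apply/andP; split; lra.
Qed.

Lemma meet_rowP o1 o2 x : in_row o1 x -> in_row o2 x -> in_row (meet_row o1 o2) x.
Proof.
case: o1 o2 => [[a b]|] [[a' b']|] // /andP[h1 h2] /andP[h3 h4].
rewrite /meet_row; case: ifP => [_|/Z.leb_gt /lt_ZtoR]; rewrite /in_row ZtoR_min ZtoR_max.
  by rewrite ge_max le_min h1 h2 h3 h4.
rewrite ltNge => /negP[]; apply: (@le_trans _ _ x).
  by rewrite ge_max h1 h3.
by rewrite le_min h2 h4.
Qed.

Lemma hull_rowP o1 o2 x : in_row o1 x || in_row o2 x -> in_row (hull_row o1 o2) x.
Proof.
case: o1 o2 => [[a b]|] [[a' b']|] //; rewrite ?orbF//.
rewrite /hull_row /in_row ZtoR_min ZtoR_max ge_min le_max.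
by move=> /orP[/andP[->->]|/andP[->->]]; rewrite ?orbT.
Qed.

Lemma lenses_rowP Y i x : (i < 5)%N -> in_row (lens_row Y i) x ->
  in_row (lenses_row Y) x.
Proof.
move=> i5 h; rewrite /lenses_row.
have : i \in iota 0 5 by rewrite mem_iota.
elim: (iota 0 5) => //= k s ih; rewrite inE => /predU1P[<-|/ih ks].
  by apply: hull_rowP; rewrite h.
by apply: hull_rowP; rewrite ks orbT.
Qed.

Definition vertex (i : nat) : Z * Z := nth (0, 0)%zz pentagon (i %% 5).

(** Both discs meet the row of the integer part of the height of [w], and the row intervals were
    computed for all positions of [q] and [q'] in their cells. *)
Lemma lens_in_region i q q' w : in_cell (vertex i) q -> in_cell (vertex i.+1) q' ->
  dist2 w q <= ZtoR 22500 -> dist2 w q' <= ZtoR 22500 -> in_region w.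
Proof.
case: w => x y.
wlog i5 : i / (i < 5)%N => [wl|].
  move=> h h'; apply: (wl (i %% 5)%N); rewrite ?ltn_mod//.
    by rewrite /vertex modn_mod.
  by move: h'; rewrite /vertex -[in X in X -> _]addn1 -modnDml addn1.
move=> qi qi' wq wq'.
pose Y := ssrZ.Z_of_int (Num.floor y).
have YE : ZtoR Y = (Num.floor y)%:~R by rewrite /ZtoR /Y ssrZ.Z_of_intK.
have yY : ZtoR Y <= y <= ZtoR Y + 1.
  by rewrite YE ge_floor /= -[1]/(1%:~R) -intrD ltW// lt_succ_floor.
(* A vertex has height between 150 and 426, so a point within distance 150 of it is in one of the
   600 scanned rows. *)
have [Y0 Y6] : (0 <= Y)%zz /\ (Y < 600)%zz.
  have [v1 v2] : (150 <= (vertex i).2)%zz /\ ((vertex i).2 <= 425)%zz.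
    by case: i i5 {qi qi'} => [|[|[|[|[|]]]]].
  have E1 : ZtoR 150 = 150 :> R by [].
  have E2 : ZtoR 425 = 425 :> R by [].
  move/le_ZtoR: v1 => v1; move/le_ZtoR: v2 => v2; rewrite E1 in v1; rewrite E2 in v2.
  move: qi => /andP[_ /andP[qi1 qi2]].
  have : `|y - q.2| <= 150.
    rewrite -(ler_pXn2r (n := 2)) ?nnegrE ?normr_sqr//.
    by rewrite -E1 [leRHS]expr2 -ZtoRM; move: wq; rewrite /dist2 /=;
      have := sqr_ge0 (x - q.1); lra.
  rewrite ler_norml => /andP[y1 y2].
  have f0 : (0 <= Num.floor y)%R by rewrite floor_ge_int; lra.
  have f6 : (Num.floor y < 600)%R by rewrite floor_lt_int; lra.
  exact: Z_of_int_bounds.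
have /lenses_rowP-/(_ i5) : in_row (lens_row Y i) x.
  apply: meet_rowP; [apply: (disc_rowP (q := q)) yY|apply: (disc_rowP (q := q')) yY] => //.
  by move: qi; rewrite /vertex modn_small.
case E : (lenses_row Y) => [ab|] //= xab.
apply/hasP; exists (Y, ab); last by rewrite /= xab.
rewrite /region_rows mem_pmap; apply/mapP; exists (Z.to_nat Y).
  by rewrite mem_iota; lia.
by rewrite Z2Nat.id//= E.
Qed.

(** The largest distance between points of [p, p + 1] and [Y, Y + 1], the counterpart of
    [row_gap]. *)
Definition cell_span (p Y : Z) : Z := Z.max (p + 1 - Y) (Y + 1 - p).

Lemma cell_spanP p q Y (y : R) : ZtoR p <= q <= ZtoR p + 1 ->
  ZtoR Y <= y <= ZtoR Y + 1 -> (y - q) ^+ 2 <= ZtoR (cell_span p Y) ^+ 2.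
Proof.
move=> /andP[q1 q2] /andP[y1 y2]; rewrite /cell_span.
rewrite ZtoR_max !ZtoRB !ZtoRD !ZtoR1.
set m := Num.max _ _; have : `|y - q| <= m.
  by rewrite /m ler_norml le_max lerNl le_max; apply/andP; split; apply/orP; 
    [left|right]; lra.
move=> h; rewrite -(normr_sqr (y - q)) ler_sqr ?nnegrE ?normr_ge0//.
exact: le_trans h.
Qed.

(** Edges are tested at the largest distance between the two cells and non-edges at the least, so
    adjacency does not depend on the positions in the cells. *)
Lemma pentagon_adj : all (fun i => all (fun j => (i == j) ||
    let p := nth (0, 0)%zz pentagon i in let q := nth (0, 0)%zz pentagon j in
    if (j == i.+1 %[mod 5]) || (i == j.+1 %[mod 5]) then
      (cell_span p.1 q.1 * cell_span p.1 q.1 + cell_span p.2 q.2 * cell_span p.2 q.2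
         <=? 22500)%zz
    else (22500 <?
      row_gap p.1 q.1 * row_gap p.1 q.1 + row_gap p.2 q.2 * row_gap p.2 q.2)%zz)
  (iota 0 5)) (iota 0 5).
Proof. by vm_compute. Qed.

Lemma cell_adj (i j : 'I_5) q q' : in_cell (vertex i) q -> in_cell (vertex j) q' ->
  i != j -> (dist2 q q' <= ZtoR 22500) = C5 i j.
Proof.
move=> /andP[hi1 hi2] /andP[hj1 hj2] ij.
have /allP/(_ (val i)) := pentagon_adj; rewrite mem_iota ltn_ord => /(_ isT).
move=> /allP/(_ (val j)); rewrite mem_iota ltn_ord => /(_ isT).
rewrite (_ : (val i == val j) = false) /=; last exact: negbTE.
have vE (k : 'I_5) : nth (0, 0)%zz pentagon k = vertex k by rewrite /vertex modn_small.
rewrite !vE /C5_adj /dist2; case: ifP => _.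
- move=> /Z.leb_le /le_ZtoR; rewrite ZtoRD !ZtoRM.
  have := cell_spanP hi1 hj1; have := cell_spanP hi2 hj2 => h1 h2 h3.
  by rewrite -[q.1 - _]opprB -[q.2 - _]opprB !sqrrN !expr2 in h1 h2 *; lra.
- move=> /Z.ltb_lt /lt_ZtoR; rewrite ZtoRD !ZtoRM.
  have [_ h1] := row_gapP hi1 hj1; have [_ h2] := row_gapP hi2 hj2 => h3.
  apply/negbTE; rewrite -ltNge.
  by rewrite -[q.1 - _]opprB -[q.2 - _]opprB !sqrrN !expr2 in h1 h2 *; lra.
Qed.

End Region.

(** * Positivity of the constant *)

Notation plane4 R := (plane R * plane R * plane R * plane R)%type.

Section Patterns.
Context (R : realType).
Implicit Types (x y : R * R) (r : R).

Definition area4 : set (plane4 R) -> \bar R :=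
  (@area R \x @area R \x @area R \x @area R)%E.

HB.instance Definition _ := Measure.on area4.

Lemma edist_affine x u v r : 0 < r ->
  (Defs.edist (affine2 x r u) (affine2 x r v) <= r) = (Defs.edist u v <= 1).
Proof.
move=> r0; rewrite !edist_le ?(ltW r0)// /affine2 /affine /=.
rewrite (_ : _ + _ = r ^+ 2 * ((u.1 - v.1) ^+ 2 + (u.2 - v.2) ^+ 2)); last by ring.
by rewrite -[X in _ <= X]mulr1 ler_pM2l ?exprn_gt0// expr1n.
Qed.

Lemma affine2_0 x r : affine2 x r (0, 0) = x.
Proof. by case: x => a b; rewrite /affine2 /affine /= !mulr0 !addr0. Qed.

Definition edge_pattern r : set (plane R * plane R) :=
  [set p | Defs.edist p.1 p.2 <= r].

Lemma measurable_edge_pattern r : 0 <= r -> measurable (edge_pattern r).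
Proof. by move=> r0; apply: measurable_edist_le. Qed.

Lemma area_edge_section x r : 0 < r ->
  area (xsection (edge_pattern r) x) = (r ^+ 2 * pi)%:E.
Proof.
move=> r0; have [_ _ /(_ (xsection (edge_pattern r) x))] := scales_affine2 x r0.
move=> /(_ (measurable_xsection _ (measurable_edge_pattern (ltW r0)))).
rewrite (_ : _ @^-1` _ = [set y : plane R | Defs.edist (0, 0) y <= 1]); last first.
  apply/seteqP; split => y; rewrite /xsection /= inE /edge_pattern /=;
  by rewrite -{1}(affine2_0 x r) edist_affine.
rewrite area_disc => e.
have : ((r ^+ 2)%:E * pi%:E = (r ^+ 2)%:E *
    ((r^-1 ^+ 2)%:E * area (xsection (edge_pattern r) x)))%E by rewrite e.
rewrite muleA -!EFinM -exprMn mulfV ?gt_eqF// expr1n mul1e.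
by move=> <-.
Qed.

Definition five (x0 : plane R) (x : plane4 R) : 'I_5 -> R * R :=
  tnth [tuple x0; x.1.1.1; x.1.1.2; x.1.2; x.2].

Definition C5_pattern r : set (plane R * plane4 R) :=
  [set p | graph_iso (geom_graph (five p.1 p.2) r) C5].

Lemma forall_I5 (Q : 'I_5 -> Prop) :
  Q (inord 0) -> Q (inord 1) -> Q (inord 2) -> Q (inord 3) -> Q (inord 4) ->
  forall i, Q i.
Proof.
move=> Q0 Q1 Q2 Q3 Q4 i.
have e k : val i = k -> i = inord k by move=> <-; rewrite inord_val.
by case E : (val i) (ltn_ord i) => [|[|[|[|[|k]]]]] //; rewrite (e _ E).
Qed.

Lemma measurable_five d (T : measurableType d) (f : T -> plane R) (g : T -> plane4 R) i :
  measurable_fun setT f -> measurable_fun setT g ->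
  measurable_fun setT (fun w => five (f w) (g w) i : plane R).
Proof.
move=> mf /measurable_fun_pairP[/measurable_fun_pairP[/measurable_fun_pairP[m1 m2] m3] m4].
by elim/forall_I5: i; rewrite /five; under eq_fun do rewrite (tnth_nth (0, 0)) /= inordK //=.
Qed.

Lemma graph_iso_ext (V W : finType) (G G' : sgraph V) (H : sgraph W) :
  (forall u v, G u v = G' u v) -> graph_iso G H -> graph_iso G' H.
Proof. by move=> e [f bf fP]; exists f => // u v; rewrite -e. Qed.

Lemma measurable_C5_pattern r : 0 <= r -> measurable (C5_pattern r).
Proof.
move=> r0.
pose e (k : 'I_5 * 'I_5) (p : plane R * plane4 R) :=
  Defs.edist (five p.1 p.2 k.1) (five p.1 p.2 k.2) <= r.
have me k : measurable [set p | e k p].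
  by apply: measurable_edist_le => //; exact: measurable_five.
pose Q (f : {ffun 'I_5 * 'I_5 -> bool}) := exists2 s : 'I_5 -> 'I_5, bijective s &
  forall u v, (u != v) && f (u, v) = C5 (s u) (s v).
rewrite (_ : C5_pattern r = [set p | Q [ffun k => e k p]]); first exact: measurable_finfun.
apply/seteqP; split => p [s bs h]; exists s => // u v.
  by rewrite ffunE -h.
by rewrite -h ffunE.
Qed.

Definition C5_shape : set (plane4 R) :=
  [set x | graph_iso (geom_graph (five_points x) 1) C5].

Lemma C5_shapeE : C5_shape = xsection (C5_pattern 1) (0, 0).
Proof. by apply/seteqP; split => x; rewrite /xsection /= inE. Qed.

Lemma measurable_C5_shape : measurable C5_shape.
Proof.
rewrite C5_shapeE; apply: measurable_xsection; exact: measurable_C5_pattern.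
Qed.

Lemma five_affine x r (y : plane4 R) i :
  five x (affine8 x r y) i = affine2 x r (five_points y i).
Proof.
by elim/forall_I5: i; rewrite /five /five_points !(tnth_nth (0, 0)) /= !inordK //= affine2_0.
Qed.

Lemma area_C5_section x r : 0 < r ->
  area4 (xsection (C5_pattern r) x) = ((r ^+ 8)%:E * area4 C5_shape)%E.
Proof.
move=> r0; have [_ _ /(_ (xsection (C5_pattern r) x))] := scales_affine8 x r0.
move=> /(_ (measurable_xsection _ (measurable_C5_pattern (ltW r0)))).
rewrite (_ : _ @^-1` _ = C5_shape); last first.
  apply/seteqP; split => y; rewrite /xsection /= inE /C5_pattern /= => h;
  apply: graph_iso_ext h => u v /=; rewrite /geom_adj /= !five_affine ?edist_affine//.
move=> e; rewrite [area4 C5_shape]e muleA -EFinM -exprMn mulfV ?gt_eqF// expr1n mul1e.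
by [].
Qed.

End Patterns.

Lemma product_sigma_finite (R : realType) d1 d2 (V1 : measurableType d1)
    (V2 : measurableType d2) (m1 : {measure set V1 -> \bar R})
    (m2 : {sigma_finite_measure set V2 -> \bar R}) :
  sigma_finite setT m1 -> sigma_finite setT (m1 \x m2)%E.
Proof.
move=> /sigma_finiteP[F [TF ndF Foo]].
have /sigma_finiteP[G [TG ndG Goo]] := sigma_finiteT m2.
exists (fun k => F k `*` G k).
  rewrite -setXTT TF TG predeqE => -[x y]; split.
    move=> [/= [k _ Fkx] [l _ Gly]]; exists (maxn k l) => //; split.
    - by move: x Fkx; exact/subsetPset/ndF/leq_maxl.
    - by move: y Gly; exact/subsetPset/ndG/leq_maxr.
  by move=> [k _ []/= ? ?]; split; exists k.
move=> k; have [? ?] := Foo k; have [? ?] := Goo k; split; first exact: measurableX.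
by rewrite product_measure1E// lte_mul_pinfty// ge0_fin_numE.
Qed.

Lemma area4_sigma_finite (R : realType) : sigma_finite setT (@area4 R).
Proof.
have s2 := product_sigma_finite (@area R) (sigma_finiteT (@area R)).
have s3 := product_sigma_finite (@area R) s2.
exact: (product_sigma_finite (@area R) s3).
Qed.

HB.instance Definition _ (R : realType) :=
  Measure_isSigmaFinite.Build _ _ _ (@area4 R) (@area4_sigma_finite R).

Section PatternMeasure.
Context (R : realType).
Implicit Types (x y : R * R) (r : R).

Lemma edist_coord x y r : Defs.edist x y <= r ->
  `|x.1 - y.1| <= r /\ `|x.2 - y.2| <= r.
Proof.
move=> h; have r0 : 0 <= r by apply: le_trans h; exact: sqrtr_ge0.
move: h; rewrite edist_le// => h.
by split; rewrite -(ler_pXn2r (n := 2)) ?nnegrE// real_normK ?num_real//;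
  apply: le_trans h; rewrite ?lerDl ?lerDr sqr_ge0.
Qed.

Lemma C5_diameter (a b : 'I_5) : exists c : 'I_5,
  ((a == c) || C5 a c) && ((c == b) || C5 c b).
Proof.
have /allP/(_ (val a)) : all (fun a => all (fun b => has (fun c =>
    ((a == c) || nat_C5 a c) && ((c == b) || nat_C5 c b))
  (iota 0 5)) (iota 0 5)) (iota 0 5) by vm_compute.
rewrite mem_iota ltn_ord => /(_ isT)/allP/(_ (val b)).
rewrite mem_iota ltn_ord => /(_ isT)/hasP[c]; rewrite mem_iota => /= c5 h.
by exists (Ordinal c5).
Qed.

(** Two vertices of C5 are joined by at most two edges, each of length at most r. *)
Lemma C5_close (x : 'I_5 -> R * R) r i j : 0 <= r ->
  graph_iso (geom_graph x r) C5 ->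
  `|(x i).1 - (x j).1| <= 2 * r /\ `|(x i).2 - (x j).2| <= 2 * r.
Proof.
move=> r0 [f [g fK gK] fP].
have [c /andP[hi hj]] := C5_diameter (f i) (f j).
have close u v : (f u == f v) || C5 (f u) (f v) ->
    `|(x u).1 - (x v).1| <= r /\ `|(x u).2 - (x v).2| <= r.
  move=> /orP[/eqP/(can_inj fK) ->|]; first by rewrite !subrr normr0.
  by rewrite -fP => /andP[_ /edist_coord].
have [a1 a2] : `|(x i).1 - (x (g c)).1| <= r /\ `|(x i).2 - (x (g c)).2| <= r.
  by apply: close; rewrite gK.
have [b1 b2] : `|(x (g c)).1 - (x j).1| <= r /\ `|(x (g c)).2 - (x j).2| <= r.
  by apply: close; rewrite gK.
have tri (u v w : R) : `|u - w| <= r -> `|w - v| <= r -> `|u - v| <= 2 * r.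
  move=> h1 h2; have -> : u - v = (u - w) + (w - v) by ring.
  by apply: le_trans (ler_normD _ _) _; rewrite mulr_natl mulr2n lerD.
by split; [exact: tri a1 b1|exact: tri a2 b2].
Qed.

Definition rect (a b c d : R) : set (plane R) := `[a, b]%classic `*` `[c, d]%classic.

Lemma measurable_rect a b c d : measurable (rect a b c d).
Proof. by apply: measurableX; exact: measurable_itv. Qed.

Lemma area_rect a b c d : a <= b -> c <= d ->
  area (rect a b c d) = ((b - a) * (d - c))%:E.
Proof.
have len u v : u <= v -> lebesgue_measure (`[u, v]%classic : set (measurableTypeR R)) = (v - u)%:E.
  move=> uv; rewrite lebesgue_measure_itv /= lte_fin; case: ltP => h.
    by rewrite EFinB.
  by rewrite (@le_anti _ _ u v) ?subrr// uv h.
move=> ab cd; rewrite /rect /area product_measure1E; try exact: measurable_itv.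
by rewrite EFinM -!len.
Qed.

Lemma area4_setX (A B C D : set (plane R)) :
  measurable A -> measurable B -> measurable C -> measurable D ->
  area4 (A `*` B `*` C `*` D) = (area A * area B * area C * area D)%E.
Proof.
move=> mA mB mC mD; rewrite /area4.
have e1 : area4 (A `*` B `*` C `*` D) =
    ((@area R \x @area R \x @area R) (A `*` B `*` C) * area D)%E.
  by apply: product_measure1E => //; do 2! apply: measurableX => //.
have e2 : ((@area R \x @area R \x @area R) (A `*` B `*` C) =
    (@area R \x @area R) (A `*` B) * area C)%E.
  by apply: product_measure1E => //; apply: measurableX.
have e3 : ((@area R \x @area R) (A `*` B) = area A * area B)%E.
  exact: product_measure1E.
by apply: (eq_trans e1); rewrite e2 e3.
Qed.

(** This makes the integral behind [mu_C5] finite, so that taking its real value loses nothing. *)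
Lemma C5_shape_bounded :
  (@C5_shape R) `<=` rect (-2) 2 (-2) 2 `*` rect (-2) 2 (-2) 2 `*`
     rect (-2) 2 (-2) 2 `*` rect (-2) 2 (-2) 2.
Proof.
move=> y Cy.
have h i : rect (-2) 2 (-2) 2 (five_points y i).
  have [] := C5_close i (inord 0) ler01 Cy.
  rewrite /five_points [tnth _ (inord 0)](tnth_nth (0, 0)) inordK//=.
  rewrite !subr0 mulr1 !ler_norml.
  by rewrite /rect /= !in_itv /=.
have := (h (inord 1), h (inord 2), h (inord 3), h (inord 4)).
by rewrite /five_points !(tnth_nth (0, 0)) /= !inordK//= => -[[[? ?] ?] ?].
Qed.

Lemma area_C5_shape_lty : (area4 (@C5_shape R) < +oo)%E.
Proof.
have mQ := measurable_rect (-2) 2 (-2) 2.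
have h2 : -2 <= 2 :> R by lra.
apply: le_lt_trans (_ : area4 (rect (-2) 2 (-2) 2 `*` rect (-2) 2 (-2) 2 `*`
     rect (-2) 2 (-2) 2 `*` rect (-2) 2 (-2) 2) < +oo)%E.
  apply: le_measure; rewrite ?inE; first exact: measurable_C5_shape.
    by do 3! apply: measurableX => //.
  exact: C5_shape_bounded.
by rewrite area4_setX// area_rect// -!EFinM ltry.
Qed.

Let unit_cell_rect (i : nat) : set (plane R) :=
  let a := (ZtoR R (vertex i).1 - ZtoR R (vertex 0).1) / 150 in
  let b := (ZtoR R (vertex i).2 - ZtoR R (vertex 0).2) / 150 in
  rect a (a + 150^-1) b (b + 150^-1).

Lemma ZtoR_22500 : ZtoR R 22500%zz = 150 ^+ 2.
Proof. by rewrite expr2; exact: (ZtoRM R 150%zz 150%zz). Qed.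

(** Vertex 0 is pinned to the corner of its cell, moved to the origin, while the other four range
    over cells of positive area: hence mu is positive. *)
Lemma C5_shape_cells :
  unit_cell_rect 1 `*` unit_cell_rect 2 `*` unit_cell_rect 3 `*` unit_cell_rect 4
  `<=` @C5_shape R.
Proof.
move=> y [[[y1 y2] y3] y4].
pose q (u : R * R) : R * R :=
  (ZtoR R (vertex 0).1 + 150 * u.1, ZtoR R (vertex 0).2 + 150 * u.2).
have cellP i u : unit_cell_rect i u -> in_cell (vertex i) (q u).
  rewrite /unit_cell_rect /rect /= !in_itv /= => -[/andP[a1 a2] /andP[b1 b2]].
  rewrite /in_cell /q /=; move: (ZtoR R _) (ZtoR R _) (ZtoR R _) (ZtoR R _) a1 a2 b1 b2
    => z1 z2 z3 z4 a1 a2 b1 b2.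
  by apply/andP; split; apply/andP; split; lra.
have hq (i : 'I_5) : in_cell (vertex i) (q (five_points y i)).
  elim/forall_I5: i; rewrite /five_points (tnth_nth (0, 0)) /= inordK//=.
  - by rewrite /in_cell /q /= !mulr0 !addr0 !lexx !lerDl ler01.
  - exact: cellP.
  - exact: cellP.
  - exact: cellP.
  - exact: cellP.
exists id; first by exists id.
move=> u v; have [<-|uv] := eqVneq u v; first by rewrite !adj_irr.
rewrite -(cell_adj (hq u) (hq v) uv) /geom_graph /= /geom_adj uv /= edist_le//.
rewrite ZtoR_22500 expr1n /dist2 /q /=.
set a := five_points y u; set b := five_points y v.
have -> : forall s t : R * R, (ZtoR R (vertex 0).1 + 150 * s.1 - (ZtoR R (vertex 0).1 + 150 * t.1)) ^+ 2
  + (ZtoR R (vertex 0).2 + 150 * s.2 - (ZtoR R (vertex 0).2 + 150 * t.2)) ^+ 2 =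
  150 ^+ 2 * ((s.1 - t.1) ^+ 2 + (s.2 - t.2) ^+ 2) by move=> s t; ring.
by rewrite -[X in _ = (_ <= X)]mulr1 ler_pM2l// exprn_gt0.
Qed.

Lemma area_C5_shape_gt0 : (0 < area4 (@C5_shape R))%E.
Proof.
have mc i : measurable (unit_cell_rect i) by exact: measurable_rect.
apply: lt_le_trans (_ : area4 (unit_cell_rect 1 `*` unit_cell_rect 2 `*`
     unit_cell_rect 3 `*` unit_cell_rect 4) <= _)%E; last first.
  apply: le_measure; rewrite ?inE; [|exact: measurable_C5_shape|exact: C5_shape_cells].
  by do 3! apply: measurableX => //.
have ac i : area (unit_cell_rect i) = (150^-1 * 150^-1)%:E.
  rewrite area_rect ?lerDl ?invr_ge0//.
  by congr (_%:E); congr (_ * _); rewrite addrAC subrr add0r.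
have c0 : 0 < 150^-1 * 150^-1 :> R by rewrite mulr_gt0// invr_gt0 ltr0n.
rewrite area4_setX// !ac -!EFinM lte_fin.
by apply: (mulr_gt0 _ c0); apply: (mulr_gt0 _ c0); exact: mulr_gt0.
Qed.

Lemma area_C5_shape : area4 (@C5_shape R) = (5`!%:R * mu_C5 R)%:E.
Proof.
rewrite /mu_C5 mulrA mulfV ?pnatr_eq0// mul1r /Rintegral.
have -> : (\int[@area R \x @area R \x @area R \x @area R]_x
    (\1_(@C5_shape R) x)%:E = area4 (@C5_shape R))%E.
  rewrite -/(@area4 R) integral_indic ?setIT//.
  exact: measurable_C5_shape.
by rewrite fineK// ge0_fin_numE ?measure_ge0// area_C5_shape_lty.
Qed.

Lemma mu_C5_gt0 : 0 < mu_C5 R.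
Proof.
by have := area_C5_shape_gt0; rewrite area_C5_shape lte_fin pmulr_rgt0 ?ltr0n.
Qed.

End PatternMeasure.

(** * Uniform points in the square *)

Section BlockMeasurability.
Context d (T : measurableType d) (R : realType) (P : probability T R).
Context d' (T' : measurableType d') (I : finType) (X : I -> {RV P >-> T'}).

(** With this coarser sigma-algebra on [T], depending only on the points of [J] becomes a
    measurability statement. *)
Definition block_space (J : {set I}) := g_sigma_algebraType (block_rectangles X J).

Lemma measurable_block_RV (J : {set I}) i : i \in J ->
  measurable_fun setT (X i : block_space J -> T').
Proof. by move=> iJ _ B mB; rewrite setTI; exact: block_sigma_RV. Qed.

Lemma block_space_measurable (J : {set I}) dV (V : measurableType dV) (Y : T -> V) :
  measurable_fun setT (Y : block_space J -> V) -> measurable_fun setT Y.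
Proof.
move=> mY _ B mB; rewrite setTI; apply: (@block_sigma_measurable _ _ _ _ _ _ _ X J).
by have := mY measurableT B mB; rewrite setTI.
Qed.

Lemma block_independent (J K : {set I}) d1 d2 (V1 : measurableType d1)
    (V2 : measurableType d2) (U : T -> V1) (Y : T -> V2) A B :
  mutually_independent X -> (forall i, i \in J -> i \notin K) ->
  measurable_fun setT (U : block_space J -> V1) ->
  measurable_fun setT (Y : block_space K -> V2) ->
  measurable A -> measurable B ->
  P (U @^-1` A `&` Y @^-1` B) = (P (U @^-1` A) * P (Y @^-1` B))%E.
Proof.
move=> Xi JK mU mY mA mB.
have sA : block_sigma X J (U @^-1` A).
  by have := mU measurableT A mA; rewrite setTI.
have sB : block_sigma X K (Y @^-1` B).
  by have := mY measurableT B mB; rewrite setTI.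
have mUA := block_sigma_measurable sA; have mYB := block_sigma_measurable sB.
rewrite !(prE P)//; last exact: measurableI.
by rewrite -EFinM (block_indep Xi JK sA sB).
Qed.

End BlockMeasurability.

Section UniformPoints.
Context d (T : measurableType d) (R : realType) (P : probability T R).
Context (n : nat) (n_gt0 : (0 < n)%N) (X : 'I_n -> {RV P >-> plane R}).
Hypothesis Xiid : iid_uniform_square X.

Let N : R := n%:R.
Let s : R := Num.sqrt N / 2.

Lemma N_gt0 : 0 < N. Proof. by rewrite ltr0n. Qed.

Lemma sqrtN_gt0 : 0 < Num.sqrt N. Proof. by rewrite sqrtr_gt0 N_gt0. Qed.

Lemma squareE : square n = rect (- s) s (- s) s. Proof. by []. Qed.

Lemma measurable_square : measurable (@square R n).
Proof. by rewrite squareE; exact: measurable_rect. Qed.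

Lemma area_square : area (@square R n) = N%:E.
Proof.
have s0 : 0 < s by rewrite divr_gt0 ?sqrtN_gt0.
rewrite squareE area_rect; [congr (_%:E)|lra|lra].
rewrite opprK -mulr2n -[s *+ 2]mulr_natr /s mulfVK ?pnatr_eq0// -expr2.
by rewrite sqr_sqrtr ?ltW ?N_gt0.
Qed.

Lemma point_density i : has_density P (X i : T -> plane R) (@area R) (@square R n) N^-1.
Proof.
move=> B mB; have := Xiid.2 i B mB; rewrite area_square /=.
by rewrite muleC => <-.
Qed.

Lemma pr_point_le i a b c e : a <= b -> c <= e ->
  pr P (X i @^-1` rect a b c e) <= (b - a) * (e - c) / N.
Proof.
move=> ab ce; have mr := measurable_rect a b c e.
rewrite -lee_fin -prE; last exact: measurable_RV_preimage.
rewrite point_density//.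
have : (area (rect a b c e `&` @square R n) <= area (rect a b c e))%E.
  apply: le_measure; rewrite ?inE//.
  by apply: measurableI => //; exact: measurable_square.
rewrite area_rect// => h.
rewrite mulrC EFinM; apply: lee_wpmul2l => //.
by rewrite lee_fin invr_ge0 ltW ?N_gt0.
Qed.

Lemma pr_point_eq i (B : set (plane R)) : measurable B -> B `<=` @square R n ->
  pr P (X i @^-1` B) = fine (area B) / N.
Proof.
move=> mB Bs; rewrite /pr point_density// setIidl// fineM//; first by rewrite mulrC.
rewrite ge0_fin_numE//; apply: le_lt_trans (_ : area (@square R n) < +oo)%E.
  by apply: le_measure; rewrite ?inE//; exact: measurable_square.
by rewrite area_square ltry.
Qed.

Definition inner_square (rho : R) : set (plane R) :=
  rect (- (s - rho)) (s - rho) (- (s - rho)) (s - rho).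

(** The upper bound ignores the border of the square. The lower bound keeps only the positions of
    [X i] at distance at least [rho] from it, a fraction (1 - 2 rho / sqrt N)^2 of the square, where
    the section is not truncated. *)
Lemma pattern_probability dV (V : measurableType dV)
    (m : {sigma_finite_measure set V -> \bar R}) i (J : {set 'I_n}) (Y : T -> V)
    (S : set V) (E : set (plane R * V)) (c a rho : R) :
  i \notin J -> measurable_fun setT (Y : block_space X J -> V) ->
  measurable S -> measurable E -> 0 <= c -> 0 <= a -> 0 <= rho -> 2 * rho <= Num.sqrt N ->
  has_density P Y m S c ->
  (forall x, m (xsection E x) = a%:E) ->
  (forall x, inner_square rho x -> xsection E x `<=` S) ->
  c * a * (1 - 2 * rho / Num.sqrt N) ^+ 2 <= pr P [set w | E (X i w, Y w)] <= c * a.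
Proof.
move=> iJ mY mS mE c0 a0 rho0 rhoN dY Ea ES.
have mYT := block_space_measurable mY.
have N0 := N_gt0; have sN0 := sqrtN_gt0.
have mXi : measurable_fun setT (X i : T -> plane R) by exact: measurable_funP.
have ind A B : measurable A -> measurable B ->
    P (X i @^-1` A `&` Y @^-1` B) = (P (X i @^-1` A) * P (Y @^-1` B))%E.
  move=> mA mB; apply: (block_independent (X := X) (J := [set i]%SET) (K := J)) => //.
  - exact: Xiid.1.
  - by move=> j; rewrite finset.inE => /eqP ->.
  - by apply: measurable_block_RV; rewrite finset.inE.
have N1 : 0 <= N^-1 by rewrite invr_ge0 ltW.
have := joint_density mXi mYT measurable_square mS N1 c0 (point_density i) dY ind mE.
have mW : measurable [set w | E (X i w, Y w)].
  rewrite -[X in measurable X]setTI.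
  by apply: (measurable_fun_pair mXi mYT).
rewrite (_ : _ @^-1` E = [set w | E (X i w, Y w)])// prE// => PE.
have up : ((@area R \x m) (E `&` (@square R n `*` S)) <= a%:E * area (@square R n))%E.
  apply: product_measure_le => //; first exact: measurable_square.
  by move=> x _; rewrite Ea.
have srho : 0 <= s - rho by rewrite subr_ge0 /s ler_pdivlMr// mulrC.
have in_sub : inner_square rho `<=` @square R n.
  rewrite squareE /inner_square /rect => -[u v] /=; rewrite !in_itv /=.
  by move=> [/andP[h1 h2] /andP[h3 h4]]; split; apply/andP; split; lra.
have lo : (a%:E * area (inner_square rho) <=
    (@area R \x m) (E `&` (@square R n `*` S)))%E.
  apply: product_measure_ge => //; [exact: measurable_square|exact: measurable_rect|].
  by move=> x hx; split; [exact: Ea|exact: ES].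
move: up lo; rewrite area_square /inner_square area_rect; [|lra|lra].
set z := (_ \x _)%E _ in PE *.
have side : 0 <= (s - rho - - (s - rho)) * (s - rho - - (s - rho)) by nra.
move=> up lo.
have zfin : z \is a fin_num.
  rewrite ge0_fin_numE; first by apply: le_lt_trans up _; rewrite -EFinM ltry.
  by apply: le_trans lo; rewrite -EFinM lee_fin mulr_ge0.
move: up lo PE; rewrite -(fineK zfin) -!EFinM !lee_fin => up lo [->].
have sE : s = Num.sqrt N / 2 by [].
have NE : N^-1 = (Num.sqrt N ^+ 2)^-1 by rewrite sqr_sqrtr // ltW.
have c1 : 0 <= N^-1 * c by rewrite mulr_ge0.
apply/andP; split.
  apply: le_trans (ler_wpM2l c1 lo).
  rewrite le_eqVlt; apply/orP; left; apply/eqP.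
  rewrite sE NE; move: (Num.sqrt N) sN0 => t t0; field.
  by rewrite gt_eqF.
apply: le_trans (ler_wpM2l c1 up) _.
by rewrite le_eqVlt; apply/orP; left; apply/eqP; field; rewrite gt_eqF.
Qed.

End UniformPoints.

Section UniformPatterns.
Context d (T : measurableType d) (R : realType) (P : probability T R).
Context (n : nat) (n_gt0 : (0 < n)%N) (X : 'I_n -> {RV P >-> plane R}).
Hypothesis Xiid : iid_uniform_square X.
Context (r : R) (r_gt0 : 0 < r) (r_small : 4 * r <= Num.sqrt n%:R).

Let N : R := n%:R.
Let N0 : 0 < N. Proof. by rewrite ltr0n. Qed.

Lemma inner_square_close (x y : plane R) : inner_square n (2 * r) x ->
  `|x.1 - y.1| <= 2 * r -> `|x.2 - y.2| <= 2 * r -> @square R n y.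
Proof.
rewrite squareE /inner_square /rect /= !in_itv /= => -[/andP[h1 h2] /andP[h3 h4]].
rewrite !ler_norml => /andP[h5 h6] /andP[h7 h8].
by split; apply/andP; split; lra.
Qed.

(** The margin 2 r, twice the length of an edge, yields the same boundary factor for edges as for
    pentagons. *)
Lemma edge_probability i j : i != j ->
  N^-1 * (r ^+ 2 * pi) * (1 - 4 * r / Num.sqrt N) ^+ 2
    <= pr P [set w | Defs.edist (X i w) (X j w) <= r] <= N^-1 * (r ^+ 2 * pi).
Proof.
move=> ij.
rewrite (_ : 4 * r = 2 * (2 * r)); last by ring.
apply: (pattern_probability n_gt0 Xiid (m := @area R) (J := [set j]%SET)
  (Y := X j : T -> plane R) (S := @square R n) (E := edge_pattern r)).
- by rewrite finset.inE.
- by apply: measurable_block_RV; rewrite finset.inE.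
- exact: measurable_square.
- exact: (measurable_edge_pattern (ltW r_gt0)).
- by rewrite invr_ge0 ltW.
- by rewrite mulr_ge0 ?sqr_ge0 ?pi_ge0.
- by rewrite mulr_ge0// ltW.
- by move: r_small; lra.
- exact: point_density.
- by move=> x; exact: area_edge_section.
- move=> x xin y; rewrite /xsection /= inE => /edist_coord[h1 h2].
  have r2 : r <= 2 * r by rewrite ler_peMl ?ler1n ?ltW.
  by apply: (inner_square_close xin); [exact: le_trans h1 r2|exact: le_trans h2 r2].
Qed.

Lemma C5_probability (g : 'I_5 -> 'I_n) : injective g ->
  N^-1 ^+ 4 * (r ^+ 8 * (5`!%:R * mu_C5 R)) * (1 - 4 * r / Num.sqrt N) ^+ 2
    <= pr P [set w | graph_iso (geom_graph (fun k => X (g k) w : R * R) r) C5]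
    <= N^-1 ^+ 4 * (r ^+ 8 * (5`!%:R * mu_C5 R)).
Proof.
move=> ginj.
have mu0 := mu_C5_gt0 R.
pose Z k : {RV P >-> plane R} := X (g (inord k)).
pose Y w : plane4 R := (Z 1 w, Z 2 w, Z 3 w, Z 4 w)%N.
have gne k l : (k < 5)%N -> (l < 5)%N -> k != l -> g (inord k) != g (inord l).
  move=> k5 l5; apply: contra => /eqP/ginj/(congr1 val) /=.
  by rewrite !inordK// => ->.
rewrite (_ : [set w | _] = [set w | C5_pattern r (Z 0%N w, Y w)]); last first.
  have e w k : five (Z 0%N w) (Y w) k = X (g k) w.
    by elim/forall_I5: k; rewrite /five (tnth_nth (0, 0)) inordK.
  by apply/seteqP; split=> w; apply: graph_iso_ext => u v; rewrite /= /geom_adj /= !e.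
pose J : {set 'I_n} := [set g (inord 1); g (inord 2); g (inord 3); g (inord 4)]%SET.
have mZ (K : {set 'I_n}) k : g (inord k) \in K ->
    measurable_fun setT (Z k : block_space X K -> plane R).
  by move=> h; exact: measurable_block_RV.
have mZT k : measurable_fun setT (Z k : T -> plane R) by exact: measurable_funP.
have mS := @measurable_square R n.
have N1 : 0 <= N^-1 by rewrite invr_ge0 ltW.
have dZ k : has_density P (Z k : T -> plane R) (@area R) (@square R n) N^-1.
  exact: point_density.
(* The joint density of the four other points is built up one independent point at a time. *)
have d2 : has_density P (fun w => (Z 1%N w, Z 2%N w) : plane R * plane R)
    (@area R \x @area R)%E (@square R n `*` @square R n) (N^-1 * N^-1).
  apply: joint_density => //.
  move=> A B mA mB; apply: (block_independent (X := X) (J := [set g (inord 1)]%SET)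
      (K := [set g (inord 2)]%SET)) => //.
  - exact: Xiid.1.
  - by move=> i; rewrite !finset.inE => /eqP ->; exact: gne.
  - by apply: mZ; rewrite finset.inE.
  - by apply: mZ; rewrite finset.inE.
have d3 : has_density P (fun w => (Z 1%N w, Z 2%N w, Z 3%N w) : plane R * plane R * plane R)
    (@area R \x @area R \x @area R)%E (@square R n `*` @square R n `*` @square R n)
    (N^-1 * N^-1 * N^-1).
  apply: joint_density => //.
  - exact: measurable_fun_pair.
  - exact: measurableX.
  - exact: mulr_ge0.
  move=> A B mA mB; apply: (block_independent (X := X)
      (J := [set g (inord 1); g (inord 2)]%SET) (K := [set g (inord 3)]%SET)) => //.
  - exact: Xiid.1.
  - by move=> i; rewrite !finset.inE => /orP[]/eqP ->; exact: gne.
  - by apply: measurable_fun_pair; apply: mZ; rewrite !finset.inE eqxx ?orbT.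
  - by apply: mZ; rewrite finset.inE.
have d4 : has_density P (Y : T -> plane4 R) (@area4 R)
    (@square R n `*` @square R n `*` @square R n `*` @square R n) (N^-1 ^+ 4).
  rewrite (_ : N^-1 ^+ 4 = N^-1 * N^-1 * N^-1 * N^-1); last by ring.
  apply: joint_density => //.
  - by apply: measurable_fun_pair => //; exact: measurable_fun_pair.
  - by do 2! apply: measurableX => //.
  - by do 2! apply: mulr_ge0 => //.
  move=> A B mA mB; apply: (block_independent (X := X)
      (J := [set g (inord 1); g (inord 2); g (inord 3)]%SET)
      (K := [set g (inord 4)]%SET)) => //.
  - exact: Xiid.1.
  - by move=> i; rewrite !finset.inE -orbA => /or3P[]/eqP ->; exact: gne.
  - by apply: measurable_fun_pair; [apply: measurable_fun_pair|]; apply: mZ; rewrite !finset.inE eqxx ?orbT.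
  - by apply: mZ; rewrite finset.inE.
rewrite (_ : 4 * r = 2 * (2 * r)); last by ring.
have PP := (pattern_probability n_gt0 Xiid (m := @area4 R) (i := g (inord 0)) (J := J) (Y := Y)
  (S := @square R n `*` @square R n `*` @square R n `*` @square R n) (E := C5_pattern r) (c := N^-1 ^+ 4) (a := r ^+ 8 * (5`!%:R * mu_C5 R)) (rho := 2 * r)).
apply: PP.
- by rewrite !finset.inE -!orbA !negb_or !gne.
- by apply: measurable_fun_pair; [apply: measurable_fun_pair; [apply: measurable_fun_pair|]|];
    apply: mZ; rewrite !finset.inE eqxx ?orbT.
- by do 3! apply: measurableX => //.
- exact: (measurable_C5_pattern (ltW r_gt0)).
- by rewrite exprn_ge0.
- exact: mulr_ge0 (exprn_ge0 8 (ltW r_gt0)) (mulr_ge0 (ler0n _ _) (ltW mu0)).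
- by rewrite mulr_ge0// ltW.
- by move: r_small; lra.
- exact: d4.
- move=> x; rewrite EFinM -area_C5_shape; exact: area_C5_section.
- move=> x xin y; rewrite /xsection /= inE => Cy.
  have h k : square n (five x y k).
    have [] := C5_close (inord 0) k (ltW r_gt0) Cy.
    rewrite {1 3}/five !(tnth_nth (0, 0)) inordK//=; exact: inner_square_close.
  have := (h (inord 1), h (inord 2), h (inord 3), h (inord 4)).
  by rewrite /five !(tnth_nth (0, 0)) /= !inordK//= => -[[[? ?] ?] ?].
Qed.

End UniformPatterns.

(** * Void probabilities *)

Section BlockSigmaClosure.
Context d (T : measurableType d) (R : realType) (P : probability T R).
Context d' (T' : measurableType d') (I : finType) (X : I -> {RV P >-> T'}).

Lemma block_sigmaT (J : {set I}) : block_sigma X J setT.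
Proof. exact: (@measurableT _ (g_sigma_algebraType (block_rectangles X J))). Qed.

Lemma block_sigmaI (J : {set I}) A B :
  block_sigma X J A -> block_sigma X J B -> block_sigma X J (A `&` B).
Proof. exact: (@measurableI _ (g_sigma_algebraType (block_rectangles X J))). Qed.

Lemma block_sigmaC (J : {set I}) A : block_sigma X J A -> block_sigma X J (~` A).
Proof. exact: (@measurableC _ (g_sigma_algebraType (block_rectangles X J))). Qed.

Lemma block_rectanglesW (J K : {set I}) : J \subset K ->
  block_rectangles X J `<=` block_rectangles X K.
Proof.
move=> /fintype.subsetP JK A [B mB ->].
exists (fun i => if i \in J then B i else setT) => [i|]; first by case: ifP.
apply/seteqP; split=> [w h i /= iK|w h i /= iJ].
  by case: ifP => // iJ; exact: h.
by have := h i (JK _ iJ); rewrite /= iJ.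
Qed.

Lemma block_sigmaW (J K : {set I}) A : J \subset K ->
  block_sigma X J A -> block_sigma X K A.
Proof.
move=> JK; apply: smallest_sub; first exact: smallest_sigma_algebra.
by move=> B /(block_rectanglesW JK); exact: sub_sigma_algebra.
Qed.

End BlockSigmaClosure.

Section PoissonVoid.
Context d (T : measurableType d) (R : realType) (P : probability T R).
Context d' (T' : measurableType d') (I : finType) (X : I -> {RV P >-> T'}).
Hypothesis Xind : mutually_independent X.
Context (K : choiceType) (supp : K -> {set I}) (A W : K -> set T).

Definition void (s : seq K) : set T := \big[setI/setT]_(a <- s) ~` A a.

Let p a : R := pr P (A a).

(* Revealing the events one at a time, [A a] is independent of the earlier
   events not sharing an index with it, and the others all lie in [W a]. *)
Lemma void_probability (s : seq K) : uniq s ->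
  (forall a, block_sigma X (supp a) (A a)) ->
  (forall a, measurable (W a)) ->
  {in s &, forall a b, a != b -> (exists2 i, i \in supp a & i \in supp b) ->
     A b `<=` W a} ->
  `|pr P (void s) - \prod_(a <- s) (1 - p a)|
    <= \sum_(a <- s) (p a * pr P (W a) + pr P (A a `&` W a)).
Proof.
move=> us sA mW.
have mA a : measurable (A a) by exact: block_sigma_measurable (sA a).
have mV t : measurable (void t).
  by apply: bigsetI_measurable => a _; exact: measurableC.
have p01 a : 0 <= p a <= 1 by rewrite pr_ge0 pr_le1.
elim: s us => [|a s ih] /=; first by rewrite /void !big_nil prT subrr normr0.
move=> /andP[ans us] AW.
have ms b : b \in s -> b \in a :: s by rewrite inE orbC => ->.
have {}ih := ih us (fun b c bs cs => AW b c (ms _ bs) (ms _ cs)).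
pose D := \big[setI/setT]_(b <- s | [forall i in supp a, i \notin supp b]) ~` A b.
have sD : block_sigma X (~: supp a)%SET D.
  rewrite /D; elim/big_ind: _ => //; first exact: block_sigmaT.
    by move=> ? ?; exact: block_sigmaI.
  move=> b /forall_inP ab; apply: block_sigmaC; apply: block_sigmaW (sA b).
  apply/fintype.subsetP => i ib; rewrite finset.inE; apply/negP => /ab.
  by rewrite ib.
have mD : measurable D := block_sigma_measurable sD.
have VD : void s `<=` D.
  rewrite /void /D -bigcap_seq -bigcap_seq_cond => w h b /= /andP[bs _].
  by have := h b; rewrite /= bs; apply.
have DV : D `<=` void s `|` W a.
  move=> w Dw; have [Ww|nWw] := pselect (W a w); [by right|left].
  rewrite /void -bigcap_seq => b /= bs Abw.
  have [ab|] := boolP [forall i in supp a, i \notin supp b].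
    by move: Dw; rewrite /D -bigcap_seq_cond => /(_ b); rewrite /= bs ab; apply.
  rewrite -fintype.negb_exists_in negbK => /exists_inP[i ia ib].
  apply: nWw; apply: (AW a b _ _ _ _ w Abw).
  - exact: mem_head.
  - by rewrite inE bs orbT.
  - by apply: contraNneq ans => ->.
  - by exists i.
have AD : pr P (A a `&` D) = p a * pr P D.
  by apply: (block_indep Xind _ (sA a) sD) => i ia; rewrite finset.inE negbK.
have Vcons : void (a :: s) = void s `\` A a.
  by rewrite /void big_cons setIC.
have e1 : pr P (void s) = pr P (A a `&` void s) + pr P (void (a :: s)).
  by rewrite (prD P (mV s) (mA a)) Vcons setIC.
have e2 : pr P (A a `&` void s) <= p a * pr P D.
  rewrite -AD; apply: le_pr; [exact: measurableI|exact: measurableI|].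
  by move=> w [Aw Vw]; split => //; exact: VD.
have e3 : p a * pr P D <= pr P (A a `&` void s) + pr P (A a `&` W a).
  rewrite -AD; apply: le_trans (pr_leU _ _ _); [|exact: measurableI|exact: measurableI].
  apply: le_pr; [exact: measurableI|apply: measurableU; exact: measurableI|].
  by move=> w [Aw /DV[?|?]]; [left|right].
have e4 : pr P (void s) <= pr P D by apply: le_pr.
have e5 : pr P D <= pr P (void s) + pr P (W a).
  apply: le_trans (pr_leU _ (mV s) (mW a)); apply: le_pr => //; exact: measurableU.
rewrite !big_cons.
set v := pr P (void s) in e1 e3 e4 e5 ih *.
set v' := pr P (void (a :: s)) in e1 *.
set q := \prod_(_ <- s) _ in ih *.
set S := \sum_(_ <- s) _ in ih *.
have /andP[p0 p1] := p01 a.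
have C0 := pr_ge0 P (A a `&` W a); have W0 := pr_ge0 P (W a).
(* The first bracket measures the dependence of [A a] on the other events; the second is the
   inherited error, which the factor 1 - p a does not increase. *)
have -> : v' - (1 - p a) * q =
    (v' - (1 - p a) * v) + (1 - p a) * (v - q) by ring.
apply: le_trans (ler_normD _ _) _; apply: lerD; last first.
  rewrite normrM ger0_norm ?subr_ge0//; apply: le_trans ih.
  by rewrite ler_piMl// gerBl.
have h1 : p a * v <= p a * pr P D by rewrite ler_wpM2l.
have h2 : p a * pr P D <= p a * (v + pr P (W a)) by rewrite ler_wpM2l.
rewrite ler_norml; apply/andP; split; move: (pr P (A a `&` void s)) e1 e2 e3 => z; nra.
Qed.

End PoissonVoid.

(** * Points close to each other *)

Section Near.
Context (R : realType).

(** Boxes instead of discs: events about close points are then covered by rectangles, whose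
    probabilities multiply. *)
Definition near_box (rho : R) (x y : R * R) : bool :=
  (`|x.1 - y.1| <= rho) && (`|x.2 - y.2| <= rho).

Lemma near_box_sym rho x y : near_box rho x y = near_box rho y x.
Proof. by rewrite /near_box distrC [X in _ && (X <= _)]distrC. Qed.

Lemma near_boxW rho rho' x y : rho <= rho' -> near_box rho x y -> near_box rho' x y.
Proof.
by move=> h /andP[h1 h2]; rewrite /near_box !(le_trans _ h).
Qed.

Lemma near_box_trans rho rho' x y z : near_box rho x y -> near_box rho' y z ->
  near_box (rho + rho') x z.
Proof.
move=> /andP[h1 h2] /andP[h3 h4]; apply/andP; split.
  have -> : x.1 - z.1 = (x.1 - y.1) + (y.1 - z.1) by ring.
  by apply: le_trans (ler_normD _ _) _; exact: lerD.
have -> : x.2 - z.2 = (x.2 - y.2) + (y.2 - z.2) by ring.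
by apply: le_trans (ler_normD _ _) _; exact: lerD.
Qed.

Lemma near_boxxx rho x : 0 <= rho -> near_box rho x x.
Proof. by move=> r0; rewrite /near_box !subrr normr0 r0. Qed.

Lemma measurable_near_box d (T : measurableType d) (f g : T -> plane R) rho :
  measurable_fun setT f -> measurable_fun setT g ->
  measurable [set w | near_box rho (f w) (g w)].
Proof.
move=> /measurable_fun_pairP[f1 f2] /measurable_fun_pairP[g1 g2].
have m (u v : T -> measurableTypeR R) : measurable_fun setT u -> measurable_fun setT v ->
    measurable [set w | `|u w - v w| <= rho].
  move=> mu mv; pose h w : R := `|u w - v w|.
  have mh : measurable_fun setT h.
    by apply: measurableT_comp => //; apply: measurable_funB.
  rewrite (_ : [set w | _] = setT `&` h @^-1` `]-oo, rho]); first exact: mh.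
  by apply/seteqP; split=> w /=; rewrite in_itv/=; [split|case].
rewrite (_ : [set w | _] = [set w | `|(f w).1 - (g w).1| <= rho] `&`
  [set w | `|(f w).2 - (g w).2| <= rho]).
  by apply: measurableI; exact: m.
by apply/seteqP; split=> w /= => [/andP[]|[h1 h2]] //; apply/andP.
Qed.

End Near.

Section Cluster.
Context d (T : measurableType d) (R : realType) (P : probability T R).
Context (n : nat) (n_gt0 : (0 < n)%N) (X : 'I_n -> {RV P >-> plane R}).
Hypothesis Xiid : iid_uniform_square X.

Let N : R := n%:R.
Let t : R := Num.sqrt N.
Let N0 : 0 < N. Proof. by rewrite ltr0n. Qed.
Let t0 : 0 < t. Proof. by rewrite sqrtr_gt0. Qed.
Let tN : t ^+ 2 = N. Proof. by rewrite sqr_sqrtr// ltW. Qed.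

Lemma pr_rectangles (J : {set 'I_n}) (B : 'I_n -> set (plane R)) :
  (forall i, measurable (B i)) ->
  pr P (\bigcap_(i in [set` J]) (X i @^-1` B i)) = \prod_(i in J) pr P (X i @^-1` B i).
Proof.
move=> mB; have h i : P (X i @^-1` B i) = (pr P (X i @^-1` B i))%:E.
  by rewrite prE//; exact: measurable_RV_preimage.
have e : P (\bigcap_(i in [set` J]) (X i @^-1` B i)) =
    (\prod_(i in J) pr P (X i @^-1` B i))%:E.
  by rewrite Xiid.1// -prodEFin; apply: eq_bigr => i _; exact: h.
by rewrite {1}/pr e.
Qed.

Lemma pr_outside_square i : pr P (X i @^-1` (~` @square R n)) = 0.
Proof.
have mS := @measurable_square R n.
have e : pr P (X i @^-1` @square R n) = 1.
  rewrite (pr_point_eq n_gt0 Xiid i mS)//.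
  by rewrite (area_square R n_gt0) /= mulfV// gt_eqF.
rewrite -preimage_setC prC ?e ?subrr//.
exact: measurable_RV_preimage.
Qed.

(** Cover the square by at most 4 N / rho^2 cells of side rho. If [X i0] is in a given cell, which
    has probability at most rho^2 / N, every point near it is in the concentric square of side 3
    rho, which gives a factor 9 rho^2 / N for each point of [J]. *)
Lemma cluster_probability (rho : R) i0 (J : {set 'I_n}) : 0 < rho -> rho <= t ->
  i0 \notin J ->
  pr P [set w | [forall j in J, near_box rho (X i0 w) (X j w)]]
    <= 4 * (9 * rho ^+ 2 / N) ^+ #|J|.
Proof.
move=> rho0 rhot i0J.
set E := [set w | _].
have mXT i : measurable_fun setT (X i : T -> plane R) by exact: measurable_funP.
have mE : measurable E.
  rewrite (_ : E = \bigcap_(j in [set` J]) [set w | near_box rho (X i0 w) (X j w)]).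
    apply: fin_bigcap_measurable; first exact: finite_finset.
    by move=> j _; exact: measurable_near_box.
  apply/seteqP; split=> w /= => [/forall_inP h j|h]; first exact: h.
  by apply/forall_inP => j; exact: h.
pose m := Num.truncn (t / rho).
pose pos (k : nat) : R := - (t / 2) + k%:R * rho.
pose cell (c : 'I_m.+1 * 'I_m.+1) := rect (pos c.1) (pos c.1 + rho) (pos c.2) (pos c.2 + rho).
pose nb (c : 'I_m.+1 * 'I_m.+1) := rect (pos c.1 - rho) (pos c.1 + 2 * rho)
   (pos c.2 - rho) (pos c.2 + 2 * rho).
pose B c i := if i == i0 then cell c else nb c.
pose Ec c := \bigcap_(i in [set` (i0 |: J)%SET]) (X i @^-1` B c i).
have mB c i : measurable (B c i) by rewrite /B; case: ifP => _; exact: measurable_rect.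
have mEc c : measurable (Ec c).
  apply: fin_bigcap_measurable; first exact: finite_finset.
  by move=> i _; exact: measurable_RV_preimage.
have mO : measurable (X i0 @^-1` (~` @square R n)).
  apply: measurable_RV_preimage; apply: measurableC; exact: measurable_square.
have rr : 0 <= rho ^+ 2 / N by rewrite divr_ge0 ?sqr_ge0// ltW.
have step : pr P (E `\` (X i0 @^-1` (~` @square R n))) <=
    \sum_(c : 'I_m.+1 * 'I_m.+1) pr P (Ec c).
  apply: pr_le_exists => //; first exact: measurableD.
  move=> w [Ew]; rewrite /preimage /= => /contrapT; rewrite squareE /rect /=.
  rewrite !in_itv /= -/N -/t => -[/andP[x1 x2] /andP[y1 y2]].
  have idx (u : R) : - (t / 2) <= u -> u <= t / 2 ->
      exists k : 'I_m.+1, pos k <= u <= pos k + rho.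
    move=> u1 u2; pose k := Num.truncn ((u + t / 2) / rho).
    have u0 : 0 <= (u + t / 2) / rho by apply: divr_ge0; [lra|exact: ltW].
    have km : (k < m.+1)%N.
      rewrite ltnS /m truncn_ge_nat; last by apply: divr_ge0; exact: ltW.
      apply: le_trans (_ : (u + t / 2) / rho <= _); first by rewrite truncn_le.
      by rewrite ler_pM2r ?invr_gt0//; lra.
    exists (Ordinal km); rewrite /pos /=.
    have k1 : k%:R * rho <= u + t / 2.
      by rewrite -ler_pdivlMr// truncn_le.
    have k2 : u + t / 2 < k.+1%:R * rho.
      by rewrite -ltr_pdivrMr//; exact: truncnS_gt.
    have kS : k.+1%:R = k%:R + 1 :> R by rewrite natr1.
    by rewrite kS in k2; apply/andP; split; lra.
  have [k1 /andP[a1 a2]] := idx _ x1 x2; have [k2 /andP[b1 b2]] := idx _ y1 y2.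
  exists (k1, k2) => // i /= /setU1P[->|iJ].
    by rewrite /B eqxx /cell /rect /= !in_itv /= a1 a2 b1 b2.
  have /andP[] := forall_inP Ew i iJ; rewrite !ler_norml => /andP[c1 c2] /andP[d1 d2].
  rewrite /B ifF; last by apply: contraNF i0J => /eqP <-.
  by rewrite /nb /rect /= !in_itv /=; split; apply/andP; split; lra.
have prEc c : pr P (Ec c) <= (rho ^+ 2 / N) * (9 * rho ^+ 2 / N) ^+ #|J|.
  rewrite pr_rectangles// big_setU1//=; apply: ler_pM; first exact: pr_ge0.
  - by apply: prodr_ge0 => i _; exact: pr_ge0.
  - rewrite /B eqxx; apply: le_trans (pr_point_le n_gt0 Xiid _ _ _) _; [lra|lra|].
    by rewrite le_eqVlt; apply/orP; left; apply/eqP; congr (_ / _); ring.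
  rewrite -prodr_const; apply: ler_prod => i iJ; rewrite pr_ge0 /=.
  rewrite /B ifF; last by apply: contraNF i0J => /eqP <-.
  apply: le_trans (pr_point_le n_gt0 Xiid _ _ _) _; [lra|lra|].
  by rewrite le_eqVlt; apply/orP; left; apply/eqP; congr (_ / _); ring.
have up : pr P E <= \sum_(c : 'I_m.+1 * 'I_m.+1) pr P (Ec c).
  rewrite (prD P mE mO) -[leRHS]add0r; apply: lerD => //.
  rewrite -(pr_outside_square i0).
  by apply: le_pr; [exact: measurableI|exact: mO|move=> w []].
apply: (le_trans up); apply: le_trans (ler_sum _ (fun c _ => prEc c)) _.
rewrite sumr_const card_prod card_ord.
set y := (_ ^+ #|J|); have y0 : 0 <= y by rewrite exprn_ge0// -mulrA mulr_ge0.
rewrite -[leLHS]mulr_natr mulrAC; apply: ler_wpM2r => //.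
rewrite natrM mulrAC ler_pdivrMr// -tN.
have mt : m.+1%:R * rho <= 2 * t.
  have h : m%:R * rho <= t.
    by rewrite -ler_pdivlMr// truncn_le; apply: divr_ge0; exact: ltW.
  by have -> : m.+1%:R = m%:R + 1 :> R by [rewrite natr1]; lra.
have m0 : 0 <= m.+1%:R * rho by rewrite mulr_ge0// ltW.
nra.
Qed.

End Cluster.

Lemma prodr_seq_bounds (R : realDomainType) (K : eqType) (s : seq K) (f : K -> R) x y :
  0 <= x -> {in s, forall a, x <= f a <= y} ->
  x ^+ size s <= \prod_(a <- s) f a <= y ^+ size s.
Proof.
move=> x0; elim: s => [|a s ih] h; first by rewrite big_nil !expr0 lexx.
have /andP[h1 h2] : x <= f a <= y by apply: h; rewrite mem_head.
have /andP[h3 h4] := ih (fun b bs => h b (mem_behead (s := a :: s) bs)).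
rewrite big_cons /= !exprS; apply/andP; split.
  by apply: ler_pM => //; exact: exprn_ge0.
apply: ler_pM => //; first exact: le_trans h1.
by apply: le_trans h3; exact: exprn_ge0.
Qed.

Section ClusterVoid.
Context d (T : measurableType d) (R : realType) (P : probability T R).
Context (n : nat) (n_gt0 : (0 < n)%N) (X : 'I_n -> {RV P >-> plane R}).
Hypothesis Xiid : iid_uniform_square X.

Let N : R := n%:R.
Let N0 : 0 < N. Proof. by rewrite ltr0n. Qed.

Context (k : nat) (rho lo hi : R).
Hypotheses (rho_gt0 : 0 < rho) (rho_small : rho <= Num.sqrt N).
Context (A : {set 'I_n} -> set T).
Hypothesis A_block : forall a, block_sigma X a (A a).
Hypothesis A_near : forall (a : {set 'I_n}) w i j, #|a| = k -> A a w -> i \in a -> j \in a ->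
  near_box rho (X i w) (X j w).
Hypothesis A_pr : forall a : {set 'I_n}, #|a| = k -> lo <= pr P (A a) <= hi.
Hypothesis hi_le1 : hi <= 1.

Let W (a : {set 'I_n}) : set T :=
  [set w | [exists ij : 'I_n * 'I_n, [&& ij.1 \in a, ij.2 \notin a &
     near_box rho (X ij.1 w) (X ij.2 w)]]].

(** The singleton puts the event into the form that [cluster_probability] handles. *)
Let near_event (ij : 'I_n * 'I_n) : set T :=
  [set w | [forall j in [set ij.2]%SET, near_box rho (X ij.1 w) (X j w)]].

(** When [A a] occurs and an outside point [ij.2] is near [ij.1], that point of [a] has [#|a|] near
    points: the rest of [a] and the outsider. *)
Let star_event (a : {set 'I_n}) (ij : 'I_n * 'I_n) : set T :=
  [set w | [forall j in (ij.2 |: a :\ ij.1)%SET, near_box rho (X ij.1 w) (X j w)]].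

Let measurable_near i j : measurable [set w | near_box rho (X i w) (X j w)].
Proof. by apply: measurable_near_box; exact: measurable_funP. Qed.

Let measurable_star i (J : {set 'I_n}) :
  measurable [set w | [forall j in J, near_box rho (X i w) (X j w)]].
Proof.
rewrite (_ : [set w | _] =
    \bigcap_(j in [set` J]) [set w | near_box rho (X i w) (X j w)]).
  by apply: fin_bigcap_measurable => //; exact: finite_finset.
apply/seteqP; split=> w /= => [/forall_inP h j|h]; first exact: h.
by apply/forall_inP => j; exact: h.
Qed.

Let measurable_W a : measurable (W a).
Proof.
rewrite (_ : W a = \bigcup_(ij in [set ij : 'I_n * 'I_n | (ij.1 \in a) && (ij.2 \notin a)])
    [set w | near_box rho (X ij.1 w) (X ij.2 w)]).
  by apply: fin_bigcup_measurable => //; exact: finite_finset.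
apply/seteqP; split=> w /=.
  by move=> /existsP[ij /and3P[h1 h2 h3]]; exists ij => //=; rewrite h1 h2.
by move=> [ij /andP[h1 h2] h3]; apply/existsP; exists ij; apply/and3P.
Qed.

Let pairs (a : {set 'I_n}) : {set 'I_n * 'I_n} := finset.setX a (~: a)%SET.

Let card_pairs (a : {set 'I_n}) : #|a| = k -> (#|pairs a|%:R <= k%:R * N :> R).
Proof.
move=> ak; rewrite cardsX ak -natrM ler_nat leq_mul2l.
by rewrite -[X in (_ <= X)%N](card_ord n) max_card orbT.
Qed.

Let star_ge0 m : 0 <= 4 * (9 * rho ^+ 2 / N) ^+ m.
Proof.
apply: mulr_ge0 => //; apply: exprn_ge0; apply: divr_ge0; last exact: ltW.
by apply: mulr_ge0 => //; exact: sqr_ge0.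
Qed.

Let pr_W (a : {set 'I_n}) : #|a| = k -> pr P (W a) <= k%:R * N * (4 * (9 * rho ^+ 2 / N) ^+ 1).
Proof.
move=> ak; apply: le_trans (_ : \sum_(ij in pairs a) pr P (near_event ij) <= _).
  apply: pr_le_exists => //; first by move=> ij; exact: measurable_star.
  move=> w /existsP[ij /and3P[h1 h2 h3]]; exists ij.
    by rewrite !finset.inE h1 h2.
  by apply/forall_inP => j /set1P ->.
have y0 := star_ge0 1.
apply: le_trans (_ : \sum_(ij in pairs a) (4 * (9 * rho ^+ 2 / N) ^+ 1) <= _).
  apply: ler_sum => -[i j] /setXP[/= ia ja]; rewrite -[X in _ ^+ X](cards1 j).
  apply: (cluster_probability n_gt0 Xiid) => //.
  by apply/set1P => /= ij; move: ja; rewrite finset.inE /= -ij ia.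
by rewrite sumr_const -[leLHS]mulr_natl ler_wpM2r// card_pairs.
Qed.

Let pr_AW (a : {set 'I_n}) : #|a| = k ->
  pr P (A a `&` W a) <= k%:R * N * (4 * (9 * rho ^+ 2 / N) ^+ k).
Proof.
move=> ak; apply: le_trans (_ : \sum_(ij in pairs a) pr P (star_event a ij) <= _).
  apply: pr_le_exists.
  - apply: measurableI; last exact: measurable_W.
    exact: (block_sigma_measurable (@A_block a)).
  - by move=> ij; exact: measurable_star.
  move=> w [Aw /existsP[ij /and3P[h1 h2 h3]]]; exists ij.
    by rewrite !finset.inE h1 h2.
  apply/forall_inP => j /setU1P[-> //|/setD1P[_ ja]].
  exact: A_near Aw h1 ja.
have y0 := star_ge0 k.
apply: le_trans (_ : \sum_(ij in pairs a) (4 * (9 * rho ^+ 2 / N) ^+ k) <= _).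
  apply: ler_sum => -[i j] /setXP[/= ia]; rewrite finset.inE => ja.
  have -> : k = #|(j |: a :\ i)%SET|.
    rewrite cardsU1 -ak (cardsD1 i a) ia; congr (_ + _)%N.
    by rewrite !finset.inE (negbTE ja) andbF.
  apply: (cluster_probability n_gt0 Xiid) => //.
  rewrite !finset.inE eqxx /= orbF; by apply: contraNneq ja => <-.
by rewrite sumr_const -[leLHS]mulr_natl ler_wpM2r// card_pairs.
Qed.

Definition void_error : R :=
  'C(n, k)%:R * (hi * (k%:R * N * (4 * (9 * rho ^+ 2 / N) ^+ 1))
    + k%:R * N * (4 * (9 * rho ^+ 2 / N) ^+ k)).

(** [void_probability] applies to the sets of size k: if [b] meets [a] without being equal to it,
    [A b] puts a point of [b] outside [a] near the common point, so [A b] lies in [W a]. *)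
Lemma cluster_void_bound :
  (1 - hi) ^+ 'C(n, k) - void_error
    <= pr P [set w | forall a : {set 'I_n}, #|a| = k -> ~ A a w]
    <= (1 - lo) ^+ 'C(n, k) + void_error.
Proof.
pose s := enum [set a : {set 'I_n} | #|a| == k]%SET.
have ks a : (a \in s) = (#|a| == k) by rewrite mem_enum finset.inE.
have ss : size s = 'C(n, k) by rewrite -cardE card_draws card_ord.
have -> : [set w | forall a : {set 'I_n}, #|a| = k -> ~ A a w] = void A s.
  rewrite /void -bigcap_seq; apply/seteqP; split=> w h a /=.
    by rewrite ks => /eqP; exact: h.
  by move=> ak; apply: h; rewrite /= ks ak.
have := void_probability Xiid.1 (supp := id) (A := A) (W := W) (s := s) (enum_uniq _)
  (@A_block) measurable_W.
have AW : {in s &, forall a b : {set 'I_n}, a != b ->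
    (exists2 i, i \in a & i \in b) -> A b `<=` W a}.
  move=> a b; rewrite !ks => /eqP ak /eqP bk ab [i ia ib] w Abw.
  have [j jb ja] : exists2 j, j \in b & j \notin a.
    apply/fintype.subsetPn; apply: contra ab => ba.
    by rewrite eq_sym eqEcard ba ak bk leqnn.
  apply/existsP; exists (i, j); apply/and3P; split => //.
  exact: A_near Abw ib jb.
move=> /(_ AW).
set pv := pr P _; set q := \prod_(_ <- _) _; set e := \sum_(_ <- _) _ => h.
have eE : e <= void_error.
  rewrite /e big_seq; apply: le_trans (_ : \sum_(a <- s | a \in s)
    (hi * (k%:R * N * (4 * (9 * rho ^+ 2 / N) ^+ 1))
    + k%:R * N * (4 * (9 * rho ^+ 2 / N) ^+ k)) <= _).
    apply: ler_sum => a; rewrite ks => /eqP ak.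
    have /andP[p1 p2] := A_pr ak.
    apply: lerD; last exact: pr_AW.
    by apply: ler_pM => //; [exact: pr_ge0|exact: pr_ge0|exact: pr_W].
  by rewrite -big_seq big_const_seq count_predT ss iter_addr_0 -[leLHS]mulr_natl.
have [q1 q2] : (1 - hi) ^+ 'C(n, k) <= q /\ q <= (1 - lo) ^+ 'C(n, k).
  rewrite -ss; apply/andP; apply: prodr_seq_bounds; first by rewrite subr_ge0.
  move=> a; rewrite ks => /eqP/A_pr/andP[h1 h2].
  by rewrite !lerB.
move: h; rewrite ler_norml => /andP[h1 h2].
by apply/andP; split; lra.
Qed.

End ClusterVoid.

(** * Limits of void probabilities *)

Section RealLimits.
Context (R : realType).
Implicit Types (u v x r : nat -> R).

Lemma cvg_near_eq u v (l : R) : (\forall n \near \oo, u n = v n) ->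
  v n @[n --> \oo] --> l -> u n @[n --> \oo] --> l.
Proof.
move=> uv; apply: cvg_trans; apply: near_eq_cvg.
by near=> n; apply/esym; near: n.
Unshelve. all: by end_near. Qed.

Lemma natr_near_gt (M : R) : \forall n \near \oo, M < n%:R.
Proof.
near=> n; apply: lt_le_trans (truncnS_gt M) _; rewrite ler_nat; near: n.
exact: nbhs_infty_ge.
Unshelve. all: by end_near. Qed.

Lemma cvg_invn : n%:R^-1 @[n --> \oo] --> (0 : R).
Proof.
apply: (gtr0_cvgV0 (f := fun n : nat => n%:R : R) _).2.
  by near=> n; rewrite ltr0n; near: n; exact: nbhs_infty_gt.
by apply/cvgryPgt => M; exact: natr_near_gt.
Unshelve. all: by end_near. Qed.

Lemma cvg_exprn (u : nat -> R) (l : R) k : u n @[n --> \oo] --> l ->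
  u n ^+ k @[n --> \oo] --> l ^+ k.
Proof.
move=> ul; elim: k => [|k ih]; first by rewrite expr0; exact: cvg_cst.
rewrite exprS; under eq_fun do rewrite exprS; exact: cvgM.
Qed.

Lemma cvg_ffact k : (n ^_ k)%:R / n%:R ^+ k @[n --> \oo] --> (1 : R).
Proof.
elim: k => [|k ih].
  under eq_fun do rewrite ffactn0 expr0 divr1; exact: cvg_cst.
apply: (cvg_near_eq (v := fun n => (n ^_ k)%:R / n%:R ^+ k * (1 - k%:R * n%:R^-1))).
  near=> n; have kn : (k <= n)%N by near: n; exact: nbhs_infty_ge.
  have n0 : n%:R != 0 :> R by rewrite pnatr_eq0 -lt0n; near: n; exact: nbhs_infty_gt.
  have p0 : n%:R ^+ k != 0 :> R by rewrite expf_neq0.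
  rewrite ffactnSr natrM natrB// exprSr.
  by move: (n%:R ^+ k) p0 => p p0; field; apply/andP.
rewrite -[X in _ --> X]mulr1; apply: cvgM => //.
rewrite -[X in _ --> X]subr0; apply: cvgB; first exact: cvg_cst.
by rewrite -(mulr0 k%:R); apply: cvgM; [exact: cvg_cst|exact: cvg_invn].
Unshelve. all: by end_near. Qed.

Lemma cvg_binomial k : 'C(n, k)%:R / n%:R ^+ k @[n --> \oo] --> (k`!%:R^-1 : R).
Proof.
have k0 : k`!%:R != 0 :> R by rewrite pnatr_eq0 -lt0n fact_gt0.
apply: (cvg_near_eq (v := fun n => k`!%:R^-1 * ((n ^_ k)%:R / n%:R ^+ k))).
  by near=> n; rewrite -bin_ffact natrM mulrA [_ * k`!%:R]mulrC !mulrA mulVf// mul1r.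
by rewrite -[X in _ --> X]mulr1; apply: cvgM; [exact: cvg_cst|exact: cvg_ffact].
Unshelve. all: by end_near. Qed.

Lemma onem_le_expR (x : R) : 1 - x <= expR (- x).
Proof. by have := expR_ge1Dx (- x). Qed.

(** Invert 1 / (1 - x) = 1 + x / (1 - x) <= exp (x / (1 - x)). *)
Lemma onem_ge_expR (x : R) : x < 1 -> expR (- (x / (1 - x))) <= 1 - x.
Proof.
move=> x1; have x0 : 0 < 1 - x by rewrite subr_gt0.
rewrite expRN -[leRHS]invrK lef_pV2 ?posrE ?expR_gt0 ?invr_gt0//.
apply: le_trans (expR_ge1Dx _); rewrite le_eqVlt; apply/orP; left; apply/eqP.
by field; rewrite gt_eqF.
Qed.

Lemma cvg_expR u (l : R) : u n @[n --> \oo] --> l -> expR (u n) @[n --> \oo] --> expR l.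
Proof. by move=> ul; apply: (@continuous_cvg _ _ _ _ _ u expR l) => //; exact: continuous_expR. Qed.

Lemma cvg_onem_exp x (m : nat -> nat) (l : R) :
  (\forall n \near \oo, 0 <= x n) -> x n @[n --> \oo] --> 0 ->
  (m n)%:R * x n @[n --> \oo] --> l ->
  (1 - x n) ^+ m n @[n --> \oo] --> expR (- l).
Proof.
move=> x0 xl mx.
have lt1 : \forall n \near \oo, x n < 1 by apply: (cvgr_lt _ xl); exact: ltr01.
apply: (@squeeze_cvgr _ _ _ _ (fun n => expR (- ((m n)%:R * x n / (1 - x n))))
   (fun n => expR (- ((m n)%:R * x n)))).
- near=> n; have x1 : x n < 1 by near: n.
  have y0 : 0 <= 1 - x n by rewrite subr_ge0 ltW.
  have -> : - ((m n)%:R * x n / (1 - x n)) = (m n)%:R * - (x n / (1 - x n)).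
    by rewrite -mulrA mulrN.
  have -> : - ((m n)%:R * x n) = (m n)%:R * - x n by rewrite mulrN.
  rewrite !expRM_natl; apply/andP; split.
    by apply: lerXn2r; [rewrite nnegrE; exact: expR_ge0|rewrite nnegrE|exact: onem_ge_expR].
  by apply: lerXn2r; [rewrite nnegrE|rewrite nnegrE; exact: expR_ge0|exact: onem_le_expR].
- apply: cvg_expR; apply: cvgN; rewrite -[X in _ --> X]divr1; apply: cvgM => //.
  apply: cvgV; first exact: oner_neq0.
  by rewrite -[X in _ --> X]subr0; apply: cvgB => //; exact: cvg_cst.
- by apply: cvg_expR; apply: cvgN.
Unshelve. all: by end_near. Qed.

End RealLimits.

Section ClusterLimit.
Context (R : realType) (r : nat -> R) (K : nat) (M c : R).
Hypotheses (K_gt0 : (0 < K)%N) (M_ge0 : 0 <= M).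
Hypothesis r_gt0 : forall n, (0 < n)%N -> 0 < r n.
Hypothesis r_cvg0 : r n @[n --> \oo] --> 0.
Hypothesis r_cvg : n%:R * r n ^+ (2 * K) @[n --> \oo] --> c.

Let q n : R := n%:R * r n ^+ (2 * K).
Let b n : R := 'C(n, K.+1)%:R / n%:R ^+ K.+1.

(** The pattern has K + 1 points, and M is the area of its shape at threshold 1 with one point
    fixed. [cluster_lo] is this probability reduced by the boundary effect. *)
Definition cluster_hi n : R := n%:R^-1 ^+ K * (r n ^+ (2 * K) * M).
Definition cluster_lo n : R := cluster_hi n * (1 - 4 * r n / Num.sqrt n%:R) ^+ 2.

Let b_cvg : b n @[n --> \oo] --> ((K.+1)`!%:R^-1 : R).
Proof. exact: cvg_binomial. Qed.

Lemma binomial_hiE n : (0 < n)%N -> 'C(n, K.+1)%:R * cluster_hi n = b n * q n * M.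
Proof.
move=> n0; have nn : n%:R != 0 :> R by rewrite pnatr_eq0 -lt0n.
rewrite /b /q /cluster_hi exprS exprVn.
have : n%:R ^+ K != 0 :> R by rewrite expf_neq0.
by move: (n%:R ^+ K) (r n ^+ _) => p s p0; field; apply/andP.
Qed.

Lemma cluster_hi_ge0 n : (0 < n)%N -> 0 <= cluster_hi n.
Proof.
move=> n0; apply: mulr_ge0; first by rewrite exprn_ge0// invr_ge0.
by apply: mulr_ge0 => //; rewrite exprn_ge0// ltW// r_gt0.
Qed.

Lemma cvg_binomial_hi :
  'C(n, K.+1)%:R * cluster_hi n @[n --> \oo] --> c * M / (K.+1)`!%:R.
Proof.
apply: (cvg_near_eq (v := fun n => b n * q n * M)).
  by near=> n; apply: binomial_hiE; near: n; exact: nbhs_infty_gt.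
have -> : c * M / (K.+1)`!%:R = (K.+1)`!%:R^-1 * c * M by ring.
by apply: cvgM; [apply: cvgM; [exact: b_cvg|exact: r_cvg]|exact: cvg_cst].
Unshelve. all: by end_near. Qed.

Lemma cvg_sqrtn_inv : (Num.sqrt n%:R)^-1 @[n --> \oo] --> (0 : R).
Proof.
apply: (gtr0_cvgV0 (f := fun n : nat => Num.sqrt n%:R : R) _).2.
  by near=> n; rewrite sqrtr_gt0 ltr0n; near: n; exact: nbhs_infty_gt.
apply/cvgryPgt => A; near=> n.
have : `|A| ^+ 2 < n%:R by near: n; exact: natr_near_gt.
move=> h; apply: le_lt_trans (ler_norm A) _.
by rewrite -(ltr_pXn2r (n := 2)) ?nnegrE ?sqrtr_ge0// sqr_sqrtr.
Unshelve. all: by end_near. Qed.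

Lemma cvg_boundary_factor :
  (1 - 4 * r n / Num.sqrt n%:R) ^+ 2 @[n --> \oo] --> (1 : R).
Proof.
rewrite -[X in _ --> X](expr1n _ 2); apply: cvg_exprn.
rewrite -[X in _ --> X]subr0; apply: cvgB; first exact: cvg_cst.
rewrite -(mulr0 (4 * 0)); apply: cvgM; last exact: cvg_sqrtn_inv.
by apply: cvgM => //; exact: cvg_cst.
Qed.

Lemma cvg_binomial_lo :
  'C(n, K.+1)%:R * cluster_lo n @[n --> \oo] --> c * M / (K.+1)`!%:R.
Proof.
rewrite -[X in _ --> X]mulr1; under eq_fun do rewrite /cluster_lo mulrA.
by apply: cvgM; [exact: cvg_binomial_hi|exact: cvg_boundary_factor].
Qed.

Lemma cvg_cluster_hi : cluster_hi n @[n --> \oo] --> 0.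
Proof.
rewrite -[X in _ --> X](mulr0 (0 ^+ K)); apply: cvgM.
  by apply: cvg_exprn; exact: cvg_invn.
rewrite -[X in _ --> X](mul0r M); apply: cvgM; last exact: cvg_cst.
have -> : 0 = 0 ^+ (2 * K) :> R by rewrite expr0n muln_eq0 /= eqn0Ngt K_gt0.
exact: cvg_exprn.
Qed.

(** An extra point near a pattern costs n choices times a probability of order r^2 / n. So both
    parts of the error are of order r^2 times the bounded quantity n r^(2 K), and r tends to 0. Here
    36 = 9 * 2^2 and 144 = 4 * 36. *)
Lemma cvg_void_error : void_error n K.+1 (2 * r n) (cluster_hi n) @[n --> \oo] --> 0.
Proof.
pose k : R := K.+1%:R.
apply: (cvg_near_eq (v := fun n => b n * q n * M * (k * 144 * r n ^+ 2)
   + b n * (4 * k * 36 ^+ K.+1) * (q n * r n ^+ 2))).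
  near=> n; have n0 : (0 < n)%N by near: n; exact: nbhs_infty_gt.
  have nn : n%:R != 0 :> R by rewrite pnatr_eq0 -lt0n.
  rewrite /void_error -binomial_hiE// mulrDr -/k; congr (_ + _).
    by rewrite expr1; move: ('C(n, K.+1)%:R) (cluster_hi n) => u h; field.
  have -> : (9 * (2 * r n) ^+ 2 / n%:R) ^+ K.+1 =
      36 ^+ K.+1 * (r n ^+ (2 * K) * r n ^+ 2) / n%:R ^+ K.+1.
    have -> : 9 * (2 * r n) ^+ 2 = 36 * r n ^+ 2 by ring.
    by rewrite expr_div_n exprMn -exprM mulnS addnC exprD.
  rewrite /b /q; have : n%:R ^+ K.+1 != 0 :> R by rewrite expf_neq0.
  move: (n%:R ^+ K.+1) (36 ^+ K.+1) (r n ^+ (2 * K)) ('C(n, K.+1)%:R) => p x y u p0.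
  by field.
have r2 : r n ^+ 2 @[n --> \oo] --> 0.
  have -> : 0 = 0 ^+ 2 :> R by rewrite expr0n.
  exact: cvg_exprn.
have -> : 0 = (K.+1)`!%:R^-1 * c * M * (k * 144 * 0) +
  (K.+1)`!%:R^-1 * (4 * k * 36 ^+ K.+1) * (c * 0) by ring.
apply: cvgD; apply: cvgM.
- by apply: cvgM; [apply: cvgM; [exact: b_cvg|exact: r_cvg]|exact: cvg_cst].
- by apply: cvgM => //; exact: cvg_cst.
- by apply: cvgM; [exact: b_cvg|exact: cvg_cst].
- by apply: cvgM => //; exact: r_cvg.
Unshelve. all: by end_near. Qed.

Lemma cluster_void_limit (f : nat -> R) :
  (\forall n \near \oo,
    4 * r n <= Num.sqrt n%:R -> 2 * r n <= Num.sqrt n%:R -> cluster_hi n <= 1 ->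
    (1 - cluster_hi n) ^+ 'C(n, K.+1) - void_error n K.+1 (2 * r n) (cluster_hi n)
    <= f n <= (1 - cluster_lo n) ^+ 'C(n, K.+1) + void_error n K.+1 (2 * r n) (cluster_hi n)) ->
  f n @[n --> \oo] --> expR (- (c * M / (K.+1)`!%:R)).
Proof.
move=> fb.
have lohi : \forall n \near \oo, 0 <= cluster_lo n.
  near=> n; apply: mulr_ge0; last exact: sqr_ge0.
  by apply: cluster_hi_ge0; near: n; exact: nbhs_infty_gt.
have cvg_lo : cluster_lo n @[n --> \oo] --> 0.
  by rewrite -(mul0r 1); apply: cvgM; [exact: cvg_cluster_hi|exact: cvg_boundary_factor].
apply: (@squeeze_cvgr _ _ _ _
  (fun n => (1 - cluster_hi n) ^+ 'C(n, K.+1) - void_error n K.+1 (2 * r n) (cluster_hi n))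
  (fun n => (1 - cluster_lo n) ^+ 'C(n, K.+1) + void_error n K.+1 (2 * r n) (cluster_hi n))).
- near=> n.
  have rs : r n < 4^-1 by near: n; apply: (cvgr_lt _ r_cvg0); rewrite invr_gt0.
  have s1 : 1 <= Num.sqrt n%:R :> R.
    by rewrite -[leLHS]sqrtr1 ler_sqrt// ler1n; near: n; exact: nbhs_infty_gt.
  have h1 : cluster_hi n <= 1.
    by apply: ltW; near: n; apply: (cvgr_lt _ cvg_cluster_hi); exact: ltr01.
  have : 4 * r n <= Num.sqrt n%:R -> 2 * r n <= Num.sqrt n%:R -> cluster_hi n <= 1 ->
    (1 - cluster_hi n) ^+ 'C(n, K.+1) - void_error n K.+1 (2 * r n) (cluster_hi n)
    <= f n <= (1 - cluster_lo n) ^+ 'C(n, K.+1) + void_error n K.+1 (2 * r n) (cluster_hi n)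
    by near: n.
  by apply => //; lra.
- rewrite -[X in _ --> X]subr0; apply: cvgB; last exact: cvg_void_error.
  apply: cvg_onem_exp; [|exact: cvg_cluster_hi|exact: cvg_binomial_hi].
  by near=> n; apply: cluster_hi_ge0; near: n; exact: nbhs_infty_gt.
- rewrite -[X in _ --> X]addr0; apply: cvgD; last exact: cvg_void_error.
  by apply: cvg_onem_exp => //; exact: cvg_binomial_lo.
Unshelve. all: by end_near. Qed.

End ClusterLimit.

(** * Sparse random geometric graphs *)

Lemma sgraph_ext (V : finType) (G H : sgraph V) : (forall u v, G u v = H u v) -> G = H.
Proof.
case: G H => [a s i] [a' s' i'] /= e.
have ea : a = a' by apply/funext => u; apply/funext => v; exact: e.
subst a'; congr SGraph; exact: Prop_irrelevance.
Qed.

Section RggEvents.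
Context d (T : measurableType d) (R : realType) (P : probability T R).
Context (n : nat) (X : 'I_n -> {RV P >-> plane R}) (r : R).
Hypothesis r_gt0 : 0 < r.

Let G w : sgraph 'I_n := rgg X r w.

Lemma measurable_close_pair (J : {set 'I_n}) i j : i \in J -> j \in J ->
  block_sigma X J [set w | Defs.edist (X i w) (X j w) <= r].
Proof.
move=> iJ jJ; apply: (@measurable_edist_le _ (block_space X J)); first exact: ltW.
  exact: measurable_block_RV.
exact: measurable_block_RV.
Qed.

Lemma rgg_adj w i j : G w i j = (i != j) && (Defs.edist (X i w) (X j w) <= r).
Proof. by []. Qed.

(** A property local to [J] is a function of the finite table of adjacencies inside [J]. *)
Lemma block_sigma_rgg (J : {set 'I_n}) (Q : sgraph 'I_n -> Prop) :
  (forall g g' : sgraph 'I_n, (forall u v, u \in J -> v \in J -> g u v = g' u v) ->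
     Q g -> Q g') ->
  block_sigma X J [set w | Q (G w)].
Proof.
move=> Qloc.
pose e (k : 'I_n * 'I_n) (w : block_space X J) :=
  [&& k.1 \in J, k.2 \in J & Defs.edist (X k.1 w) (X k.2 w) <= r].
have me k : measurable [set w | e k w].
  rewrite /e; case kJ : (k.1 \in J); case lJ : (k.2 \in J) => /=;
    rewrite ?set_false; try exact: measurable0.
  exact: measurable_close_pair.
(* A table is accepted if some outcome with that table satisfies [Q]; by locality all outcomes with
   it then do. *)
pose Q' (f : {ffun 'I_n * 'I_n -> bool}) :=
  exists2 w', f = [ffun k => e k w'] & Q (G w').
have -> : [set w | Q (G w)] = [set w | Q' [ffun k => e k w]].
  apply/seteqP; split=> w; first by exists w.
  move=> [w' /ffunP ew]; apply: Qloc => u v uJ vJ; rewrite !rgg_adj; congr (_ && _).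
  by have := ew (u, v); rewrite !ffunE /e /= uJ vJ.
exact: (measurable_finfun Q' me).
Qed.

Lemma measurable_rgg (Q : sgraph 'I_n -> Prop) : measurable [set w | Q (G w)].
Proof.
apply: (@block_sigma_measurable _ _ _ _ _ _ _ X [set: 'I_n]%SET).
apply: block_sigma_rgg => g g' e; rewrite (_ : g' = g)//.
by apply: sgraph_ext => u v; rewrite e// finset.inE.
Qed.

Lemma rgg_near w i j : G w i j -> near_box r (X i w) (X j w).
Proof. by rewrite rgg_adj => /andP[_ /edist_coord[h1 h2]]; rewrite /near_box h1 h2. Qed.

Lemma path_near w x p y : path (G w) x p -> y \in p ->
  near_box ((size p)%:R * r) (X x w) (X y w).
Proof.
elim: p x => //= z p ih x /andP[xz zp]; rewrite -natr1 mulrDl mul1r addrC inE.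
have zr := rgg_near xz.
move=> /predU1P[->|yp].
  by apply: near_boxW zr; rewrite lerDl mulr_ge0// ltW.
exact: near_box_trans zr (ih _ zp yp).
Qed.

(* Some point has [m] other points in the box of half-side [rho] around it. *)
Definition crowded (m : nat) (rho : R) : set T :=
  [set w | [exists iJ : 'I_n * {set 'I_n}, [&& #|iJ.2| == m, iJ.1 \notin iJ.2 &
     [forall j in iJ.2, near_box rho (X iJ.1 w) (X j w)]]]].

Lemma crowdedP m rho w i (J : {set 'I_n}) : (m <= #|J|)%N -> i \notin J ->
  (forall j, j \in J -> near_box rho (X i w) (X j w)) -> crowded m rho w.
Proof.
move=> mJ iJ h.
have [J' [J'J J'm]] : exists J' : {set 'I_n}, J' \subset J /\ #|J'| = m.
  have /card_geqP[s [us ss sJ]] := mJ.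
  exists [set x in s]%SET; split.
    by apply/fintype.subsetP => x; rewrite finset.inE => /sJ.
  by rewrite cardsE (card_uniqP us).
apply/existsP; exists (i, J') => /=; rewrite J'm eqxx /=; apply/andP; split.
  by apply: contra iJ; exact: (fintype.subsetP J'J).
by apply/forall_inP => j /(fintype.subsetP J'J)/h.
Qed.

(** In a larger component, either a simple path with five edges starts at [x] and its vertices crowd
    [x], or every vertex is reached by a shorter simple path and the other vertices of the component
    do. *)
Lemma uncrowded_component w x : ~ crowded 5 (5 * r) w -> (#|component (G w) x| <= 5)%N.
Proof.
move=> nc; rewrite leqNgt; apply/negP => big; apply: nc.
have [[p [xp sp up]]|short] := pselect (exists p,
    [/\ path (G w) x p, (5 <= size p)%N & uniq (x :: p)]).
  have s5 : size (take 5 p) = 5 by rewrite size_take_min; exact/minn_idPl.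
  have u5 : uniq (x :: take 5 p) by have := take_uniq 6 up.
  apply: (crowdedP (i := x) (J := [set z in take 5 p]%SET)).
  - by rewrite cardsE (card_uniqP _) ?s5//; case/andP: u5.
  - by rewrite finset.inE; case/andP: u5.
  move=> z; rewrite finset.inE => /(path_near (take_path 5 xp)); rewrite s5.
  exact.
apply: (crowdedP (i := x) (J := (component (G w) x :\ x)%SET)).
- by move: big; rewrite (cardsD1 x) finset.inE connect0.
- by rewrite !finset.inE eqxx.
move=> y /setD1P[yx]; rewrite finset.inE => /connectP[p0 /shortenP[p xp up _] yE].
have sp : (size p < 5)%N.
  by rewrite ltnNge; apply/negP => p5; apply: short; exists p.
have yp : y \in p.
  by have := mem_last x p; rewrite -yE inE (negbTE yx).
by apply: near_boxW (path_near xp yp); rewrite ler_wpM2r ?ler_nat ?(ltnW sp)// ltW.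
Qed.

Lemma measurable_crowded m rho : measurable (crowded m rho).
Proof.
rewrite (_ : crowded m rho = \bigcup_(iJ in
    [set iJ : 'I_n * {set 'I_n} | (#|iJ.2| == m) && (iJ.1 \notin iJ.2)])
    \bigcap_(j in [set` iJ.2]) [set w | near_box rho (X iJ.1 w) (X j w)]).
  apply: fin_bigcup_measurable; first exact: finite_finset.
  move=> iJ _; apply: fin_bigcap_measurable; first exact: finite_finset.
  by move=> j _; apply: measurable_near_box; exact: measurable_funP.
apply/seteqP; split=> w.
  move=> /existsP[iJ /and3P[h1 h2 /forall_inP h3]]; exists iJ; first by rewrite /= h1 h2.
  by move=> j; exact: h3.
move=> [iJ /andP[h1 h2] h3]; apply/existsP; exists iJ; rewrite h1 h2 /=.
by apply/forall_inP => j jJ; exact: h3.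
Qed.

Lemma bin_le_expn m k : ('C(m, k) <= m ^ k)%N.
Proof.
apply: leq_trans (_ : m ^_ k <= _)%N; first by rewrite -bin_ffact leq_pmulr// fact_gt0.
by elim: k => // k ih; rewrite ffactnSr expnSr leq_mul ?leq_subr.
Qed.

Lemma pr_crowded (n_gt0 : (0 < n)%N) m rho : iid_uniform_square X -> 0 < rho ->
  rho <= Num.sqrt n%:R ->
  pr P (crowded m rho) <= 4 * n%:R * (9 * rho ^+ 2) ^+ m.
Proof.
move=> Xiid rho0 rhon.
have N0 : 0 < n%:R :> R by rewrite ltr0n.
pose S (iJ : 'I_n * {set 'I_n}) : set T :=
  [set w | [forall j in iJ.2, near_box rho (X iJ.1 w) (X j w)]].
have mS iJ : measurable (S iJ).
  rewrite (_ : S iJ = \bigcap_(j in [set` iJ.2]) [set w | near_box rho (X iJ.1 w) (X j w)]).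
    apply: fin_bigcap_measurable; first exact: finite_finset.
    by move=> j _; apply: measurable_near_box; exact: measurable_funP.
  apply/seteqP; split=> w; first by move=> /forall_inP.
  by move=> h; apply/forall_inP => j; exact: h.
pose A := [set iJ : 'I_n * {set 'I_n} | (#|iJ.2| == m) && (iJ.1 \notin iJ.2)]%SET.
apply: le_trans (_ : \sum_(iJ in A) pr P (S iJ) <= _).
  apply: pr_le_exists => //; first exact: measurable_crowded.
  move=> w /existsP[iJ /and3P[h1 h2 h3]]; exists iJ => //.
  by rewrite finset.inE h1 h2.
have y0 : 0 <= 4 * (9 * rho ^+ 2 / n%:R) ^+ m.
  apply: mulr_ge0 => //; apply: exprn_ge0; apply: divr_ge0; last exact: ltW.
  by apply: mulr_ge0 => //; exact: sqr_ge0.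
apply: le_trans (_ : \sum_(iJ in A) (4 * (9 * rho ^+ 2 / n%:R) ^+ m) <= _).
  apply: ler_sum => -[i J]; rewrite finset.inE /= => /andP[/eqP <- iJ].
  exact: (cluster_probability n_gt0 Xiid).
have cA : (#|A| <= n * n ^ m)%N.
  apply: leq_trans (_ : #|finset.setX [set: 'I_n]%SET
      [set J : {set 'I_n} | #|J| == m]%SET| <= _)%N.
    apply: subset_leq_card; apply/fintype.subsetP => -[i J].
    by rewrite !finset.inE /= => /andP[->].
  by rewrite cardsX cardsT card_draws card_ord leq_mul// bin_le_expn.
rewrite sumr_const -[leLHS]mulr_natl.
apply: le_trans (_ : (n * n ^ m)%:R * (4 * (9 * rho ^+ 2 / n%:R) ^+ m) <= _).
  by rewrite ler_wpM2r// ler_nat.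
rewrite natrM natrX expr_div_n.
have p0 : n%:R ^+ m != 0 :> R by rewrite expf_neq0// gt_eqF.
move: (n%:R ^+ m) ((9 * rho ^+ 2) ^+ m) p0 => p y p0.
by rewrite le_eqVlt; apply/orP; left; apply/eqP; field.
Qed.

Definition edge_event (a : {set 'I_n}) : set T :=
  [set w | exists i j, [/\ i \in a, j \in a & G w i j]].

Definition C5_event (a : {set 'I_n}) : set T :=
  [set w | exists2 g : 'I_5 -> 'I_n, (forall k, g k \in a) & induced_C5 (G w) g].

Lemma edge_event_block a : block_sigma X a (edge_event a).
Proof.
apply: (block_sigma_rgg (Q := fun g => exists i j, [/\ i \in a, j \in a & g i j])).
by move=> g g' e [i [j [ia ja ij]]]; exists i, j; split => //; rewrite -e.
Qed.

Lemma C5_event_block a : block_sigma X a (C5_event a).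
Proof.
apply: (block_sigma_rgg (Q := fun G => exists2 g : 'I_5 -> 'I_n,
  (forall k, g k \in a) & induced_C5 G g)).
by move=> G1 G2 e [g ga gC]; exists g => // i j; rewrite -gC e.
Qed.

Lemma edge_event_near (a : {set 'I_n}) w i j : #|a| = 2 -> edge_event a w ->
  i \in a -> j \in a -> near_box (2 * r) (X i w) (X j w).
Proof.
move=> /eqP/cards2P[x [y [xy ->]]] [u [v [ua va uv]]] ia ja.
apply: (near_boxW (rho := r)); first by rewrite ler_peMl ?ler1n ?ltW.
have xyw : near_box r (X x w) (X y w).
  move: ua va uv => /set2P[]-> /set2P[]->; rewrite ?adj_irr//; first exact: rgg_near.
  by rewrite adj_sym; exact: rgg_near.
by move: ia ja => /set2P[]-> /set2P[]-> //; rewrite ?near_boxxx ?ltW// near_box_sym.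
Qed.

(** Labellings of a five-element set differ by a bijection, so one fixed labelling [g] decides the
    event. *)
Lemma C5_event_iso (a : {set 'I_n}) (g : 'I_5 -> 'I_n) w : #|a| = 5 ->
  injective g -> (forall k, g k \in a) ->
  C5_event a w <-> graph_iso (geom_graph (fun k => X (g k) w : R * R) r) C5.
Proof.
move=> a5 ginj ga.
have surj (h : 'I_5 -> 'I_n) : injective h -> (forall k, h k \in a) ->
    forall i, i \in a -> exists k, h k = i.
  move=> hinj ha i ia; have /eqP : h @: [set: 'I_5]%SET == a.
    rewrite eqEcard card_imset// cardsT card_ord a5 leqnn andbT.
    by apply/fintype.subsetP => _ /imsetP[k _ ->].
  by move=> e; move: ia; rewrite -e => /imsetP[k _ ->]; exists k.
have adjE (h : 'I_5 -> 'I_n) : injective h -> forall u v,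
    G w (h u) (h v) = geom_adj (fun k => X (h k) w : R * R) r u v.
  by move=> hinj u v; rewrite rgg_adj /geom_adj (inj_eq hinj).
split.
  move=> [h ha hC]; have hinj := induced_C5_inj hC.
  have [f fP] := choice (fun k => surj h hinj ha (g k) (ga k)).
  have finj : injective f by move=> u v e; apply: ginj; rewrite -!fP e.
  exists f; first exact: injF_bij.
  by move=> u v; rewrite /= -adjE// -!fP hC.
move=> [f [f' fK f'K] fC]; exists (fun k => g (f' k)) => [k|u v]; first exact: ga.
by rewrite (adjE g ginj) -[LHS]/(geom_graph (fun k => X (g k) w : R * R) r (f' u) (f' v)) fC !f'K.
Qed.

Lemma C5_event_near (a : {set 'I_n}) w i j : #|a| = 5 -> C5_event a w ->
  i \in a -> j \in a -> near_box (2 * r) (X i w) (X j w).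
Proof.
move=> a5 [g ga gC] ia ja.
have ginj := induced_C5_inj gC.
have surj k : k \in a -> exists l, g l = k.
  move=> ka; have /eqP : g @: [set: 'I_5]%SET == a.
    rewrite eqEcard card_imset// cardsT card_ord a5 leqnn andbT.
    by apply/fintype.subsetP => _ /imsetP[l _ ->].
  by move=> e; move: ka; rewrite -e => /imsetP[l _ ->]; exists l.
have iso : graph_iso (geom_graph (fun k => X (g k) w : R * R) r) C5.
  by apply/(C5_event_iso w a5 ginj ga); exists g.
have [k <-] := surj i ia; have [l <-] := surj j ja.
have [h1 h2] := C5_close k l (ltW r_gt0) iso.
by rewrite /near_box h1 h2.
Qed.

Section Probabilities.
Hypotheses (n_gt0 : (0 < n)%N) (Xiid : iid_uniform_square X).
Hypothesis r_small : 4 * r <= Num.sqrt n%:R.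

Lemma pr_edge_event (a : {set 'I_n}) : #|a| = 2 ->
  n%:R^-1 * (r ^+ 2 * pi) * (1 - 4 * r / Num.sqrt n%:R) ^+ 2
    <= pr P (edge_event a) <= n%:R^-1 * (r ^+ 2 * pi).
Proof.
move=> /eqP/cards2P[x [y [xy ->]]].
rewrite (_ : edge_event _ = [set w | Defs.edist (X x w) (X y w) <= r]).
  exact: edge_probability.
apply/seteqP; split=> w /=; last first.
  move=> h; exists x, y; rewrite !set21 set22; split => //.
  by rewrite rgg_adj xy.
move=> [u [v [/set2P[]-> /set2P[]->]]]; rewrite ?adj_irr// ?rgg_adj => /andP[_]//.
by move=> h; have : G w y x; [rewrite rgg_adj eq_sym xy|rewrite adj_sym rgg_adj => /andP[]].
Qed.

Lemma pr_C5_event (a : {set 'I_n}) : #|a| = 5 ->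
  n%:R^-1 ^+ 4 * (r ^+ 8 * (5`!%:R * mu_C5 R)) * (1 - 4 * r / Num.sqrt n%:R) ^+ 2
    <= pr P (C5_event a) <= n%:R^-1 ^+ 4 * (r ^+ 8 * (5`!%:R * mu_C5 R)).
Proof.
move=> a5.
pose g (k : 'I_5) : 'I_n := enum_val (cast_ord (esym a5) k).
have ginj : injective g by move=> u v /enum_val_inj/cast_ord_inj.
have ga k : g k \in a by exact: enum_valP.
rewrite (_ : C5_event a =
    [set w | graph_iso (geom_graph (fun k => X (g k) w : R * R) r) C5]).
  exact: C5_probability.
by apply/seteqP; split=> w /=; rewrite -(C5_event_iso w a5 ginj ga).
Qed.

End Probabilities.

End RggEvents.

Section ProbabilityLimits.
Context (R : realType).

Lemma pr_diff_le d (T : measurableType d) (P : probability T R) (A B Z : set T) :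
  measurable A -> measurable B -> measurable Z ->
  (forall w, ~ Z w -> (A w <-> B w)) -> `|pr P A - pr P B| <= pr P Z.
Proof.
move=> mA mB mZ AB.
have h (C D : set T) : measurable C -> measurable D -> (forall w, ~ Z w -> C w -> D w) ->
    pr P C - pr P D <= pr P Z.
  move=> mC mD CD; rewrite lerBlDl; apply: le_trans (pr_leU _ mD mZ).
  apply: le_pr => //; first exact: measurableU.
  by move=> w Cw; have [Zw|nZ] := pselect (Z w); [right|left; exact: CD].
rewrite ler_norml lerNl opprB; apply/andP; split; apply: h => // w nZ.
  by rewrite AB.
by rewrite AB.
Qed.

Lemma squeeze_diff (u v z : nat -> R) (l : R) :
  (\forall n \near \oo, `|u n - v n| <= z n) -> z n @[n --> \oo] --> 0 ->
  v n @[n --> \oo] --> l -> u n @[n --> \oo] --> l.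
Proof.
move=> uvz z0 vl.
apply: (@squeeze_cvgr _ _ _ _ (fun n => v n - z n) (fun n => v n + z n)).
- near=> n; have : `|u n - v n| <= z n by near: n.
  by rewrite ler_distl.
- by rewrite -[X in _ --> X]subr0; exact: cvgB.
- by rewrite -[X in _ --> X]addr0; exact: cvgD.
Unshelve. all: by end_near. Qed.

Lemma cvg_pr_ereal (d : nat -> measure_display) (T : forall n, measurableType (d n))
    (P : forall n, probability (T n) R) (S : forall n, set (T n)) (l : R) :
  (forall n, measurable (S n)) -> pr (P n) (S n) @[n --> \oo] --> l ->
  P n (S n) @[n --> \oo] --> l%:E.
Proof.
move=> mS h; under eq_fun do rewrite prE//.
by apply: cvg_EFin; [near=> n; rewrite fin_numE|].
Unshelve. all: by end_near. Qed.

Lemma cvg_root0 (r : nat -> R) k : (forall n, (0 < n)%N -> 0 <= r n) ->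
  r n ^+ k.+1 @[n --> \oo] --> 0 -> r n @[n --> \oo] --> 0.
Proof.
move=> r0 rk; apply/cvgr0Pnorm_lt => e e0.
have ek : 0 < e ^+ k.+1 by rewrite exprn_gt0.
near=> n; have n0 : (0 < n)%N by near: n; exact: nbhs_infty_gt.
have : r n ^+ k.+1 < e ^+ k.+1 by near: n; exact: (cvgr_lt _ rk) ek.
by rewrite ltr_pXn2r ?nnegrE ?r0 ?ltW// ger0_norm ?r0.
Unshelve. all: by end_near. Qed.

Lemma cvg_radius0 (r : nat -> R) k (c : R) : (forall n, (0 < n)%N -> 0 < r n) ->
  n%:R * r n ^+ k.+1 @[n --> \oo] --> c -> r n @[n --> \oo] --> 0.
Proof.
move=> r0 h; apply: (@cvg_root0 r k) => [n n0|]; first exact/ltW/r0.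
apply: (cvg_near_eq (v := fun n => n%:R^-1 * (n%:R * r n ^+ k.+1))).
  near=> n; rewrite mulrA mulVf ?mul1r// pnatr_eq0 -lt0n; near: n.
  exact: nbhs_infty_gt.
by rewrite -(mul0r c); apply: cvgM => //; exact: cvg_invn.
Unshelve. all: by end_near. Qed.

End ProbabilityLimits.

Section Sparse.
Context (R : realType) (d : nat -> measure_display) (T : forall n, measurableType (d n)).
Context (P : forall n, probability (T n) R) (X : forall n, 'I_n -> {RV (P n) >-> plane R}).
Hypothesis X_iid : forall n, (0 < n)%N -> iid_uniform_square (@X n).

Definition chi (r : nat -> R) n (w : T n) : nat :=
  clique_chromatic_number (rgg (@X n) (r n) w).

Section Radius.
Variable r : nat -> R.
Hypothesis r_gt0 : forall n, (0 < n)%N -> 0 < r n.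

Lemma measurable_chi (Q : nat -> Prop) n : measurable [set w : T n | Q (chi r w)].
Proof.
(* No sign is known for [r 0], but without vertices the clique chromatic number is constantly 1. *)
case: n => [|n].
  have [Q1|nQ] := pselect (forall w : T 0, Q (chi r w)).
    by rewrite (_ : [set w | _] = setT)//; apply/seteqP; split => // w _; exact: Q1.
  have c1 (w : T 0) : chi r w = 1%N.
    by apply/clique_chromatic_eq1 => u; have := ltn_ord u; rewrite ltn0.
  have -> : [set w : T 0 | Q (chi r w)] = set0.
    apply/seteqP; split=> [w Qw|w []]; apply: nQ => w'.
    by rewrite (c1 w') -(c1 w); exact: Qw.
  exact: measurable0.
apply: (measurable_rgg (@X n.+1) (r_gt0 (ltn0Sn n))
  (fun g => Q (clique_chromatic_number g))).
Qed.

Definition has_C5 n : set (T n) :=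
  [set w | exists g, induced_C5 (rgg (@X n) (r n) w) g].

Lemma measurable_has_C5 n : (0 < n)%N -> measurable (@has_C5 n).
Proof.
move=> n0; exact: (measurable_rgg (@X n) (r_gt0 n0) (fun g => exists h, induced_C5 g h)).
Qed.

(** An edge is a pattern with K = 1 and M = pi, the area of the unit disc; the 2 is a factorial. *)
Lemma cvg_no_edge (c : R) : n%:R * r n ^+ 2 @[n --> \oo] --> c ->
  pr (P n) [set w : T n | chi r w = 1%N] @[n --> \oo] --> expR (- (c * pi / 2%:R)).
Proof.
move=> rc; have r0 := cvg_radius0 r_gt0 rc.
apply: (cluster_void_limit (K := 1) _ (pi_ge0 R) r_gt0 r0 rc) => //.
near=> n => r4 r2 hi1; have n0 : (0 < n)%N by near: n; exact: nbhs_infty_gt.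
have rn := r_gt0 n0.
rewrite (_ : [set w | _] =
    [set w | forall a : {set 'I_n}, #|a| = 2 -> ~ edge_event (@X n) (r n) a w]).
  apply: (cluster_void_bound n0 (X_iid n0)) => //.
  - by rewrite mulr_gt0.
  - by move=> a; exact: edge_event_block.
  - by move=> a w i j; exact: edge_event_near.
  - move=> a a2; have := pr_edge_event rn n0 (X_iid n0) r4 a2.
    by rewrite /cluster_lo /cluster_hi expr1 muln1.
apply/seteqP; split=> w /=.
  move=> /clique_chromatic_eq1 h a _ [i [j [_ _ ij]]].
  by have := h i j; rewrite ij.
move=> h; apply/clique_chromatic_eq1 => i j; apply/negP => ij.
apply: (h [set i; j]%SET); first by rewrite cards2 (adj_neq ij).
by exists i, j; rewrite set21 set22.
Unshelve. all: by end_near. Qed.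

(** Here K = 4 and M = 5! mu, and the factorial cancels against the binomial coefficient. *)
Lemma cvg_no_C5 (c : R) : n%:R * r n ^+ 8 @[n --> \oo] --> c ->
  pr (P n) (~` @has_C5 n) @[n --> \oo] --> expR (- (mu_C5 R * c)).
Proof.
move=> rc; have r0 := cvg_radius0 r_gt0 rc.
have M0 : 0 <= 5`!%:R * mu_C5 R by rewrite mulr_ge0// ltW// mu_C5_gt0.
have -> : mu_C5 R * c = c * (5`!%:R * mu_C5 R) / 5`!%:R.
  by field; rewrite pnatr_eq0.
apply: (cluster_void_limit (K := 4) _ M0 r_gt0 r0 rc) => //.
near=> n => r4 r2 hi1; have n0 : (0 < n)%N by near: n; exact: nbhs_infty_gt.
have rn := r_gt0 n0.
rewrite (_ : ~` _ =
    [set w | forall a : {set 'I_n}, #|a| = 5 -> ~ C5_event (@X n) (r n) a w]).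
  apply: (cluster_void_bound n0 (X_iid n0)) => //.
  - by rewrite mulr_gt0.
  - by move=> a; exact: C5_event_block.
  - by move=> a w i j; exact: C5_event_near.
  - by move=> a a5; have := pr_C5_event rn n0 (X_iid n0) r4 a5.
apply/seteqP; split=> w /=.
  by move=> h a _ [g _ gC]; apply: h; exists g.
move=> h [g gC]; apply: (h (g @: [set: 'I_5])%SET).
  by rewrite (card_imset _ (induced_C5_inj gC)) cardsT card_ord.
by exists g => // k; apply: imset_f; rewrite finset.inE.
Unshelve. all: by end_near. Qed.

Definition crowd n : set (T n) := crowded (@X n) 5 (5 * r n).

(** The expected number of groups of six close points has order n r^10 = n r^8 * r^2. *)
Lemma cvg_crowd (c : R) : n%:R * r n ^+ 8 @[n --> \oo] --> c ->
  pr (P n) (@crowd n) @[n --> \oo] --> 0.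
Proof.
move=> rc; have r0 := cvg_radius0 r_gt0 rc.
apply: (@squeeze_cvgr _ _ _ _ (fun=> 0)
  (fun n => 4 * 225 ^+ 5 * (n%:R * r n ^+ 8 * r n ^+ 2))).
- near=> n; have n0 : (0 < n)%N by near: n; exact: nbhs_infty_gt.
  have rs : r n < 5^-1 by near: n; apply: (cvgr_lt _ r0); rewrite invr_gt0.
  have s1 : 1 <= Num.sqrt n%:R :> R.
    by rewrite -[leLHS]sqrtr1 ler_sqrt// ler1n.
  rewrite pr_ge0 /=; apply: le_trans (pr_crowded n0 5 (X_iid n0) _ _) _.
  + by rewrite mulr_gt0// r_gt0.
  + by apply: le_trans s1; move: rs; lra.
  rewrite le_eqVlt; apply/orP; left; apply/eqP.
  have -> : 9 * (5 * r n) ^+ 2 = 225 * r n ^+ 2 by ring.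
  rewrite exprMn -exprM -[n%:R * _ * _]mulrA -exprD.
  by move: (225 ^+ 5) => y; ring.
- exact: cvg_cst.
- have -> : 0 = 4 * 225 ^+ 5 * (c * 0) :> R by rewrite !mulr0.
  apply: cvgM; first exact: cvg_cst.
  apply: cvgM; first exact: rc.
  have -> : 0 = 0 ^+ 2 :> R by rewrite expr0n.
  exact: cvg_exprn.
Unshelve. all: by end_near. Qed.

Lemma chi_uncrowded n (w : T n) : (0 < n)%N -> ~ crowd w ->
  (has_C5 w -> chi r w = 3%N) /\ (~ has_C5 w -> (chi r w <= 2)%N).
Proof.
move=> n0 nc.
have small x := uncrowded_component (r_gt0 n0) x nc.
split=> [[g gC]|nC]; first exact: small_components_C5 gC.
by apply: clique_chromatic_leq => //; exact: small_components_colourable2.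
Qed.

Lemma cvg_no_C5_crowd : n%:R * r n ^+ 8 @[n --> \oo] --> 0 ->
  pr (P n) (@crowd n `|` @has_C5 n) @[n --> \oo] --> 0.
Proof.
move=> rc.
have h1 := cvg_crowd rc; have h2 := cvg_no_C5 rc.
apply: (@squeeze_cvgr _ _ _ _ (fun=> 0)
  (fun n => pr (P n) (@crowd n) + (1 - pr (P n) (~` @has_C5 n)))).
- near=> n; have n0 : (0 < n)%N by near: n; exact: nbhs_infty_gt.
  have mC := measurable_has_C5 n0.
  rewrite pr_ge0 /= (prC _ mC) subKr.
  by apply: pr_leU => //; exact: measurable_crowded.
- exact: cvg_cst.
- rewrite mulr0 oppr0 expR0 in h2.
  have -> : 0 = 0 + (1 - 1) :> R by rewrite subrr addr0.
  by apply: cvgD => //; apply: cvgB => //; exact: cvg_cst.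
Unshelve. all: by end_near. Qed.

End Radius.

(** On the same points, [r] eventually exceeds the radius [r'] with n r'^2 = c, so fewer outcomes
    are edgeless. For c = 1/e the limit exp(-c pi / 2) is below e, since exp(c) > c. *)
Lemma cvg_edgeless0 (r : nat -> R) : (forall n, (0 < n)%N -> 0 < r n) ->
  n%:R * r n ^+ 2 @[n --> \oo] --> +oo ->
  pr (P n) [set w : T n | chi r w = 1%N] @[n --> \oo] --> 0.
Proof.
move=> r0 rc; apply/cvgr0Pnorm_lt => e e0.
pose c : R := e^-1.
have c0 : 0 < c by rewrite invr_gt0.
pose r' n : R := Num.sqrt (c / n%:R).
have r'0 n : (0 < n)%N -> 0 < r' n.
  by move=> n0; rewrite sqrtr_gt0 divr_gt0// ltr0n.
have r'c : n%:R * r' n ^+ 2 @[n --> \oo] --> c.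
  apply: (cvg_near_eq (v := fun=> c)); last exact: cvg_cst.
  near=> n; have n0 : 0 < n%:R :> R by rewrite ltr0n; near: n; exact: nbhs_infty_gt.
  by rewrite sqr_sqrtr ?divr_ge0 ?ltW// mulrC divfK// gt_eqF.
have lim := cvg_no_edge r'0 r'c.
have small : expR (- (c * pi / 2%:R)) < e.
  have p2 : 1 <= pi / 2%:R :> R by have := pi_ge2 R; lra.
  apply: le_lt_trans (_ : expR (- c) < e).
    by rewrite ler_expR lerN2 -mulrA ler_peMr// ltW.
  rewrite expRN -[ltRHS]invrK ltf_pV2 ?posrE ?expR_gt0//.
  by apply: lt_le_trans (expR_ge1Dx _); rewrite ltrDr.
near=> n; have n0 : (0 < n)%N by near: n; exact: nbhs_infty_gt.
rewrite ger0_norm ?pr_ge0//.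
apply: le_lt_trans (_ : pr (P n) [set w : T n | chi r' w = 1%N] < e); last first.
  by near: n; exact: (cvgr_lt _ lim) small.
have rr : r' n <= r n.
  have cn : c <= n%:R * r n ^+ 2 by near: n; move/cvgryPge : rc; apply.
  have nn : 0 < n%:R :> R by rewrite ltr0n.
  rewrite -(ler_pXn2r (n := 2)) ?nnegrE ?(ltW (r'0 n n0)) ?(ltW (r0 n n0))//.
  have -> : r' n ^+ 2 = c / n%:R by apply: sqr_sqrtr; rewrite divr_ge0 ?ltW.
  by rewrite ler_pdivrMr// mulrC.
apply: le_pr; [exact: (measurable_chi r0 (fun k => k = 1%N))|
  exact: (measurable_chi r'0 (fun k => k = 1%N))|].
move=> w /= /clique_chromatic_eq1 h; apply/clique_chromatic_eq1 => i j.
apply: contra (h i j) => /andP[ij e'].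
by rewrite rgg_adj ij (le_trans e').
Unshelve. all: by end_near. Qed.

End Sparse.

(** * Dense random geometric graphs *)

Section Checkerboard.
Context (R : realType) (n : nat) (x : 'I_n -> R * R) (r : R) (m : nat).

Let s : R := Num.sqrt n%:R / 2.
Let sigma : R := Num.sqrt n%:R / m%:R.
Let pos (i : nat) : R := - s + i%:R * sigma.
Let G := geom_graph x r.

(** Half-open, so that [column] recovers the indices of the cell from any of its points. *)
Definition half_open_cell (i j : nat) : set (plane R) :=
  `[pos i, pos i + sigma[%classic `*` `[pos j, pos j + sigma[%classic.

Hypotheses (n_gt0 : (0 < n)%N) (m_gt1 : (1 < m)%N) (r_large : 15 / 2 * sigma <= r).
Hypothesis x_in : forall v, @square R n (x v).
Hypothesis x_full : forall i j : 'I_m, exists v, half_open_cell i j (x v).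

Let sigma_gt0 : 0 < sigma.
Proof. by rewrite divr_gt0 ?sqrtr_gt0 ?ltr0n// (ltn_trans _ m_gt1). Qed.

Let r_gt0 : 0 < r.
Proof. by apply: lt_le_trans r_large; rewrite mulr_gt0. Qed.

Let s_sigma : 2 * s = m%:R * sigma.
Proof.
rewrite /s /sigma mulrC divfK// mulrCA divff ?mulr1// pnatr_eq0 -lt0n.
exact: ltn_trans m_gt1.
Qed.

Let column (u : R) : nat := Num.truncn ((u + s) / sigma).

Let column_cell u i : pos i <= u -> u < pos i + sigma -> column u = i.
Proof.
rewrite /pos => u1 u2; apply/eqP; rewrite /column truncn_eq; last first.
  apply: divr_ge0; last exact: ltW.
  have : 0 <= i%:R * sigma by rewrite mulr_ge0// ltW.
  by move: (i%:R * sigma) u1 => z; lra.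
rewrite ler_pdivlMr// ltr_pdivrMr// -natr1 mulrDl mul1r.
by move: (i%:R * sigma) u1 u2 => z *; apply/andP; split; lra.
Qed.

Let column_exists u : - s <= u <= s -> exists i : 'I_m, pos i <= u <= pos i + sigma.
Proof.
move=> /andP[u1 u2].
have y0 : 0 <= (u + s) / sigma by apply: divr_ge0; [lra|exact: ltW].
have /andP[c1 c2] := truncn_itv y0.
rewrite ler_pdivlMr// in c1; rewrite ltr_pdivrMr// -natr1 mulrDl mul1r in c2.
have [cm|mc] := ltnP (Num.truncn ((u + s) / sigma)) m.
  exists (Ordinal cm); rewrite /pos /=.
  by move: (_%:R * _) c1 c2 => z *; apply/andP; split; lra.
have m1 : (m.-1 < m)%N by rewrite prednK// (ltn_trans _ m_gt1).
have mE : m%:R = m.-1%:R + 1 :> R by rewrite natr1 prednK// (ltn_trans _ m_gt1).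
exists (Ordinal m1); rewrite /pos /=.
have c3 : m%:R * sigma <= u + s by apply: le_trans c1; rewrite ler_wpM2r ?ler_nat// ltW.
have := s_sigma; rewrite mE mulrDl mul1r in c3 *.
by move: (_%:R * _) c3 sigma_gt0 => z *; apply/andP; split; lra.
Qed.

Let colour (v : 'I_n) : 'I_2 := inord (odd (column (x v).1 + column (x v).2)).

Let colour_cell (i j : nat) v : half_open_cell i j (x v) -> val (colour v) = odd (i + j).
Proof.
rewrite /half_open_cell /= !in_itv /= => -[/andP[a1 a2] /andP[b1 b2]].
by rewrite /colour (column_cell a1 a2) (column_cell b1 b2) inordK//; case: odd.
Qed.

(* A cell at the border still has a neighbour on its inner side. *)
Let neighbour (i : 'I_m) : exists i' : 'I_m, odd i' != odd i /\
  (pos i' = pos i + sigma \/ pos i' = pos i - sigma).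
Proof.
have [i1|i1] := ltnP i.+1 m.
  exists (Ordinal i1); rewrite /= -[~~ _]/(~~ _); split; first by case: odd.
  by left; rewrite /pos /= -natr1 mulrDl mul1r addrA.
have i0 : (0 < i)%N by rewrite -ltnS; apply: leq_trans i1.
have im : (i.-1 < m)%N by apply: leq_ltn_trans (ltn_ord i); exact: leq_pred.
exists (Ordinal im); rewrite /=; split.
  by rewrite -{2}(prednK i0) /=; case: odd.
right; rewrite /pos /= -{2}(prednK i0) -natr1 mulrDl mul1r addrA.
by rewrite addrK.
Qed.

(** The witness is the midpoint of the extreme values, so it stays within the range of the square
    and lies in some closed cell. *)
Let center (S : {set 'I_n}) (z : 'I_n -> R) v0 : v0 \in S ->
  (forall v, - s <= z v <= s) -> (forall u v, u \in S -> v \in S -> `|z u - z v| <= r) ->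
  exists2 c, - s <= c <= s & forall v, v \in S -> `|z v - c| <= r / 2.
Proof.
move=> v0S zs zr.
case: (@Order.TotalTheory.arg_minP _ _ _ v0 (mem S) z v0S) => a aS amin.
case: (@Order.TotalTheory.arg_maxP _ _ _ v0 (mem S) z v0S) => b bS bmax.
exists ((z a + z b) / 2).
  have /andP[a1 a2] := zs a; have /andP[b1 b2] := zs b.
  by apply/andP; split; lra.
move=> v vS; have h1 : z a <= z v := amin v vS; have h2 : z v <= z b := bmax v vS.
have := zr b a bS aS; rewrite !ler_norml => /andP[h3 h4].
by apply/andP; split; lra.
Qed.

(** This is where 15/2 is used: (r/2 + 2 sigma)^2 + (r/2 + sigma)^2 <= r^2 as soon as r >= (3 + sqrt
    19) sigma, and 3 + sqrt 19 < 7.36. *)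
Let adj_close u v c1 c2 :
  `|(x u).1 - c1| <= r / 2 -> `|(x u).2 - c2| <= r / 2 ->
  `|(x v).1 - c1| <= 2 * sigma -> `|(x v).2 - c2| <= sigma ->
  Defs.edist (x u) (x v) <= r.
Proof.
move=> h1 h2 h3 h4; rewrite (edist_le _ _ (ltW r_gt0)).
have a1 : `|(x u).1 - (x v).1| <= r / 2 + 2 * sigma.
  have -> : (x u).1 - (x v).1 = ((x u).1 - c1) - ((x v).1 - c1) by ring.
  by apply: le_trans (ler_normB _ _) _; exact: lerD.
have a2 : `|(x u).2 - (x v).2| <= r / 2 + sigma.
  have -> : (x u).2 - (x v).2 = ((x u).2 - c2) - ((x v).2 - c2) by ring.
  by apply: le_trans (ler_normB _ _) _; exact: lerD.
have sq (y b : R) : `|y| <= b -> y ^+ 2 <= b ^+ 2.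
  move=> yb; rewrite -(real_normK (num_real y)) lerXn2r ?nnegrE//.
  exact: le_trans yb.
apply: le_trans (lerD (sq _ _ a1) (sq _ _ a2)) _.
have := sigma_gt0; have := r_large; nra.
Qed.

(** The cell of the centre of a maximal clique and a horizontally adjacent cell contain points
    within r of the whole clique. By maximality these belong to it, and they have different
    colours. *)
Lemma checkerboard_colourable : clique_colourable G 2.
Proof.
apply/existsP; exists (finfun colour); apply/forallP => S; apply/implyP => /andP[mS S1].
apply/negP => /monochromaticP mono.
have [cS maxS] := maximal_cliqueP mS.
have [v0 [_ [v0S _ _]]] := card_gt1P S1.
have near u v : u \in S -> v \in S ->
    `|(x u).1 - (x v).1| <= r /\ `|(x u).2 - (x v).2| <= r.
  move=> uS vS; have [->|uv] := eqVneq u v; first by rewrite !subrr normr0 ltW.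
  by move/cliqueP: cS => /(_ u v uS vS uv)/andP[_ /edist_coord].
have xs v : (- s <= (x v).1 <= s) /\ (- s <= (x v).2 <= s).
  by have := x_in v; rewrite squareE /rect /= !in_itv.
have [c1 c1s c1S] := center v0S (fun v => (xs v).1) (fun u v uS vS => (near u v uS vS).1).
have [c2 c2s c2S] := center v0S (fun v => (xs v).2) (fun u v uS vS => (near u v uS vS).2).
have [i /andP[i1 i2]] := column_exists c1s; have [j /andP[j1 j2]] := column_exists c2s.
have inS (k : 'I_m) v : pos i - sigma <= pos k <= pos i + sigma ->
    half_open_cell k j (x v) -> v \in S.
  rewrite /half_open_cell /= !in_itv /= => /andP[k1 k2] [/andP[a1 a2] /andP[b1 b2]].
  apply: maxS => u uS uv; rewrite /= /geom_adj uv /=.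
  apply: (adj_close (c1S u uS) (c2S u uS)); rewrite ler_norml; apply/andP; split; lra.
have [i' [ii' ei']] := neighbour i.
have [v vc] := x_full i j; have [v' vc'] := x_full i' j.
have s0 := sigma_gt0.
have vS : v \in S by apply: (inS i) => //; apply/andP; split; lra.
have v'S : v' \in S.
  by apply: (inS i') => //; case: ei' => ->; apply/andP; split; lra.
have := mono v v' vS v'S; rewrite !ffunE => /(congr1 val).
rewrite (colour_cell vc) (colour_cell vc') !oddD => e; move: ii'.
by move: e; case: odd; case: odd; case: odd.
Qed.

Lemma checkerboard_chromatic : clique_chromatic_number G = 2%N.
Proof.
apply/eqP; rewrite eqn_leq clique_chromatic_leq ?checkerboard_colourable//=.
(* One colour is too few because points of the cells (0, 0) and (1, 0) are adjacent. *)
rewrite ltn_neqAle clique_chromatic_gt0 andbT eq_sym; apply/eqP.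
move=> /clique_chromatic_eq1 noedge.
pose i0 : 'I_m := Ordinal (ltnW m_gt1); pose i1 : 'I_m := Ordinal m_gt1.
have [u uc] := x_full i0 i0; have [v vc] := x_full i1 i0.
have uv : u != v.
  apply/negP => /eqP uv; have := colour_cell uc; rewrite uv (colour_cell vc).
  by [].
apply: (negP (noedge u v)); rewrite /= /geom_adj uv /=.
move: uc vc; rewrite /half_open_cell /pos /= !in_itv /= mul0r mul1r addr0.
move=> [/andP[a1 a2] /andP[b1 b2]] [/andP[a3 a4] /andP[b3 b4]].
have s0 := sigma_gt0.
apply: (adj_close (c1 := (x u).1) (c2 := (x u).2)); rewrite ?subrr ?normr0.
- by rewrite divr_ge0 ?ltW.
- by rewrite divr_ge0 ?ltW.
- by rewrite ler_norml; apply/andP; split; lra.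
- by rewrite ler_norml; apply/andP; split; lra.
Qed.

End Checkerboard.

(** * Probability that all cells of the grid are occupied *)

Section FullCells.
Context d (T : measurableType d) (R : realType) (P : probability T R).
Context (n : nat) (n_gt0 : (0 < n)%N) (X : 'I_n -> {RV P >-> plane R}).
Hypothesis Xiid : iid_uniform_square X.
Context (r : R) (m : nat).
Let sigma : R := Num.sqrt n%:R / m%:R.
Hypotheses (r_gt0 : 0 < r) (m_gt1 : (1 < m)%N) (r_large : 15 / 2 * sigma <= r).

Let N0 : 0 < n%:R :> R. Proof. by rewrite ltr0n. Qed.
Let m0 : (0 < m)%N. Proof. exact: ltn_trans m_gt1. Qed.
Let sigma_ge0 : 0 <= sigma. Proof. by rewrite divr_ge0 ?sqrtr_ge0. Qed.

Lemma measurable_half_open_cell i j : measurable (@half_open_cell R n m i j).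
Proof. by apply: measurableX; exact: measurable_itv. Qed.

Lemma half_open_cell_square (i j : 'I_m) : half_open_cell n m i j `<=` @square R n.
Proof.
have h (k : 'I_m) : 0 <= k%:R * sigma /\ k%:R * sigma + sigma <= Num.sqrt n%:R :> R.
  split; first by rewrite mulr_ge0.
  have : k.+1%:R * sigma <= m%:R * sigma by rewrite ler_wpM2r// ler_nat.
  rewrite -natr1 mulrDl mul1r /sigma [X in _ <= X]mulrC divfK//.
  by rewrite pnatr_eq0 -lt0n.
have [a1 a2] := h i; have [b1 b2] := h j.
move=> [u v]; rewrite squareE /rect /half_open_cell /= !in_itv /= -/sigma.
by move=> [/andP[c1 c2] /andP[c3 c4]]; split; apply/andP; split; lra.
Qed.

Lemma pr_half_open_cell (i j : 'I_m) v :
  pr P (X v @^-1` half_open_cell n m i j) = sigma ^+ 2 / n%:R.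
Proof.
rewrite (pr_point_eq n_gt0 Xiid); first last.
- exact: half_open_cell_square.
- exact: measurable_half_open_cell.
have len (u : R) : lebesgue_measure (`[u, u + sigma[%classic : set (measurableTypeR R))
    = sigma%:E.
  rewrite lebesgue_measure_itv /= lte_fin; case: ltP => h.
    by rewrite -EFinB; congr (_%:E); ring.
  by congr (_%:E); apply/eqP; rewrite eq_le sigma_ge0 /=; move: h; lra.
rewrite /half_open_cell /area product_measure1E; try exact: measurable_itv.
transitivity (fine (sigma%:E * sigma%:E)%E / n%:R); last by rewrite -EFinM expr2.
by congr (fine _ / _); congr (_ * _)%E; exact: len.
Qed.

(** A union bound over the m^2 cells, each empty with probability (1 - sigma^2 / n)^n <=
    exp(-sigma^2). Points outside the square have probability 0. *)
Lemma pr_chromatic2 :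
  1 - m%:R ^+ 2 * expR (- sigma ^+ 2)
    <= pr P [set w | clique_chromatic_number (rgg X r w) = 2%N].
Proof.
pose empty (ij : 'I_m * 'I_m) : set T := \bigcap_(v in [set` [set: 'I_n]%SET])
  (X v @^-1` (~` half_open_cell n m ij.1 ij.2)).
pose out (v : 'I_n) : set T := X v @^-1` (~` @square R n).
have mC i j : measurable (~` @half_open_cell R n m i j).
  apply: measurableC; exact: measurable_half_open_cell.
have me ij : measurable (empty ij).
  apply: fin_bigcap_measurable; first exact: finite_finset.
  by move=> v _; exact: measurable_RV_preimage.
have mo v : measurable (out v).
  by apply: measurable_RV_preimage; apply: measurableC; exact: measurable_square.
set E := [set w | _].
have mE : measurable E.
  exact: (measurable_rgg X r_gt0 (fun g => clique_chromatic_number g = 2%N)).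
have pe ij : pr P (empty ij) <= expR (- sigma ^+ 2).
  rewrite /empty pr_rectangles//.
  rewrite (eq_bigr (fun=> 1 - sigma ^+ 2 / n%:R)) => [|v _]; last first.
    rewrite -preimage_setC prC ?pr_half_open_cell//.
    apply: measurable_RV_preimage; exact: measurable_half_open_cell.
  rewrite prodr_const cardsT card_ord.
  have y1 : 0 <= 1 - sigma ^+ 2 / n%:R.
    rewrite -(pr_half_open_cell ij.1 ij.2 (Ordinal n_gt0)) subr_ge0 pr_le1//.
    apply: measurable_RV_preimage; exact: measurable_half_open_cell.
  apply: le_trans (_ : expR (- (sigma ^+ 2 / n%:R)) ^+ n <= _).
    by apply: lerXn2r; [rewrite nnegrE|rewrite nnegrE; exact: expR_ge0|exact: onem_le_expR].
  by rewrite -expRM_natl mulrN mulrC divfK// gt_eqF.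
have : pr P (~` E) <= \sum_(z : 'I_m * 'I_m + 'I_n)
    pr P (match z with inl ij => empty ij | inr v => out v end).
  apply: pr_le_exists => //; first exact: measurableC.
    by case.
  move=> w nE; apply: contrapT => h; apply: nE.
  apply: (checkerboard_chromatic n_gt0 m_gt1 r_large).
    move=> v; apply: contrapT => o; apply: h.
    by exists (inr v).
  move=> i j; apply: contrapT => o; apply: h.
  exists (inl (i, j)) => //= v _ /= c; apply: o; exists v; exact: c.
rewrite big_sumType /= [X in _ + X]big1 => [|v _]; last exact: pr_outside_square.
rewrite prC// addr0 => h; rewrite lerBlDr -lerBlDl.
apply: (le_trans h); apply: le_trans (ler_sum _ (fun ij _ => pe ij)) _.
by rewrite sumr_const card_prod card_ord -[leLHS]mulr_natl natrM expr2.
Qed.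

End FullCells.

Section DenseLimit.
Context (R : realType) (d : nat -> measure_display) (T : forall n, measurableType (d n)).
Context (P : forall n, probability (T n) R) (X : forall n, 'I_n -> {RV (P n) >-> plane R}).
Hypothesis X_iid : forall n, (0 < n)%N -> iid_uniform_square (@X n).
Variable r : nat -> R.
Hypothesis r_gt0 : forall n, (0 < n)%N -> 0 < r n.

Lemma ln_natr_near_gt (M : R) : \forall n \near \oo, M < ln n%:R.
Proof.
near=> n; rewrite -(expRK M) ltr_ln ?posrE ?expR_gt0//; last first.
  by rewrite ltr0n; near: n; exact: nbhs_infty_gt.
by near: n; exact: natr_near_gt.
Unshelve. all: by end_near. Qed.

Lemma cvg_ln_natr_inv : (ln n%:R)^-1 @[n --> \oo] --> (0 : R).
Proof.
apply: (gtr0_cvgV0 (f := fun n : nat => ln n%:R : R) _).2.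
  exact: ln_natr_near_gt.
by apply/cvgryPgt => M; exact: ln_natr_near_gt.
Qed.

Lemma cube_bound (y l : R) : 216 < l -> 1 + l / 3 <= y -> 36 * l <= y ^+ 3.
Proof.
move=> l2 yl; have y72 : 72 <= y by lra.
have h1 : 72 * y <= y * y by rewrite ler_wpM2r//; lra.
have h2 : 72 * (y * y) <= y * (y * y) by rewrite ler_wpM2r// mulr_ge0//; lra.
by rewrite exprS expr2; lra.
Qed.

(** The factor 36 = 6^2 gives the grid at least six cells per side, so rounding their number
    enlarges a cell side by a factor at most 7/6. *)
Lemma ln_natr_le_natr : \forall n \near \oo, 36 * ln n%:R <= n%:R :> R.
Proof.
near=> n; have n0 : 0 < n%:R :> R by rewrite ltr0n; near: n; exact: nbhs_infty_gt.
have [l1 l2] : 0 < ln n%:R :> R /\ 216 < ln n%:R :> R.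
  by split; near: n; exact: ln_natr_near_gt.
have yl := expR_ge1Dx (ln n%:R / 3 : R).
have e : expR (ln n%:R / 3) ^+ 3 = n%:R :> R.
  by rewrite -expRM_natl mulrC divfK ?pnatr_eq0// lnK.
by rewrite -[leRHS]e; exact: cube_bound l2 yl.
Unshelve. all: by end_near. Qed.

Lemma cvg_dense : (\forall n \near \oo, 927 / 100 * Num.sqrt (ln n%:R) <= r n) ->
  pr (P n) [set w : T n | chi X r w = 2%N] @[n --> \oo] --> (1 : R).
Proof.
move=> rl.
apply: (@squeeze_cvgr _ _ _ _ (fun n => 1 - (ln n%:R)^-1) (fun=> 1)).
- near=> n; have n0 : (0 < n)%N by near: n; exact: nbhs_infty_gt.
  have N0 : 0 < n%:R :> R by rewrite ltr0n.
  have l0 : 0 < ln n%:R :> R by near: n; exact: ln_natr_near_gt.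
  have rn : 927 / 100 * Num.sqrt (ln n%:R) <= r n by near: n.
  have l36 : 36 * ln n%:R <= n%:R :> R by near: n; exact: ln_natr_le_natr.
  set a : R := Num.sqrt (ln n%:R) in rn; set t : R := Num.sqrt n%:R.
  have a0 : 0 < a by rewrite sqrtr_gt0.
  have t0 : 0 < t by rewrite sqrtr_gt0.
  have a2 : a ^+ 2 = ln n%:R by rewrite sqr_sqrtr// ltW.
  have t2 : t ^+ 2 = n%:R by rewrite sqr_sqrtr// ltW.
  have ta : 6 * a <= t.
    have p1 : 0 <= 6 * a by rewrite mulr_ge0// ltW.
    have p2 : 0 <= t := ltW t0.
    rewrite -(ler_pXn2r (n := 2)) ?nnegrE//.
    have e6 : 6 ^+ 2 = 36 :> R by rewrite -natrX.
    by rewrite exprMn a2 t2 e6.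
  pose m := Num.truncn (t / a).
  have ta0 : 0 <= t / a by rewrite divr_ge0// ltW.
  have /andP[m1 m2] := truncn_itv ta0.
  have m6 : (5 < m)%N by rewrite /m truncn_ge_nat// ler_pdivlMr.
  have m0 : 0 < m%:R :> R by rewrite ltr0n; apply: leq_trans m6.
  rewrite ler_pdivlMr// in m1; rewrite ltr_pdivrMr// -natr1 in m2.
  have m6' : 6 <= m%:R :> R by rewrite ler_nat.
  have sa : a <= t / m%:R by rewrite ler_pdivlMr// mulrC.
  (* The side t / m is at most (m + 1) / m <= 7/6 times [a], and 15/2 * 7/6 = 8.75 <= 9.27. *)
  have s_le : 15 / 2 * (t / m%:R) <= r n.
    apply: le_trans rn; rewrite mulrA ler_pdivrMr//; nra.
  apply/andP; split.
    apply: le_trans (pr_chromatic2 n0 (X_iid n0) (r_gt0 n0) (ltn_trans (isT : 1 < 5)%N m6) s_le).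
    (* The side is at least [a], so a cell is empty with probability at most 1/n; and m a <= t
       bounds the number of cells by n / ln n. *)
    rewrite lerB// -/t; apply: le_trans (_ : m%:R ^+ 2 * expR (- ln n%:R) <= _).
      rewrite ler_wpM2l ?sqr_ge0// ler_expR lerN2 -a2.
      by apply: lerXn2r; [rewrite nnegrE ltW|rewrite nnegrE; apply: le_trans sa; exact: ltW|].
    rewrite expRN lnK// ler_pdivrMr// -a2 -t2 mulrC ler_pdivlMr ?exprn_gt0//.
    rewrite -exprMn; apply: lerXn2r => //; rewrite nnegrE ?(ltW t0)//.
    by apply: mulr_ge0; exact: ltW.
  apply: pr_le1; exact: (measurable_chi X r_gt0 (fun k => k = 2%N)).
- rewrite -[X in _ --> X]subr0; apply: cvgB; [exact: cvg_cst|exact: cvg_ln_natr_inv].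
- exact: cvg_cst.
Unshelve. all: by end_near. Qed.

End DenseLimit.

(** * Many isolated pentagons *)

Section SecondMoment.
Context d (T : measurableType d) (R : realType) (P : probability T R).

Lemma integral_sum_indic (K : Type) (s : seq K) (E : K -> set T) (c : R) : 0 <= c ->
  (forall a, measurable (E a)) ->
  (\int[P]_w (\sum_(a <- s) c * \1_(E a) w)%:E = (c * \sum_(a <- s) pr P (E a))%:E)%E.
Proof.
move=> c0 mE; under eq_integral do rewrite -sumEFin.
rewrite ge0_integral_sum//.
- rewrite mulr_sumr -sumEFin; apply: eq_bigr => a _.
  under eq_integral do rewrite EFinM.
  rewrite integral_indic_cst// EFinM; congr (_ * _)%E; exact: (prE P (mE a)).
- move=> a; apply/measurable_EFinP; apply: measurable_funM; first exact: measurable_cst.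
  exact: (measurable_indic (mE a)).
- by move=> a w _; rewrite lee_fin mulr_ge0.
Qed.

(* Integrate [2 t N <= \1_(N > 0) + t ^+ 2 N ^+ 2], where [N] counts the events
   that occur, with [t] the inverse of the mean of [N]. *)
Lemma second_moment (K : finType) (E : K -> set T) (U : set T) (k : R) :
  measurable U -> (forall a, measurable (E a)) -> (forall a, E a `<=` U) ->
  0 < \sum_a pr P (E a) ->
  (forall a b, a != b -> pr P (E a `&` E b) <= k * (pr P (E a) * pr P (E b))) ->
  0 <= k ->
  2 - (\sum_a pr P (E a))^-1 - k <= pr P U.
Proof.
move=> mU mE EU S0 pairs k0; set S := \sum_a _ in S0 *.
pose t := S^-1; have t0 : 0 <= t by rewrite invr_ge0 ltW.
pose N (w : T) : R := \sum_a \1_(E a) w.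
pose E2 (ab : K * K) := E ab.1 `&` E ab.2.
have mE2 ab : measurable (E2 ab) by exact: measurableI.
have N2 w : \sum_ab t ^+ 2 * \1_(E2 ab) w = (t * N w) ^+ 2.
  rewrite -mulr_sumr exprMn; congr (_ * _); rewrite expr2 /N mulr_suml.
  rewrite (eq_bigr (fun ab : K * K => \1_(E ab.1) w * \1_(E ab.2) w)) => [|ab _].
    rewrite -(pair_bigA _ (fun a b => \1_(E a) w * \1_(E b) w)) /=.
    by apply: eq_bigr => a _; rewrite mulr_sumr.
  by rewrite /E2 indicI.
have pw w : \sum_a 2 * t * \1_(E a) w <= \1_U w + \sum_ab t ^+ 2 * \1_(E2 ab) w.
  rewrite N2 -mulr_sumr -/(N w).
  have [Uw|nUw] := pselect (U w).
    rewrite indicE mem_set// -[true%:R]/(1 : R).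
    by have := sqr_ge0 (1 - t * N w); move: (N w) => N0; nra.
  have -> : N w = 0.
    apply: big1 => a _; rewrite indicE memNset// => /EU //.
  by rewrite !mulr0 expr0n /= addr0.
have c2 : 0 <= 2 * t by rewrite mulr_ge0.
have I1 := integral_sum_indic (index_enum K) c2 mE.
have I2 := integral_sum_indic (index_enum (K * K)%type) (sqr_ge0 t) mE2.
have I3 : (\int[P]_w (\1_U w)%:E = (pr P U)%:E)%E.
  by rewrite integral_indic// setIT; exact: prE.
have msum (J : finType) (F : J -> set T) c : (forall a, measurable (F a)) ->
    measurable_fun setT (fun w => (\sum_a c * \1_(F a) w)%:E : \bar R).
  move=> mF; apply/measurable_EFinP; apply: measurable_sum => a.
  apply: measurable_funM; first exact: measurable_cst.
  exact: (measurable_indic (mF a)).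
have : (\int[P]_w (\sum_a 2 * t * \1_(E a) w)%:E <=
    \int[P]_w ((\1_U w)%:E + (\sum_ab t ^+ 2 * \1_(E2 ab) w)%:E))%E.
  apply: ge0_le_integral => //.
  - move=> w _; rewrite lee_fin; apply: sumr_ge0 => a _; exact: mulr_ge0.
  - exact: msum.
  - apply: emeasurable_funD; last exact: msum.
    by apply/measurable_EFinP; exact: (measurable_indic mU).
  - by move=> w _; rewrite -EFinD lee_fin.
rewrite ge0_integralD//; first last.
- exact: msum.
- by move=> w _; rewrite lee_fin; apply: sumr_ge0 => a _; rewrite mulr_ge0// sqr_ge0.
- by apply/measurable_EFinP; exact: (measurable_indic mU).
rewrite I1 I2 I3 -EFinD lee_fin -/S.
have tS : t * S = 1 by rewrite mulVf// gt_eqF.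
set S2 := \sum_(a <- _) _ => main.
(* The diagonal pairs contribute S, all the others at most k S^2. *)
have S2le : S2 <= S + k * S ^+ 2.
  rewrite /S2 -(pair_bigA _ (fun a b => pr P (E a `&` E b))) /=.
  have h a : \sum_b pr P (E a `&` E b) <= pr P (E a) + k * (pr P (E a) * S).
    rewrite (bigD1 a)//= setIid; apply: lerD => //.
    rewrite /S mulr_sumr mulr_sumr [leRHS](bigD1 a)//= -[leLHS]add0r; apply: lerD.
      by rewrite !mulr_ge0// pr_ge0.
    by apply: ler_sum => b ba; apply: pairs; rewrite eq_sym.
  apply: le_trans (ler_sum _ (fun a _ => h a)) _.
  by rewrite big_split /= -mulr_sumr -mulr_suml -/S expr2.
have h1 : t ^+ 2 * S2 <= t ^+ 2 * (S + k * S ^+ 2) by rewrite ler_wpM2l ?sqr_ge0.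
have e1 : t ^+ 2 * (S + k * S ^+ 2) = t * (t * S) + k * (t * S) ^+ 2 by ring.
rewrite e1 tS mulr1 expr1n mulr1 in h1.
rewrite -mulrA tS mulr1 in main.
by rewrite -/t; lra.
Qed.

End SecondMoment.

Local Opaque region_rows.

(** * The pentagon scaled and placed in a block *)

Section PentagonGeometry.
Context (R : realType) (n : nat) (r : R) (r_gt0 : 0 < r).

(* The square is tiled by blocks of side [500 * unit_length], each with room for
   a copy of the pentagon. *)
Definition unit_length : R := r / 150.
Let u := unit_length.
Let s : R := Num.sqrt n%:R / 2.
Let u_gt0 : 0 < u. Proof. by rewrite divr_gt0. Qed.

Definition origin (a : nat) : R := - s + a%:R * (500 * u).

Definition scaled (c : nat * nat) (v : R * R) : R * R :=
  ((v.1 - origin c.1) / u, (v.2 - origin c.2) / u).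

Lemma scaled_edist c x y :
  (Defs.edist x y <= r) = (dist2 (scaled c x) (scaled c y) <= ZtoR R 22500%zz).
Proof.
rewrite edist_le ?(ltW r_gt0)// ZtoR_22500 /dist2 /scaled /=.
have -> : ((x.1 - origin c.1) / u - (y.1 - origin c.1) / u) ^+ 2 +
   ((x.2 - origin c.2) / u - (y.2 - origin c.2) / u) ^+ 2 =
   ((x.1 - y.1) ^+ 2 + (x.2 - y.2) ^+ 2) / u ^+ 2.
  by field; rewrite gt_eqF.
rewrite ler_pdivrMr ?exprn_gt0// -exprMn; congr (_ <= _ ^+ 2).
by rewrite /u /unit_length mulrC divfK// pnatr_eq0.
Qed.

Lemma scaled_itv c (a b : R) (x : R) :
  (a <= (x - origin c) / u <= b) = (origin c + a * u <= x <= origin c + b * u).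
Proof. by rewrite ler_pdivlMr// ler_pdivrMr// lerBrDl lerBlDl. Qed.

Definition vertex_box (c : nat * nat) (j : nat) : set (plane R) :=
  [set v | in_cell (vertex j) (scaled c v)].

Definition lens_region (c : nat * nat) : set (plane R) :=
  [set v | in_region (scaled c v)].

Lemma vertex_boxE c j :
  vertex_box c j = rect (origin c.1 + ZtoR R (vertex j).1 * u)
                        (origin c.1 + (ZtoR R (vertex j).1 + 1) * u)
                        (origin c.2 + ZtoR R (vertex j).2 * u)
                        (origin c.2 + (ZtoR R (vertex j).2 + 1) * u).
Proof.
apply/seteqP; split=> v; rewrite /vertex_box /rect /in_cell /= !scaled_itv !in_itv /=.
  by move=> /andP[].
by move=> [-> ->].
Qed.

Lemma measurable_vertex_box c j : measurable (vertex_box c j).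
Proof. by rewrite vertex_boxE; exact: measurable_rect. Qed.

Lemma area_vertex_box c j : area (vertex_box c j) = (u ^+ 2)%:E.
Proof.
have u0 := u_gt0; rewrite vertex_boxE area_rect.
- by congr (_%:E); ring.
- by rewrite lerD2l ler_pM2r// lerDl.
- by rewrite lerD2l ler_pM2r// lerDl.
Qed.

Definition row_rect (c : nat * nat) (row : Z * (Z * Z)) : set (plane R) :=
  rect (origin c.1 + ZtoR R row.2.1 * u) (origin c.1 + ZtoR R row.2.2 * u)
       (origin c.2 + ZtoR R row.1 * u) (origin c.2 + (ZtoR R row.1 + 1) * u).

Lemma lens_regionE c : lens_region c = \big[setU/set0]_(row <- region_rows) row_rect c row.
Proof.
rewrite -bigcup_seq; apply/seteqP; split=> v.
  rewrite [lens_region c v]/(is_true (in_region _)) => /hasP[[Y [a b]] rowi /andP[]].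
  rewrite /in_row /= !scaled_itv => h1 h2.
  by exists (Y, (a, b)) => //; rewrite /row_rect /rect /= !in_itv /=.
move=> [[Y [a b]] /= rowi]; rewrite /row_rect /rect /= !in_itv /= => -[h1 h2].
rewrite [lens_region c v]/(is_true (in_region _)).
by apply/hasP; exists (Y, (a, b)) => //=; rewrite !scaled_itv h1 h2.
Qed.

Lemma measurable_row_rect c row : measurable (row_rect c row).
Proof. exact: measurable_rect. Qed.

Lemma measurable_lens_region c : measurable (lens_region c).
Proof.
by rewrite lens_regionE; apply: bigsetU_measurable => row _; exact: measurable_row_rect.
Qed.

(** A vertex is in the lens of itself and the next vertex, since it is adjacent to every point of
    the next cell; the corner of that cell serves. *)
Lemma vertex_box_region c j : vertex_box c j `<=` lens_region c.
Proof.
move=> v vj.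
have vj' : in_cell (vertex j.+1) (ZtoR R (vertex j.+1).1, ZtoR R (vertex j.+1).2).
  by rewrite /in_cell /= !lexx !lerDl ler01.
apply: (lens_in_region vj vj').
  by rewrite /dist2 !subrr expr0n /= addr0 ZtoR_22500 sqr_ge0.
pose o (k : nat) : 'I_5 := inord (k %% 5).
have vo k : vertex (o k) = vertex k by rewrite /vertex inordK ?modn_mod// ltn_mod.
have := cell_adj (i := o j) (j := o j.+1); rewrite !vo => /(_ _ _ _ vj vj') ->.
  by rewrite /= /C5_adj /o !inordK ?ltn_mod// modn_mod -[(j %% 5).+1]addn1 modnDml addn1 eqxx.
apply/eqP => /(congr1 val); rewrite /o /= !inordK ?ltn_mod// -[j.+1]addn1 -modnDml.
have : (j %% 5 < 5)%N by rewrite ltn_mod.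
by case: (j %% 5)%N => [|[|[|[|[|k]]]]].
Qed.

Lemma region_row_bounds row : row \in region_rows ->
  [/\ 1 <= ZtoR R row.2.1, ZtoR R row.2.1 <= ZtoR R row.2.2, ZtoR R row.2.2 <= 499,
      1 <= ZtoR R row.1 & ZtoR R row.1 <= 498].
Proof.
move=> /(allP region_rows_bounds)/and5P[/Z.leb_le/(le_ZtoR R) h1 /Z.leb_le/(le_ZtoR R) h2
  /Z.leb_le/(le_ZtoR R) h3 /Z.leb_le/(le_ZtoR R) h4 /Z.leb_le/(le_ZtoR R) h5].
by split.
Qed.

Lemma lens_region_cell c v : lens_region c v ->
  (origin c.1 < v.1 < origin c.1 + 500 * u) /\ (origin c.2 < v.2 < origin c.2 + 500 * u).
Proof.
have u0 := u_gt0.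
rewrite lens_regionE -bigcup_seq => -[row /= /region_row_bounds[h1 h2 h3 h4 h5]].
rewrite /row_rect /rect /= !in_itv /= => -[/andP[a1 a2] /andP[b1 b2]].
have m1 : 1 * u <= ZtoR R row.2.1 * u by rewrite ler_wpM2r// ltW.
have m2 : ZtoR R row.2.2 * u <= 499 * u by rewrite ler_wpM2r// ltW.
have m3 : 1 * u <= ZtoR R row.1 * u by rewrite ler_wpM2r// ltW.
have m4 : ZtoR R row.1 * u <= 498 * u by rewrite ler_wpM2r// ltW.
rewrite mulrDl in b2.
move: (ZtoR R row.2.1 * u) (ZtoR R row.2.2 * u) (ZtoR R row.1 * u) m1 m2 m3 m4 a1 a2 b1 b2
  => *; split; apply/andP; split; lra.
Qed.

Lemma lens_region_disjoint c c' v : lens_region c v -> lens_region c' v -> c = c'.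
Proof.
have u0 := u_gt0.
have h (a b : nat) (x : R) : origin a < x < origin a + 500 * u ->
    origin b < x < origin b + 500 * u -> (a <= b)%N.
  move=> /andP[h1 h2] /andP[h3 h4]; rewrite leqNgt; apply/negP => ba.
  have : b.+1%:R * (500 * u) <= a%:R * (500 * u).
    by apply: ler_wpM2r; [apply: mulr_ge0; [exact: ler0n|exact: ltW]|rewrite ler_nat].
  have -> : b.+1%:R = b%:R + 1 :> R by rewrite natr1.
  rewrite mulrDl mul1r; move: h1 h2 h3 h4; rewrite /origin.
  move: (a%:R * (500 * u)) (b%:R * (500 * u)) => y z.
  move: (500 * u) => t *; lra.
case: c c' => [a b] [a' b'] /lens_region_cell[/= h1 h2] /lens_region_cell[/= h3 h4].
by congr pair; apply/eqP; rewrite eqn_leq; apply/andP; split; apply: h; eassumption.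
Qed.

Lemma C5_separated (j k : 'I_5) : j != k ->
  exists l : 'I_5, [/\ j != l, k != l & C5 j l != C5 k l].
Proof.
have all_separated : all (fun a => all (fun b => (a == b) || has (fun c =>
    [&& a != c, b != c & ((c == a.+1 %[mod 5]) || (a == c.+1 %[mod 5])) !=
      ((c == b.+1 %[mod 5]) || (b == c.+1 %[mod 5]))]) (iota 0 5)) (iota 0 5)) (iota 0 5).
  by vm_compute.
move=> jk; have /allP/(_ (val j)) := all_separated; rewrite mem_iota ltn_ord => /(_ isT).
move=> /allP/(_ (val k)); rewrite mem_iota ltn_ord => /(_ isT).
rewrite (_ : (val j == val k) = false) ?orFb; last exact: negbTE.
move=> /hasP[c]; rewrite mem_iota => c5 /and3P[jc kc djk].
by exists (Ordinal (c5 : (c < 5)%N)); split.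
Qed.

(** A point in two boxes would be both within and beyond the threshold from the corner of a third
    cell, whose vertex is adjacent to exactly one of the two. *)
Lemma vertex_box_disjoint c (j k : 'I_5) v : vertex_box c j v -> vertex_box c k v -> j = k.
Proof.
move=> vj vk; apply/eqP; apply: contraT => /C5_separated[l [jl kl]].
have vl : in_cell (vertex l) (ZtoR R (vertex l).1, ZtoR R (vertex l).2).
  by rewrite /in_cell /= !lexx !lerDl ler01.
by rewrite -(cell_adj vj vl jl) -(cell_adj vk vl kl) eqxx.
Qed.

End PentagonGeometry.

Lemma ZtoR_105300 (R : realType) : ZtoR R 105300%zz = 468 * 15 ^+ 2.
Proof.
rewrite expr2.
exact: etrans (ZtoRM R 468%zz (15 * 15)%zz) (congr1 _ (ZtoRM R 15%zz 15%zz)).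
Qed.

(** * Probabilities of isolated pentagons *)

Section PentagonEvents.
Context d (T : measurableType d) (R : realType) (P : probability T R).
Context (n : nat) (n_gt0 : (0 < n)%N) (X : 'I_n -> {RV P >-> plane R}).
Hypothesis Xiid : iid_uniform_square X.
Context (r : R) (r_gt0 : 0 < r).

Let u := unit_length r.
Let N : R := n%:R.
Let box := vertex_box n r.
Let region := lens_region n r.
Let mbox c j : measurable (box c j). Proof. exact: measurable_vertex_box. Qed.
Let mregion c : measurable (region c). Proof. exact: measurable_lens_region. Qed.
Let u0 : 0 < u. Proof. by rewrite /u /unit_length divr_gt0// ltr0n. Qed.
Let N0 : 0 < N. Proof. by rewrite ltr0n. Qed.

Lemma lens_region_square m c : m%:R * (500 * u) <= Num.sqrt N ->
  (c.1 < m)%N -> (c.2 < m)%N -> region c `<=` @square R n.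
Proof.
move=> mu c1 c2 v /(lens_region_cell r_gt0).
have h (a : nat) (x : R) : (a < m)%N -> origin n r a < x < origin n r a + 500 * u ->
    - (Num.sqrt N / 2) <= x <= Num.sqrt N / 2.
  move=> am /andP[h1 h2].
  have k0 : 0 <= a%:R * (500 * u) 
    by apply: mulr_ge0; [exact: ler0n|apply: mulr_ge0; [exact: ler0n|exact: ltW]].
  have km : a.+1%:R * (500 * u) <= m%:R * (500 * u).
    apply: ler_wpM2r; last by rewrite ler_nat.
    by apply: mulr_ge0; [exact: ler0n|exact: ltW].
  have aS : a.+1%:R = a%:R + 1 :> R by rewrite natr1.
  rewrite aS mulrDl mul1r in km.
  move: h1 h2; rewrite /origin -/u -/N; move: k0 km mu.
  move: (a%:R * (500 * u)) (m%:R * (500 * u)) => y z.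
  move: (500 * u) (Num.sqrt N) => t q *; apply/andP; split; lra.
by move=> [/(h _ _ c1) h1 /(h _ _ c2) h2]; split; rewrite /= in_itv.
Qed.

Lemma pr_lens_region_le c i : pr P (X i @^-1` region c) <= 117 / 25 * r ^+ 2 / N.
Proof.
rewrite /region lens_regionE// (_ : X i @^-1` _ =
  \big[setU/set0]_(row <- region_rows) (X i @^-1` row_rect n r c row)); last first.
  by rewrite -!bigcup_seq preimage_bigcup.
apply: le_trans (pr_le_bigU _ _ _) _.
  by move=> row; apply: measurable_RV_preimage; exact: measurable_row_rect.
have le_row row : row \in region_rows -> pr P (X i @^-1` row_rect n r c row) <=
    ZtoR R (row.2.2 - row.2.1)%zz * (u ^+ 2 / N).
  move=> /(region_row_bounds R)[_ h _ _ _].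
  apply: le_trans (pr_point_le n_gt0 Xiid i _ _) _.
  - by rewrite lerD2l ler_pM2r.
  - by rewrite lerD2l ler_pM2r// lerDl.
  by rewrite ZtoRB le_eqVlt; apply/orP; left; apply/eqP; rewrite -/u -/N; ring.
rewrite big_seq; apply: le_trans (ler_sum _ le_row) _; rewrite -big_seq -mulr_suml.
have -> : \sum_(row <- region_rows) ZtoR R (row.2.2 - row.2.1)%zz =
    ZtoR R (rows_area region_rows).
  by elim: region_rows => [|row s ih]; rewrite ?big_nil// big_cons ih /= ZtoRD.
have le_area : ZtoR R (rows_area region_rows) <= 468 * 15 ^+ 2.
  by rewrite -ZtoR_105300; apply: le_ZtoR; apply/Z.leb_le; exact: region_rows_area.
apply: le_trans (ler_wpM2r _ le_area) _; first by rewrite divr_ge0 ?sqr_ge0// ltW.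
rewrite le_eqVlt; apply/orP; left; apply/eqP; rewrite /u /unit_length.
by field; rewrite gt_eqF.
Qed.

(** Each of the n points gets its own allowed set, so the probability that [t] forms an isolated
    pentagon in block [c] is a product over the points. *)
Definition pentagon_site (c : nat * nat) (t : 'I_5 -> 'I_n) (i : 'I_n) : set (plane R) :=
  if [pick j | t j == i] is Some j then box c j else ~` region c.

Lemma pentagon_siteE c t j : injective t -> pentagon_site c t (t j) = box c j.
Proof.
move=> ti; rewrite /pentagon_site; case: pickP => [k /eqP/ti -> //|/(_ j)].
by rewrite eqxx.
Qed.

Lemma pentagon_siteC c t i : i \notin codom t -> pentagon_site c t i = ~` region c.
Proof.
by rewrite /pentagon_site; case: pickP => [k /eqP <-|//]; rewrite codom_f.
Qed.

Lemma measurable_pentagon_site c t i : measurable (pentagon_site c t i).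
Proof. by rewrite /pentagon_site; case: pickP => [k|] _ //; exact: measurableC. Qed.

Definition pentagon_event (c : nat * nat) (t : 'I_5 -> 'I_n) : set T :=
  \bigcap_(i in [set` [set: 'I_n]%SET]) X i @^-1` pentagon_site c t i.

Lemma measurable_pentagon_event c t : measurable (pentagon_event c t).
Proof.
apply: fin_bigcap_measurable; first exact: finite_finset.
by move=> i _; apply: measurable_RV_preimage; exact: measurable_pentagon_site.
Qed.

Lemma pentagon_event_site c t w i : pentagon_event c t w -> pentagon_site c t i (X i w).
Proof. by move=> /(_ i); apply; rewrite /= finset.inE. Qed.

Lemma pentagon_event_chi c t w : injective t -> pentagon_event c t w ->
  (3 <= clique_chromatic_number (rgg X r w))%N.
Proof.
move=> ti Ew; have boxP (j : 'I_5) : box c j (X (t j) w).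
  by have := pentagon_event_site (t j) Ew; rewrite pentagon_siteE.
have tC : induced_C5 (rgg X r w) t.
  move=> i j; rewrite rgg_adj (inj_eq ti); have [->|ij] := eqVneq i j.
    by rewrite adj_irr.
  by rewrite (scaled_edist n r_gt0 c) (cell_adj (boxP i) (boxP j)).
apply: (induced_C5_chromatic_ge3 tC) => i j v ij; apply/negP => /andP[vi vj].
(* A common neighbour on the pentagon would form a triangle; any other one would be in the region,
   which the event keeps empty of further points. *)
have [/codomP[k e]|vt] := boolP (v \in codom t).
  by move: vi vj (C5_triangle_free i j k); rewrite e !tC ij => -> ->.
have := pentagon_event_site v Ew; rewrite pentagon_siteC//; apply.
have nearP k : rgg X r w v (t k) ->
    dist2 (scaled n r c (X v w)) (scaled n r c (X (t k) w)) <= ZtoR R 22500%zz.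
  by rewrite rgg_adj => /andP[_]; rewrite (scaled_edist n r_gt0 c).
have vE (k l : 'I_5) : k == l.+1 %[mod 5] -> vertex k = vertex l.+1.
  by move=> /eqP; rewrite /vertex => ->.
have := ij; rewrite /= /C5_adj => /orP[] /vE e.
  by apply: (lens_in_region (boxP i) _ (nearP _ vi) (nearP _ vj)); rewrite -e; exact: boxP.
by apply: (lens_in_region (boxP j) _ (nearP _ vj) (nearP _ vi)); rewrite -e; exact: boxP.
Qed.

Context (m : nat) (m_le : m%:R * (500 * u) <= Num.sqrt N).

Let delta : R := 117 / 25 * r ^+ 2 / N.
Let beta : R := u ^+ 2 / N.
Hypothesis delta1 : delta < 1.

Let beta0 : 0 < beta. Proof. by rewrite divr_gt0// exprn_gt0. Qed.
Let delta0 : 0 <= delta.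
Proof. by rewrite /delta !mulr_ge0 ?sqr_ge0 ?invr_ge0 ?ler0n// ltW. Qed.

Definition hole (c : nat * nat) : R := fine (area (region c)) / N.

Section Site.
Context (c : nat * nat) (c1 : (c.1 < m)%N) (c2 : (c.2 < m)%N).

Let region_square : region c `<=` @square R n.
Proof. exact: lens_region_square m_le c1 c2. Qed.

Lemma pr_vertex_box i j : pr P (X i @^-1` box c j) = beta.
Proof.
rewrite pr_point_eq//; first by rewrite area_vertex_box.
by move=> v vj; apply: region_square; exact: vertex_box_region vj.
Qed.

Lemma pr_lens_region i : pr P (X i @^-1` region c) = hole c.
Proof. by rewrite pr_point_eq. Qed.

Lemma hole_ge0 : 0 <= hole c.
Proof. by rewrite -(pr_lens_region (Ordinal n_gt0)) pr_ge0. Qed.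

Lemma hole_le : hole c <= delta.
Proof. by rewrite -(pr_lens_region (Ordinal n_gt0)); exact: pr_lens_region_le. Qed.

Lemma pr_lens_regionC i : pr P (X i @^-1` (~` region c)) = 1 - hole c.
Proof.
rewrite -preimage_setC prC; last exact: measurable_RV_preimage.
by rewrite pr_lens_region.
Qed.

Lemma pr_pentagon_site t i : injective t ->
  pr P (X i @^-1` pentagon_site c t i) = if i \in codom t then beta else 1 - hole c.
Proof.
move=> ti; case: ifP => [/codomP[j ->]|/negbT it].
  by rewrite pentagon_siteE// pr_vertex_box.
by rewrite pentagon_siteC// pr_lens_regionC.
Qed.

Lemma pr_pentagon_event t :
  pr P (pentagon_event c t) = \prod_i pr P (X i @^-1` pentagon_site c t i).
Proof.
rewrite pr_rectangles//; last exact: measurable_pentagon_site.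
by apply: eq_bigl => i; rewrite finset.inE.
Qed.

Lemma pr_pentagon_event_ge t : injective t ->
  beta ^+ 5 * (1 - delta) ^+ n <= pr P (pentagon_event c t).
Proof.
move=> ti; rewrite pr_pentagon_event.
(* The factor 1 - delta is given to all n points, also to the five vertices, to have the plain
   exponent n. *)
have -> : beta ^+ 5 * (1 - delta) ^+ n =
    \prod_i ((if i \in codom t then beta else 1) * (1 - delta)).
  rewrite big_split/= prodr_const card_ord; congr (_ * _).
  by rewrite -big_mkcond prodr_const card_codom// card_ord.
have d1 : 0 <= 1 - delta by rewrite subr_ge0 ltW.
apply: ler_prod => i _; rewrite pr_pentagon_site//; case: ifP => _.
  by rewrite mulr_ge0 ?(ltW beta0)//= ler_piMr ?(ltW beta0)// lerBlDr lerDl.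
by rewrite mul1r d1 lerD2l lerN2 hole_le.
Qed.

End Site.

(** In the same block each vertex of one pentagon must be a vertex of the other, and the disjoint
    boxes force equal labels. In different blocks a shared point would be in two disjoint
    regions. *)
Lemma pentagon_events_disjoint c c' t t' w : injective t -> injective t' ->
  pentagon_event c t w -> pentagon_event c' t' w ->
  (c = c' /\ t =1 t') \/ (c <> c' /\ forall j, t j \notin codom t').
Proof.
move=> ti ti' Ew Ew'.
have boxP (j : 'I_5) : box c j (X (t j) w).
  by have := pentagon_event_site (t j) Ew; rewrite pentagon_siteE.
have boxP' (j : 'I_5) : box c' j (X (t' j) w).
  by have := pentagon_event_site (t' j) Ew'; rewrite pentagon_siteE.
have [cc|cc] := eqVneq c c'; [left|right]; (split; first by [| move/eqP: cc]) => j; last first.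
  apply/negP => /codomP[k e]; move/eqP: cc; apply.
  apply: (lens_region_disjoint r_gt0 (vertex_box_region (boxP j))).
  by rewrite e; exact: vertex_box_region (boxP' k).
have [/codomP[k e]|tj] := boolP (t j \in codom t'); last first.
  have := pentagon_event_site (t j) Ew'; rewrite pentagon_siteC// -cc => h; exfalso.
  by apply: h; exact: vertex_box_region (boxP j).
have := boxP' k; rewrite -cc -e => bk.
by rewrite e (vertex_box_disjoint (boxP j) bk).
Qed.

Let q : R := (1 - delta)^-1.
Let d1 : 0 < 1 - delta. Proof. by rewrite subr_gt0. Qed.
Let q1 : 1 <= q. Proof. by rewrite invf_ge1// lerBlDr lerDl. Qed.
Let q0 : 0 <= q. Proof. exact: le_trans ler01 q1. Qed.

(** A point of neither tuple avoids both disjoint regions with probability 1 - h - h' <= (1 - h)(1 -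
    h'). For each of the at most ten tuple points, dropping the constraint from the other pentagon
    costs a factor 1 / (1 - hole) <= q. *)
Lemma pr_pentagon_pair c c' t t' :
  (c.1 < m)%N -> (c.2 < m)%N -> (c'.1 < m)%N -> (c'.2 < m)%N -> injective t -> injective t' ->
  c <> c' -> (forall j, t j \notin codom t') ->
  pr P (pentagon_event c t `&` pentagon_event c' t') <=
    q ^+ 10 * (pr P (pentagon_event c t) * pr P (pentagon_event c' t')).
Proof.
move=> c1 c2 c1' c2' ti ti' cc tt'.
pose S i := pentagon_site c t i; pose S' i := pentagon_site c' t' i.
have mS i : measurable (S i) by exact: measurable_pentagon_site.
have mS' i : measurable (S' i) by exact: measurable_pentagon_site.
have mSS i : measurable (S i `&` S' i) by exact: measurableI.
pose D := [set i in codom t]%SET :|: [set i in codom t']%SET.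
pose e i : R := if i \in D then q else 1.
have e0 i : 0 <= e i by rewrite /e; case: ifP => _ //; exact: ler01.
have qh c'' : (c''.1 < m)%N -> (c''.2 < m)%N -> 1 <= q * (1 - hole c'').
  move=> h1 h2; rewrite /q ler_pdivlMl// mulr1.
  by rewrite lerD2l lerN2; exact: hole_le.
have site i : pr P (X i @^-1` (S i `&` S' i)) <=
    e i * (pr P (X i @^-1` S i) * pr P (X i @^-1` S' i)).
  have leS : pr P (X i @^-1` (S i `&` S' i)) <= pr P (X i @^-1` S i).
    by apply: le_pr; [exact: measurable_RV_preimage|exact: measurable_RV_preimage|move=> w []].
  have leS' : pr P (X i @^-1` (S i `&` S' i)) <= pr P (X i @^-1` S' i).
    by apply: le_pr; [exact: measurable_RV_preimage|exact: measurable_RV_preimage|move=> w []].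
  have [it|it] := boolP (i \in codom t).
    have it' : (i \in codom t') = false by apply/negbTE; case/codomP: it => j ->.
    apply: le_trans leS _; rewrite /e !finset.inE it /= /S /S'.
    rewrite !pr_pentagon_site// it it' mulrCA ler_peMr ?(ltW beta0)//; exact: qh.
  have [it'|it'] := boolP (i \in codom t').
    apply: le_trans leS' _; rewrite /e !finset.inE it' orbT /S /S'.
    rewrite !pr_pentagon_site// (negbTE it) it' mulrA ler_peMl ?(ltW beta0)//; exact: qh.
  rewrite /e !finset.inE (negbTE it) (negbTE it') /= mul1r.
  have -> : S i `&` S' i = ~` (region c `|` region c').
    by rewrite /S /S' !pentagon_siteC// setCU.
  rewrite /S /S' !pr_pentagon_site// (negbTE it) (negbTE it') -preimage_setC.
  rewrite prC; last by apply: measurable_RV_preimage; exact: measurableU.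
  rewrite preimage_setU prU; [|exact: measurable_RV_preimage|exact: measurable_RV_preimage|].
    rewrite !pr_lens_region//; have := hole_ge0 c1 c2; have := hole_ge0 c1' c2'.
    move: (hole c) (hole c') => x y; nra.
  apply/seteqP; split=> // w [/= v1 v2]; apply: cc.
  exact: (lens_region_disjoint r_gt0 v1 v2).
apply: le_trans (_ : \prod_i pr P (X i @^-1` (S i `&` S' i)) <= _).
  rewrite (_ : \prod_i _ = pr P (\bigcap_(i in [set` [set: 'I_n]%SET]) X i @^-1` (S i `&` S' i))).
    apply: le_pr; first by apply: measurableI; exact: measurable_pentagon_event.
      apply: fin_bigcap_measurable; first exact: finite_finset.
      by move=> i _; exact: measurable_RV_preimage.
    by move=> w [h1 h2] i iT; split; [exact: h1|exact: h2].
  by rewrite pr_rectangles//; apply: eq_bigl => i; rewrite finset.inE.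
apply: le_trans (_ : \prod_i (e i * (pr P (X i @^-1` S i) * pr P (X i @^-1` S' i))) <= _).
  by apply: ler_prod => i _; rewrite pr_ge0 site.
rewrite big_split /= big_split /= -!pr_pentagon_event; apply: ler_wpM2r.
  by rewrite mulr_ge0// pr_ge0.
rewrite /e -big_mkcond prodr_const ler_weXn2l//.
have cardc (f : 'I_5 -> 'I_n) : (#|[set i in codom f]%SET| <= 5)%N.
  by rewrite cardsE (leq_trans (leq_image_card f _))// card_ord.
apply: leq_trans (leq_card_setU _ _) _.
exact: leq_add (cardc t) (cardc t').
Qed.

Lemma pentagon_second_moment : (0 < m)%N -> (5 <= n)%N ->
  2 - (m%:R ^+ 2 * (n ^_ 5)%:R * (beta ^+ 5 * (1 - delta) ^+ n))^-1 - q ^+ 10 <=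
  pr P [set w | (3 <= clique_chromatic_number (rgg X r w))%N].
Proof.
move=> m_gt0 n5.
pose site (a : 'I_m * 'I_m) : nat * nat := (val a.1, val a.2).
(* The index ranges over all functions, a finite type; non-injective ones get the empty event. *)
pose E (a : 'I_m * 'I_m * {ffun 'I_5 -> 'I_n}) : set T :=
  if injectiveb a.2 then pentagon_event (site a.1) a.2 else set0.
have mE a : measurable (E a) by rewrite /E; case: ifP => // _; exact: measurable_pentagon_event.
set L := _ * _ * _.
have L0 : 0 < L.
  have f0 : 0 < (n ^_ 5)%:R :> R by rewrite ltr0n ffact_gt0.
  have m0 : 0 < m%:R ^+ 2 :> R by rewrite exprn_gt0// ltr0n.
  by apply: mulr_gt0; [exact: mulr_gt0|apply: mulr_gt0; exact: exprn_gt0].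
have LS : L <= \sum_a pr P (E a).
  rewrite -(pair_bigA _ (fun a t => pr P (E (a, t)))) /=.
  have inner a : (n ^_ 5)%:R * (beta ^+ 5 * (1 - delta) ^+ n) <= \sum_t pr P (E (a, t)).
    have -> : (n ^_ 5)%N = #|[set f : {ffun 'I_5 -> 'I_n} | injectiveb f]%SET|.
      by rewrite card_inj_ffuns !card_ord.
    rewrite mulr_natl -sumr_const big_mkcond /=; apply: ler_sum => t _.
    rewrite finset.inE /E; case: ifP => [/injectiveP ti|_]; last exact: pr_ge0.
    exact: (pr_pentagon_event_ge (c := site a) (ltn_ord _) (ltn_ord _) ti).
  apply: le_trans (ler_sum _ (fun a _ => inner a)).
  by rewrite sumr_const card_prod !card_ord -[_ *+ _]mulr_natl natrM /L expr2 !mulrA lexx.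
apply: le_trans (second_moment (k := q ^+ 10) (E := E) _ mE _ _ _ _).
- by rewrite !lerD2r lerD2l lerN2 lef_pV2 ?posrE// (lt_le_trans L0).
- exact: (measurable_rgg X r_gt0 (fun g => (3 <= clique_chromatic_number g)%N)).
- move=> [a t] w; rewrite /E /=; case: ifP => // /injectiveP ti.
  exact: pentagon_event_chi.
- exact: lt_le_trans L0 LS.
- move=> [a t] [b t'] ab; rewrite /E /=.
  have z A B : A `&` B = set0 -> pr P (A `&` B) <= q ^+ 10 * (pr P A * pr P B).
    by move=> ->; rewrite pr0 mulr_ge0 ?exprn_ge0// mulr_ge0// pr_ge0.
  case: ifP => [/injectiveP ti|_]; last by apply: z; rewrite set0I.
  case: ifP => [/injectiveP ti'|_]; last by apply: z; rewrite setI0.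
  (* Incompatible events satisfy the bound trivially; compatible ones with different indices are in
     different blocks and share no point. *)
  have [[w [Ew Ew']]|] := pselect (exists w, pentagon_event (site a) t w /\
    pentagon_event (site b) t' w); last first.
    by move=> nE; apply: z; apply/seteqP; split=> // w [h1 h2]; apply: nE; exists w.
  have [[ss tt']|[ss tt']] := pentagon_events_disjoint ti ti' Ew Ew'.
    have aE : a = b.
      by case: a b ss {ab Ew Ew'} => [a1 a2] [b1 b2] [/val_inj -> /val_inj ->].
    have tE : t = t' by apply/ffunP.
    by rewrite aE tE eqxx in ab.
  exact: (pr_pentagon_pair (c := site a) (c' := site b) (ltn_ord _) (ltn_ord _)
    (ltn_ord _) (ltn_ord _) ti ti' ss tt').
- exact: exprn_ge0.
Qed.

End PentagonEvents.

(** * The expected number of isolated pentagons *)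

Section PentagonLimit.
Context (R : realType).

(** The product of the bounds 9/400 n / r^2 for the number of blocks, n^5 / 2 for the number of
    tuples and r^10 / (150^10 n^5) for the five boxes is [K0] times n r^8. *)
Let K0 : R := 9 / 800 / 150 ^+ 10.

Lemma thousandth_lt1 : 1 / 1000 < 1 :> R. Proof. by lra. Qed.

Lemma radius_rate : (46 / 100) ^+ 2 <= 2116 / 10000 :> R. Proof. by lra. Qed.

(** Replacing 4.68 by 4.69 absorbs the factor 1 / (1 - delta) that comes with the lower bound on (1
    - delta)^n. *)
Lemma rate_bound (z delta : R) : 0 <= z -> delta <= 1 / 1000 ->
  117 / 25 * z <= 469 / 100 * z * (1 - delta).
Proof. by move=> *; nra. Qed.

Lemma complement_lt (a b p e : R) :
  2 - a - b <= p -> b < 1 + e / 2 -> a < e / 2 -> 1 - p < e.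
Proof. by move=> *; lra. Qed.

(** What remains of the exponent of n: 4.69 * 0.2116 < 0.9925, with 0.2116 = 0.46^2. *)
Lemma exponent_bound (l z : R) : z <= 2116 / 10000 * l -> 0 < l ->
  75 / 10000 * l <= l - 469 / 100 * z.
Proof. by move=> *; lra. Qed.

Lemma pentagon_mean_bound (n : nat) (r : R) : (0 < n)%N -> 0 < r -> 0 < ln n%:R :> R ->
  r <= 46 / 100 * Num.sqrt (ln n%:R) -> 36 * ln n%:R <= n%:R :> R ->
  117 / 25 * r ^+ 2 / n%:R <= 1 / 1000 -> n%:R ^+ 5 / 2 <= (n ^_ 5)%:R :> R ->
  exists2 m : nat, (0 < m)%N && (m%:R * (500 * unit_length r) <= Num.sqrt n%:R) &
   Num.min (K0 * expR (- (469 / 100)) * (n%:R * r ^+ 8)) (K0 * (75 / 10000 * ln n%:R)) <=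
    m%:R ^+ 2 * (n ^_ 5)%:R * ((unit_length r ^+ 2 / n%:R) ^+ 5 *
      (1 - 117 / 25 * r ^+ 2 / n%:R) ^+ n).
Proof.
move=> n0 r0 L0 rL LN; set delta := _ / n%:R => dle Fge.
have N0 : 0 < n%:R :> R by rewrite ltr0n.
set t : R := Num.sqrt n%:R; have t0 : 0 < t by rewrite sqrtr_gt0.
have t2 : t ^+ 2 = n%:R by rewrite sqr_sqrtr// ltW.
have r2L : r ^+ 2 <= 2116 / 10000 * ln n%:R.
  have a0 : 0 <= 46 / 100 * Num.sqrt (ln n%:R) := le_trans (ltW r0) rL.
  apply: le_trans (_ : (46 / 100 * Num.sqrt (ln n%:R)) ^+ 2 <= _).
    by apply: lerXn2r => //; rewrite nnegrE// ltW.
  rewrite exprMn sqr_sqrtr ?(ltW L0)//; apply: ler_wpM2r; [exact: ltW|exact: radius_rate].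
(* A block has side 500 r / 150, so [y] is the exact number of blocks per side, before rounding
   down. *)
pose y := 3 / 10 * (t / r).
have y1 : 1 <= y.
  rewrite /y mulrA ler_pdivlMr// mul1r.
  have p : 0 <= 3 / 10 * t by rewrite mulr_ge0// ltW.
  rewrite -(ler_pXn2r (n := 2)) ?nnegrE ?(ltW r0)// exprMn t2.
  apply: le_trans r2L _; rewrite expr2; lra.
have ye : y * (500 * unit_length r) = t by rewrite /y /unit_length; field; rewrite gt_eqF.
pose m := Num.truncn y.
have /andP[m1 m2] := truncn_itv (le_trans ler01 y1).
have m0 : (0 < m)%N by rewrite /m truncn_ge_nat// (le_trans ler01 y1).
have ul0 : 0 < unit_length r by rewrite /unit_length divr_gt0// ltr0n.
exists m.
  apply/andP; split; first exact: m0.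
  rewrite -/t -ye; apply: ler_wpM2r; last exact: m1.
  by apply: mulr_ge0; [exact: ler0n|exact: ltW].
have mS : m.+1%:R = m%:R + 1 :> R by rewrite natr1.
have m1' : 1 <= m%:R :> R by rewrite ler1n.
(* As y >= 1, rounding down at most halves it; this is the origin of 9/400 = (3/20)^2. *)
have my : y / 2 <= m%:R.
  rewrite -/m mS in m2; rewrite ler_pdivrMr ?ltr0n// mulr_natr mulr2n.
  by apply: le_trans (ltW m2) _; rewrite lerD2l.
have m2y : 9 / 400 * (n%:R / r ^+ 2) <= m%:R ^+ 2.
  apply: le_trans (_ : (y / 2) ^+ 2 <= _).
    rewrite -t2 /y le_eqVlt; apply/orP; left; apply/eqP.
    by field; rewrite gt_eqF.
  by apply: lerXn2r => //; rewrite nnegrE ?ler0n// divr_ge0 ?ler0n// (le_trans ler01).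
have d1 : delta < 1 := le_lt_trans dle thousandth_lt1.
have od : 0 < 1 - delta by rewrite subr_gt0.
have Nd : n%:R * delta = 117 / 25 * r ^+ 2.
  by rewrite /delta mulrC divfK// gt_eqF.
pose E := expR (- (469 / 100 * r ^+ 2)).
have QE : E <= (1 - delta) ^+ n.
  apply: le_trans (_ : expR (- (delta / (1 - delta))) ^+ n <= _); last first.
    apply: lerXn2r; rewrite ?nnegrE ?expR_ge0 ?(ltW od)//; exact: onem_ge_expR.
  rewrite -expRM_natl ler_expR mulrN lerN2 mulrA Nd ler_pdivrMr//.
  exact: (rate_bound (sqr_ge0 r) dle).
have E0 : 0 <= E by exact: expR_ge0.
set S := (X in _ <= X).
have SE : K0 * (n%:R * r ^+ 8 * E) <= S.
  have -> : K0 * (n%:R * r ^+ 8 * E) = 9 / 400 * (n%:R / r ^+ 2) * (n%:R ^+ 5 / 2) *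
      ((unit_length r ^+ 2 / n%:R) ^+ 5 * E).
    by rewrite /K0 /unit_length; field; rewrite !gt_eqF.
  have b0 : 0 <= (unit_length r ^+ 2 / n%:R) ^+ 5.
    by rewrite exprn_ge0// divr_ge0// ?exprn_ge0// ltW.
  have a0 : 0 <= 9 / 400 * (n%:R / r ^+ 2).
    by apply: mulr_ge0; [by rewrite divr_ge0 ?ler0n|apply: divr_ge0; [exact: ltW|exact: sqr_ge0]].
  have c0 : 0 <= n%:R ^+ 5 / 2 :> R.
    by apply: divr_ge0; [apply: exprn_ge0; exact: ltW|exact: ler0n].
  rewrite /S; apply: ler_pM; [exact: mulr_ge0|exact: mulr_ge0|exact: ler_pM|].
  by apply: ler_wpM2l.
have K00 : 0 <= K0.
  by apply: mulr_ge0; [by rewrite divr_ge0 ?ler0n|rewrite invr_ge0; apply: exprn_ge0; exact: ler0n].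
(* For r <= 1 the exponential is at least exp(-4.69). For r > 1 the factor r^8 is dropped and n
   exp(-4.69 r^2) is at least a small power of n, hence at least its logarithm. *)
rewrite ge_min; have [r1|r1] := leP r 1.
  apply/orP; left; apply: le_trans SE.
  rewrite -mulrA ler_wpM2l// mulrC ler_wpM2l//.
    by rewrite mulr_ge0 ?exprn_ge0// ltW.
  rewrite ler_expR lerN2; apply: ler_piMr; first by rewrite divr_ge0 ?ler0n.
  by apply: exprn_ile1; [exact: ltW|exact: r1].
apply/orP; right; apply: le_trans SE; rewrite ler_wpM2l//.
apply: le_trans (_ : expR (75 / 10000 * ln n%:R) <= _).
  by apply: le_trans (expR_ge1Dx _); rewrite lerDr.
apply: le_trans (_ : n%:R * E <= _); last first.
  by rewrite ler_wpM2r// ler_peMr ?(ltW N0)// exprn_ege1// ltW.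
have -> : n%:R * E = expR (ln n%:R - 469 / 100 * r ^+ 2).
  by rewrite expRD lnK.
by rewrite ler_expR; move: (ln n%:R) r2L L0 => l; exact: exponent_bound.
Qed.

End PentagonLimit.

Section ManyPentagons.
Context (R : realType) (d : nat -> measure_display) (T : forall n, measurableType (d n)).
Context (P : forall n, probability (T n) R) (X : forall n, 'I_n -> {RV (P n) >-> plane R}).
Hypothesis X_iid : forall n, (0 < n)%N -> iid_uniform_square (@X n).
Variable r : nat -> R.
Hypothesis r_gt0 : forall n, (0 < n)%N -> 0 < r n.
Hypothesis r_small : \forall n \near \oo, r n <= 46 / 100 * Num.sqrt (ln n%:R).

Let hole_rate : 117 / 25 * (46 / 100) ^+ 2 <= 1 :> R. Proof. by lra. Qed.

Lemma ln_natr_le_sqrt n : (0 < n)%N -> ln n%:R <= 2 * Num.sqrt n%:R :> R.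
Proof.
move=> n0; have t0 : 0 < Num.sqrt n%:R :> R by rewrite sqrtr_gt0 ltr0n.
have -> : ln n%:R = 2 * ln (Num.sqrt n%:R) :> R by rewrite mulr_natl -lnXn// sqr_sqrtr.
rewrite ler_pM2l ?ltr0n//.
by rewrite -[leRHS]lnK ?posrE//; apply: le_trans (expR_ge1Dx _); rewrite lerDr.
Qed.

Lemma cvg_hole : 117 / 25 * r n ^+ 2 / n%:R @[n --> \oo] --> 0.
Proof.
apply: (@squeeze_cvgr _ _ _ _ (fun=> 0) (fun n => 2 * (Num.sqrt n%:R)^-1)).
- near=> n; have n0 : (0 < n)%N by near: n; exact: nbhs_infty_gt.
  have N0 : 0 < n%:R :> R by rewrite ltr0n.
  have L0 : 0 < ln n%:R :> R by near: n; exact: ln_natr_near_gt.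
  have rl : r n <= 46 / 100 * Num.sqrt (ln n%:R) by near: n.
  have c0 : 0 <= 117 / 25 :> R by rewrite divr_ge0 ?ler0n.
  have t0 : 0 < Num.sqrt n%:R :> R by rewrite sqrtr_gt0.
  have a0 : 0 <= 46 / 100 * Num.sqrt (ln n%:R) := le_trans (ltW (r_gt0 n0)) rl.
  apply/andP; split; first by apply: divr_ge0; [apply: mulr_ge0 => //; exact: sqr_ge0|exact: ltW].
  have h : 117 / 25 * r n ^+ 2 <= 2 * Num.sqrt n%:R.
    apply: le_trans (ln_natr_le_sqrt n0).
    apply: le_trans (_ : 117 / 25 * (46 / 100 * Num.sqrt (ln n%:R)) ^+ 2 <= _).
      apply: ler_wpM2l => //; apply: lerXn2r => //; rewrite nnegrE.
      exact/ltW/r_gt0.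
    by rewrite exprMn sqr_sqrtr ?(ltW L0)// mulrA ler_piMl// ltW.
  rewrite ler_pdivrMr//; apply: le_trans h _.
  have tne : Num.sqrt n%:R != 0 :> R by rewrite gt_eqF.
  have -> : 2 * (Num.sqrt n%:R)^-1 * n%:R = 2 * Num.sqrt n%:R :> R.
    rewrite -mulrA; congr (_ * _).
    by apply: (mulfI tne); rewrite mulrA mulfV// mul1r -expr2 sqr_sqrtr// ltW.
  exact: lexx.
- exact: cvg_cst.
- by rewrite -[X in _ --> X](mulr0 2); apply: cvgM; [exact: cvg_cst|exact: cvg_sqrtn_inv].
Unshelve. all: by end_near. Qed.

(** In the bound 2 - 1/S - q^10 the mean S tends to infinity, and q tends to 1 because r^2 / n does
    to 0. *)
Lemma cvg_many_pentagons : n%:R * r n ^+ 8 @[n --> \oo] --> +oo ->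
  pr (P n) [set w : T n | (3 <= chi X r w)%N] @[n --> \oo] --> (1 : R).
Proof.
move=> r8; have hole0 := cvg_hole.
pose K0 : R := 9 / 800 / 150 ^+ 10.
have K00 : 0 < K0 by rewrite divr_gt0 ?divr_gt0 ?exprn_gt0 ?ltr0n.
have r8' M : \forall n \near \oo, M < n%:R * r n ^+ 8 by move/cvgryPgt: r8; apply.
have c1 : 0 < K0 * expR (- (469 / 100)) by apply: mulr_gt0; [|exact: expR_gt0].
have c2 : 0 < K0 * (75 / 10000) by apply: mulr_gt0; [|rewrite divr_gt0 ?ltr0n].
have q1 : ((1 - 117 / 25 * r n ^+ 2 / n%:R)^-1) ^+ 10 @[n --> \oo] --> (1 : R).
  have one10 : 1 = 1^-1 ^+ 10 :> R by rewrite invr1 expr1n.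
  rewrite [X in _ --> X]one10.
  apply: cvg_exprn; apply: cvgV; first exact: oner_neq0.
  by rewrite -[X in _ --> X]subr0; apply: cvgB => //; exact: cvg_cst.
apply/cvgrPdist_lt => e e0.
have e2 : 0 < e / 2 by rewrite divr_gt0// ltr0n.
near=> n.
have n5 : (5 <= n)%N by near: n; exact: nbhs_infty_ge.
have n0 : (0 < n)%N by exact: leq_trans n5.
have N0 : 0 < n%:R :> R by rewrite ltr0n.
have L0 : 0 < ln n%:R :> R by near: n; exact: ln_natr_near_gt.
have rl : r n <= 46 / 100 * Num.sqrt (ln n%:R) by near: n.
have l36 : 36 * ln n%:R <= n%:R :> R by near: n; exact: ln_natr_le_natr.
have dn : 117 / 25 * r n ^+ 2 / n%:R <= 1 / 1000.
  by apply: ltW; near: n; apply: (cvgr_lt _ hole0); rewrite divr_gt0 ?ltr0n.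
have qn : ((1 - 117 / 25 * r n ^+ 2 / n%:R)^-1) ^+ 10 < 1 + e / 2.
  by near: n; apply: (cvgr_lt _ q1); rewrite ltrDl.
have fn : n%:R ^+ 5 / 2 <= (n ^_ 5)%:R :> R.
  have h : 2^-1 < (n ^_ 5)%:R / n%:R ^+ 5 :> R.
    by near: n; apply: (cvgr_gt _ (@cvg_ffact R 5)); rewrite invf_lt1 ?ltr1n ?ltr0n.
  by rewrite ltr_pdivlMr ?exprn_gt0// mulrC in h; exact: ltW.
have [m /andP[m0 mt] mean] := pentagon_mean_bound n0 (r_gt0 n0) L0 rl l36 dn fn.
set S := (X in _ <= X) in mean.
have d1 := le_lt_trans dn (thousandth_lt1 R).
have := pentagon_second_moment n0 (X_iid n0) (r_gt0 n0) mt d1 m0 n5.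
rewrite -/S; set q := _ ^+ 10 in qn *.
have Se : S^-1 < e / 2.
  have Sb : (e / 2)^-1 < S.
    apply: lt_le_trans mean; rewrite lt_min; apply/andP; split.
      rewrite -(ltr_pdivrMl _ _ c1); near: n; exact: r8'.
    rewrite mulrA -(ltr_pdivrMl _ _ c2); near: n; exact: ln_natr_near_gt.
  have i0 : 0 < (e / 2)^-1 by rewrite invr_gt0.
  by rewrite -[ltRHS]invrK ltf_pV2// posrE; exact: lt_trans Sb.
have mU := measurable_chi X r_gt0 (fun k => (3 <= k)%N) n.
have p1 := pr_le1 (P n) mU.
rewrite ger0_norm ?subr_ge0//.
by move=> lower; exact: complement_lt lower qn Se.
Unshelve. all: by end_near. Qed.

End ManyPentagons.

(** * Thresholds *)

Section SparseLimits.
Context (R : realType) (d : nat -> measure_display) (T : forall n, measurableType (d n)).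
Context (P : forall n, probability (T n) R) (X : forall n, 'I_n -> {RV (P n) >-> plane R}).
Hypothesis X_iid : forall n, (0 < n)%N -> iid_uniform_square (@X n).
Variable r : nat -> R.
Hypothesis r_gt0 : forall n, (0 < n)%N -> 0 < r n.

Let chi1 n : set (T n) := [set w | chi X r w = 1%N].
Let mchi n k : measurable [set w : T n | chi X r w = k].
Proof. exact: (measurable_chi X r_gt0 (fun j => j = k)). Qed.
Let mcrowd n : measurable (@crowd R d T P X r n). Proof. exact: measurable_crowded. Qed.

Lemma cvg_prC (A : forall n, set (T n)) (l : R) : (\forall n \near \oo, measurable (A n)) ->
  pr (P n) (A n) @[n --> \oo] --> l -> pr (P n) (~` A n) @[n --> \oo] --> 1 - l.
Proof.
move=> mA h; apply: (cvg_near_eq (v := fun n => 1 - pr (P n) (A n))).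
  by near=> n; rewrite prC//; near: n.
by apply: cvgB => //; exact: cvg_cst.
Unshelve. all: by end_near. Qed.

(** Without crowds and induced C5 the value is 1 or 2, so apart from a vanishing event it is 2
    exactly when it is not 1. *)
Lemma cvg_chi2 (l : R) : n%:R * r n ^+ 8 @[n --> \oo] --> 0 ->
  pr (P n) (@chi1 n) @[n --> \oo] --> l ->
  pr (P n) [set w : T n | chi X r w = 2%N] @[n --> \oo] --> 1 - l.
Proof.
move=> r8 h; apply: (squeeze_diff _ (cvg_no_C5_crowd X_iid r_gt0 r8)); last first.
  by apply: cvg_prC h; near=> n; exact: mchi.
near=> n; have n0 : (0 < n)%N by near: n; exact: nbhs_infty_gt.
apply: pr_diff_le; first exact: mchi.
- by apply: measurableC; exact: mchi.
- by apply: measurableU; [exact: mcrowd|exact: measurable_has_C5].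
move=> w nZ; have nc : ~ crowd X r w by move=> c; apply: nZ; left.
have [_ le2] := chi_uncrowded r_gt0 n0 nc.
have {}le2 := le2 (fun h => nZ (or_intror h)).
have gt0 : (0 < chi X r w)%N by exact: clique_chromatic_gt0.
rewrite /chi1 /=; split=> [-> //|]; move: (chi X r w) gt0 le2 => [|[|[|k]]] //.
Unshelve. all: by end_near. Qed.

Lemma cvg_order8 (c : R) : n%:R * r n ^+ 2 @[n --> \oo] --> c ->
  n%:R * r n ^+ 8 @[n --> \oo] --> 0.
Proof.
move=> rc; have r0 := cvg_radius0 r_gt0 rc.
have -> : (fun n => n%:R * r n ^+ 8) = (fun n => n%:R * r n ^+ 2 * r n ^+ 6).
  by apply/funext => n; rewrite -mulrA -exprD.
rewrite -(mulr0 c); apply: cvgM => //.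
by have := cvg_exprn (k := 6) r0; rewrite expr0n.
Qed.

(** n r^2 is n r^8 divided by r^6, and r tends to 0. *)
Lemma cvg_order2 (c : R) : 0 < c -> n%:R * r n ^+ 8 @[n --> \oo] --> c ->
  n%:R * r n ^+ 2 @[n --> \oo] --> +oo.
Proof.
move=> c0 rc; have r0 := cvg_radius0 r_gt0 rc.
have r6 : r n ^+ 6 @[n --> \oo] --> 0 by have := cvg_exprn (k := 6) r0; rewrite expr0n.
apply/cvgryPgt => M; pose M' := `|M| + 1.
have M'0 : 0 < M' by rewrite ltr_wpDl.
have c2 : c / 2 < c by rewrite ltr_pdivrMr ?ltr0n// ltr_pMr// ltr1n.
have e0 : 0 < c / 2 / M' by rewrite !divr_gt0// ltr0n.
near=> n; have n0 : (0 < n)%N by near: n; exact: nbhs_infty_gt.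
have r6n : 0 < r n ^+ 6 by rewrite exprn_gt0// r_gt0.
have h1 : c / 2 < n%:R * r n ^+ 8 by near: n; exact: (cvgr_gt _ rc) c2.
have h2 : r n ^+ 6 < c / 2 / M' by near: n; exact: (cvgr_lt _ r6) e0.
have MM : M < M' by rewrite (le_lt_trans (ler_norm M))// ltrDl.
apply: lt_trans MM _; rewrite -(ltr_pM2r r6n) -mulrA -exprD.
by apply: lt_trans h1; rewrite mulrC -ltr_pdivlMr.
Unshelve. all: by end_near. Qed.

(** Crowds and edgeless graphs both have vanishing probability; apart from them the value is 3 or 2
    according to whether there is an induced C5. *)
Lemma cvg_C5_threshold (c : R) : 0 < c -> n%:R * r n ^+ 8 @[n --> \oo] --> c ->
  pr (P n) [set w : T n | chi X r w = 2%N] @[n --> \oo] --> expR (- (mu_C5 R * c)) /\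
  pr (P n) [set w : T n | chi X r w = 3%N] @[n --> \oo] --> 1 - expR (- (mu_C5 R * c)).
Proof.
move=> c0 rc; have hC := cvg_no_C5 X_iid r_gt0 rc.
have crowd0 := cvg_crowd X_iid r_gt0 rc.
have chi10 := cvg_edgeless0 X_iid r_gt0 (cvg_order2 c0 rc).
have mC5 n : (0 < n)%N -> measurable (@has_C5 R d T P X r n) by exact: measurable_has_C5.
split.
  apply: (squeeze_diff (z := fun n => pr (P n) (@crowd R d T P X r n) + pr (P n) (@chi1 n)) _ _ hC).
    near=> n; have n0 : (0 < n)%N by near: n; exact: nbhs_infty_gt.
    apply: le_trans (pr_leU _ (mcrowd n) (mchi n 1%N)).
    apply: pr_diff_le; first exact: mchi.
    - by apply: measurableC; exact: mC5.
    - by apply: measurableU; [exact: mcrowd|exact: mchi].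
    move=> w nZ; have nc : ~ crowd X r w by move=> h; apply: nZ; left.
    have n1 : chi X r w <> 1%N by move=> h; apply: nZ; right.
    have [eq3 le2] := chi_uncrowded r_gt0 n0 nc.
    have gt0 : (0 < chi X r w)%N by exact: clique_chromatic_gt0.
    split=> [/= e /eq3|/le2 /=]; first by rewrite e.
    move: (chi X r w) gt0 n1 => [|[|[|k]]] //.
  by rewrite -[X in _ --> X]addr0; apply: cvgD.
have hC5 : pr (P n) (@has_C5 R d T P X r n) @[n --> \oo] --> 1 - expR (- (mu_C5 R * c)).
  under eq_fun do rewrite -[has_C5 X r (n := _)]setCK.
  apply: cvg_prC hC; near=> n; apply: measurableC; apply: mC5.
  near: n; exact: nbhs_infty_gt.
apply: (squeeze_diff _ crowd0 hC5).
near=> n; have n0 : (0 < n)%N by near: n; exact: nbhs_infty_gt.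
apply: pr_diff_le; [exact: mchi|exact: mC5|exact: mcrowd|].
move=> w nc; have [eq3 le2] := chi_uncrowded r_gt0 n0 nc.
by split=> [/= e|/eq3 //]; apply: contrapT => /le2; rewrite e.
Unshelve. all: by end_near. Qed.

End SparseLimits.

Unset Implicit Arguments.

Theorem theorem1p2 (R : realType) (r : nat -> R)
    (d : nat -> measure_display) (T : forall n, measurableType (d n))
    (P : forall n, probability (T n) R)
    (X : forall n, 'I_n -> {RV (P n) >-> plane R})
    (r_gt0 : forall n, (0 < n)%N -> 0 < r n)
    (X_iid : forall n, (0 < n)%N -> iid_uniform_square (X n)) :
  let mu := mu_C5 R in
  let chi_c (n : nat) (w : T n) : nat :=
    clique_chromatic_number (rgg (X n) (r n) w) in
  0 < mu /\
  (n%:R * r n ^+ 2 @[n --> \oo] --> (0 : R) ->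
    P n [set w | chi_c n w = 1%N] @[n --> \oo] --> 1%E) /\
  (forall c : R, 0 < c -> n%:R * r n ^+ 2 @[n --> \oo] --> c ->
    (P n [set w | chi_c n w = 1%N] @[n --> \oo]
       --> (expR (- (pi / 2 * c)))%:E) /\
    (P n [set w | chi_c n w = 2%N] @[n --> \oo]
       --> (1 - expR (- (pi / 2 * c)))%:E)) /\
  (n%:R * r n ^+ 2 @[n --> \oo] --> +oo ->
   n%:R * r n ^+ 8 @[n --> \oo] --> (0 : R) ->
    P n [set w | chi_c n w = 2%N] @[n --> \oo] --> 1%E) /\
  (forall c : R, 0 < c -> n%:R * r n ^+ 8 @[n --> \oo] --> c ->
    (P n [set w | chi_c n w = 2%N] @[n --> \oo]
       --> (expR (- (mu * c)))%:E) /\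
    (P n [set w | chi_c n w = 3%N] @[n --> \oo]
       --> (1 - expR (- (mu * c)))%:E)) /\
  (n%:R * r n ^+ 8 @[n --> \oo] --> +oo ->
   (\forall n \near \oo, r n <= 46 / 100 * Num.sqrt (ln n%:R)) ->
    P n [set w | (3 <= chi_c n w)%N] @[n --> \oo] --> 1%E) /\
  ((\forall n \near \oo, 927 / 100 * Num.sqrt (ln n%:R) <= r n) ->
    P n [set w | chi_c n w = 2%N] @[n --> \oo] --> 1%E).
Proof.
move=> mu chi_c.
have to_ereal (Q : nat -> Prop) (l : R) :
    pr (P n) [set w : T n | Q (chi X r w)] @[n --> \oo] --> l ->
    P n [set w | Q (chi_c n w)] @[n --> \oo] --> l%:E.
  by apply: cvg_pr_ereal => n; exact: (measurable_chi X r_gt0 Q n).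
split; first exact: mu_C5_gt0.
split.
  move=> rc; apply: (to_ereal (fun k => k = 1%N)).
  by have := cvg_no_edge X_iid r_gt0 rc; rewrite !mul0r oppr0 expR0.
split.
  move=> c c0 rc; have h1 := cvg_no_edge X_iid r_gt0 rc.
  have e : pi / 2 * c = c * pi / 2 :> R by rewrite mulrC mulrA.
  rewrite e; split; first exact: (to_ereal (fun k => k = 1%N)).
  apply: (to_ereal (fun k => k = 2%N)); apply: (cvg_chi2 X_iid r_gt0) => //.
  exact: cvg_order8 rc.
split.
  move=> r2 r8; apply: (to_ereal (fun k => k = 2%N)); rewrite -[X in _ --> X]subr0.
  by apply: (cvg_chi2 X_iid r_gt0) => //; exact: cvg_edgeless0.
split.
  move=> c c0 rc; have [h2 h3] := cvg_C5_threshold X_iid r_gt0 c0 rc.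
  by split; [exact: (to_ereal (fun k => k = 2%N))|exact: (to_ereal (fun k => k = 3%N))].
split=> [r8 rl|rl].
  by apply: (to_ereal (fun k => (3 <= k)%N)); exact: cvg_many_pentagons.
by apply: (to_ereal (fun k => k = 2%N)); exact: cvg_dense.
Qed.
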